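(* Let $R_1$ and $R_2$ be two rational functions and let $q(z)$ be a polynomial. Suppose that the equation $$F'=R_1e^{q(z)}F+R_2$$ has a nonconstant meromorphic solution $F$ of finite order. Then $q$ is a constant.
   Context: Meromorphic means meromorphic in the whole complex plane $\mathbb{C}$; the order is the order of growth of a meromorphic function in the sense of Nevanlinna theory.
   Formalization: The rational function R_1 is assumed not identically zero; otherwise the claim fails, e.g. R_1 = 0, R_2 = 1, F(z) = z, q(z) = z. *)

(* Defs.v *)
From mathcomp Require Import all_boot all_order all_algebra.
From mathcomp Require Import all_classical all_reals all_analysis.
From mathcomp Require Import complex.
Set Implicit Arguments.
Unset Strict Implicit.
Unset Printing Implicit Defensive.
Import Order.TTheory GRing.Theory Num.Theory.
Import numFieldNormedType.Exports.
Local Open Scope classical_set_scope.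
Local Open Scope ring_scope.

(* [R[i]] carries no topology of its own; seen as a [numClosedFieldType] it
   gets the one induced by its norm, and [derivable _ z 1] and [derive1] are
   then complex differentiability and the complex derivative. *)
Definition Cplx (R : realType) : numClosedFieldType := R[i].

Section Nevanlinna.
Variable R : realType.
Local Notation C := (Cplx R).

Definition modulus (z : C) : R := Normc.normc z.

Definition cexp (z : C) : C :=
  Complex (expR (complex.Re z) * cos (complex.Im z))
          (expR (complex.Re z) * sin (complex.Im z)).

Definition circle_point (r theta : R) : C :=
  Complex (r * cos theta) (r * sin theta).

Definition holomorphic_at (f : C -> C) (z : C) : Prop :=
  \forall w \near z, derivable f w 1.

Definition pole_of_order (f : C -> C) (z : C) (n : nat) : Prop :=
  (0 < n)%N /\
  exists g : C -> C, [/\ holomorphic_at g z, g z != 0 &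
    \forall w \near z^', f w = g w / (w - z) ^+ n].

Definition pole (f : C -> C) (z : C) : Prop := exists n, pole_of_order f z n.

(* A meromorphic function is encoded as a total function whose values at its
   poles are arbitrary and never used. Removable singularities are excluded:
   at a point that is not a pole, [f] is holomorphic for its actual value. *)
Definition meromorphic (f : C -> C) : Prop :=
  forall z, holomorphic_at f z \/ pole f z.

Definition nonconstant (f : C -> C) : Prop :=
  ~ exists c : C, forall z, ~ pole f z -> f z = c.

(* As [x / 0 = 0] and the fraction is reduced, [f] vanishes at its poles and
   has no spurious value anywhere else. *)
Definition rational_function (f : C -> C) : Prop :=
  exists p d : {poly C},
    [/\ d != 0, coprimep p d & forall z, f z = p.[z] / d.[z]].

(* [0] when [z] is not a pole. *)
Definition pole_mult (f : C -> C) (z : C) : nat := xget 0%N (pole_of_order f z).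

Definition log_plus (x : R) : R := ln (Num.max 1 x).

Local Open Scope ereal_scope.

(* The number n(t, f) of poles in the closed disc of radius t, counted with
   multiplicity. *)
Definition pole_count (f : C -> C) (t : R) : \bar R :=
  esum [set z : C | (modulus z <= t)%R] (fun z => (pole_mult f z)%:R%:E).

(* N(r, f) = \int_0^r (n(t, f) - n(0, f)) / t dt + n(0, f) log r. *)
Definition counting_function (f : C -> C) (r : R) : \bar R :=
  \int[lebesgue_measure]_(t in `]0%R, r])
     ((pole_count f t - pole_count f 0%R) * (t^-1)%:E)
  + pole_count f 0%R * (ln r)%:E.

(* m(r, f) = 1/(2 pi) \int_0^(2 pi) log^+ |f(r e^(i theta))| d theta. *)
Definition proximity_function (f : C -> C) (r : R) : \bar R :=
  ((2 * pi)^-1)%:E *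
  \int[lebesgue_measure]_(theta in `[0%R, (2 * pi)%R])
     (log_plus (modulus (f (circle_point r theta))))%:E.

Definition characteristic (f : C -> C) (r : R) : \bar R :=
  proximity_function f r + counting_function f r.

(* limsup_(r -> +oo) log^+ T(r, f) / log r. *)
Definition order_of_growth (f : C -> C) : \bar R :=
  limf_esup (fun r : R => lne (maxe 1 (characteristic f r)) * ((ln r)^-1)%:E)
            (pinfty_nbhs R).

Definition finite_order (f : C -> C) : Prop := order_of_growth f < +oo.

End Nevanlinna.

(* Main.v *)
(* Away from the roots of the denominators of R1 and R2 the equation forbids
   poles of F, so G = P F is continuous on C for some polynomial P, and it is
   twice complex differentiable off finitely many points.  For such functions
   the maximum modulus principle needs no Cauchy integral: the Taylor expansion
   of order 2 shows that |f|^2 + eps |z|^2 has no interior maximum.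
   Finite order bounds the circle means of log^+ |F| by a power of r, and a
   discretised Poisson integral turns this into |G(z)| <= exp(|z|^K).
   Suppose deg q > 0.  Along a ray where Re q -> +oo, |F| > 1 at a far point
   would make F grow doubly exponentially nearby, so |F| <= 1; along a ray where
   Re q -> -oo the equation yields polynomial growth.  By Phragmen-Lindelof in
   narrow sectors G grows polynomially, hence is a polynomial, and then
   R1 e^q F = F' - R2 makes e^q rational: a contradiction. *)
Require Import Defs.
From mathcomp Require Import all_boot all_order all_algebra.
From mathcomp Require Import all_classical all_reals all_analysis.
From mathcomp Require Import measurable_realfun complex.
From mathcomp Require Import ring lra.
Set Implicit Arguments.
Unset Strict Implicit.
Unset Printing Implicit Defensive.
Import Order.TTheory GRing.Theory Num.Theory.
Import numFieldNormedType.Exports.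
Local Open Scope classical_set_scope.
Local Open Scope ring_scope.

(** * The modulus and the topology of the complex plane *)
Section Modulus.
Context {R : realType}.
Local Notation C := (Cplx R).
Implicit Types z w : C.

(** The obstacle is that [holomorphic_at] supplies one complex derivative only, while an interior
    maximum is excluded by second-order information. The equation itself closes the gap: where [F]
    is differentiable and the denominators do not vanish, its right-hand side is differentiable, so
    [F] has a second derivative. At the roots of the denominators only continuity of [G] is
    available; this is why the principles below carry a polynomial [Q] whose roots are exceptional
    points. Arguments of complex numbers are avoided too: sectors are cut out by signs of real parts
    of iterated squares, so their number [N] is a power of two, and they are indexed by the
    solutions [nu] of [nu ^+ N = kap]. The freedom in [kap] keeps their boundary rays away from the
    finitely many directions in which the leading term of [q] is purely imaginary, where neither of
    the two ray estimates applies. *)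

Lemma normC_modulus z : `|z| = (modulus z)%:C%C.
Proof. by case: z => a b; rewrite normc_def. Qed.

Lemma modulus_ge0 z : 0 <= modulus z.
Proof. by case: z => a b; exact: sqrtr_ge0. Qed.

Lemma modulusM z w : modulus (z * w) = modulus z * modulus w.
Proof. exact: Normc.normcM. Qed.

Lemma modulus0 : modulus (0 : C) = 0.
Proof. exact: Normc.normc0. Qed.

Lemma modulus1 : modulus (1 : C) = 1.
Proof. exact: Normc.normc1. Qed.

Lemma modulus_eq0 z : (modulus z == 0) = (z == 0).
Proof.
apply/eqP/eqP => [/Normc.eq0_normc //|->]; exact: modulus0.
Qed.

Lemma modulus_gt0 z : (0 < modulus z) = (z != 0).
Proof. by rewrite lt_neqAle modulus_ge0 andbT eq_sym modulus_eq0. Qed.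

Lemma modulusV z : modulus z^-1 = (modulus z)^-1.
Proof. exact: Normc.normcV. Qed.

Lemma modulusf_div z w : modulus (z / w) = modulus z / modulus w.
Proof. by rewrite modulusM modulusV. Qed.

Lemma modulusN z : modulus (- z) = modulus z.
Proof. exact: normcN. Qed.

Lemma modulusB z w : modulus (z - w) = modulus (w - z).
Proof. by rewrite -modulusN opprB. Qed.

Lemma modulusX z n : modulus (z ^+ n) = modulus z ^+ n.
Proof.
by elim: n => [|n IH]; rewrite ?expr0 ?modulus1// !exprS modulusM IH.
Qed.

Lemma ler_modulusD z w : modulus (z + w) <= modulus z + modulus w.
Proof. exact: le_normcD. Qed.

Lemma ler_modulus_sub z w : modulus (z - w) <= modulus z + modulus w.
Proof. by rewrite -[X in _ <= _ + X]modulusN; exact: ler_modulusD. Qed.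

Lemma ler_modulus_dist z w : modulus z - modulus w <= modulus (z - w).
Proof. by rewrite lerBlDr -{1}(subrK w z); exact: ler_modulusD. Qed.

Lemma ler_modulus_distD w z t :
  modulus (z - t) <= modulus (z - w) + modulus (w - t).
Proof.
have -> : z - t = (z - w) + (w - t) by rewrite addrA subrK.
exact: ler_modulusD.
Qed.

Lemma modulus_real (x : R) : modulus (x%:C%C : C) = `|x|.
Proof. by rewrite /modulus /= expr0n /= addr0 sqrtr_sqr. Qed.

Lemma modulus_sqr z : modulus z ^+ 2 = complex.Re z ^+ 2 + complex.Im z ^+ 2.
Proof. by case: z => a b; rewrite sqr_sqrtr // addr_ge0 ?sqr_ge0. Qed.

Lemma normr_Re z : `|complex.Re z| <= modulus z.
Proof.
rewrite -(@ler_pXn2r _ 2) ?nnegrE ?modulus_ge0// modulus_sqr.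
by rewrite real_normK ?num_real// lerDl sqr_ge0.
Qed.

Lemma normr_Im z : `|complex.Im z| <= modulus z.
Proof.
rewrite -(@ler_pXn2r _ 2) ?nnegrE ?modulus_ge0// modulus_sqr.
by rewrite real_normK ?num_real// lerDr sqr_ge0.
Qed.

Lemma modulus_le_ReIm z :
  modulus z <= `|complex.Re z| + `|complex.Im z|.
Proof.
rewrite -(@ler_pXn2r _ 2) ?nnegrE ?modulus_ge0 ?addr_ge0// modulus_sqr.
by rewrite sqrrD !real_normK ?num_real// -addrA lerD2l lerDr mulrn_wge0//.
Qed.

Lemma modulus_conj z : modulus (conjc z) = modulus z.
Proof. by case: z => a b; rewrite /modulus /= sqrrN. Qed.

Lemma cReD z w : complex.Re (z + w) = complex.Re z + complex.Re w.
Proof. by case: z; case: w. Qed.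

Lemma cReN z : complex.Re (- z) = - complex.Re z.
Proof. by case: z. Qed.

Lemma cReB z w : complex.Re (z - w) = complex.Re z - complex.Re w.
Proof. by rewrite cReD cReN. Qed.

Lemma cImD z w : complex.Im (z + w) = complex.Im z + complex.Im w.
Proof. by case: z; case: w. Qed.

Lemma cImN z : complex.Im (- z) = - complex.Im z.
Proof. by case: z. Qed.

Lemma cImB z w : complex.Im (z - w) = complex.Im z - complex.Im w.
Proof. by rewrite cImD cImN. Qed.

Lemma cReM z w : complex.Re (z * w) =
  complex.Re z * complex.Re w - complex.Im z * complex.Im w.
Proof. by case: z; case: w. Qed.

Lemma cImM z w : complex.Im (z * w) =
  complex.Re z * complex.Im w + complex.Im z * complex.Re w.
Proof. by case: z => a b; case: w => c d /=; rewrite addrC addrC. Qed.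

Lemma Re_conjM z : complex.Re (conjc z * z) = modulus z ^+ 2.
Proof. by rewrite modulus_sqr cReM; case: z => a b /=; ring. Qed.

(** Balls of [Cplx R] have complex radii, but a positive complex number is real, so real radii
    suffice. *)
Lemma nbhs_modulusP z (P : set C) :
  nbhs z P <-> exists2 d : R, 0 < d & forall w, modulus (w - z) < d -> P w.
Proof.
rewrite -nbhs_ballE; split => [[e /= e0 eP]|[d d0 dP]].
  have eE : e = (complex.Re e)%:C%C by rewrite RRe_real// gtr0_real.
  exists (complex.Re e); first by rewrite -ltcR -eE.
  move=> w wd; apply: eP; rewrite -ball_normE /=.
  by rewrite normC_modulus modulusB eE ltcR.
exists (d%:C%C); first by rewrite /= ltcR.
move=> w; rewrite -ball_normE /= normC_modulus ltcR modulusB; exact: dP.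
Qed.

Lemma dnbhs_modulusP z (P : set C) :
  dnbhs z P <->
  exists2 d : R, 0 < d & forall w, w != z -> modulus (w - z) < d -> P w.
Proof.
rewrite /dnbhs; split => [/nbhs_modulusP[d d0 dP]|[d d0 dP]].
  by exists d => // w wz wd; apply: dP.
by apply/nbhs_modulusP; exists d => // w wd wz; apply: dP.
Qed.

Lemma continuous_modulusP (f : C -> C) z :
  {for z, continuous f} <-> forall e : R, 0 < e -> exists2 d : R, 0 < d &
    forall w, modulus (w - z) < d -> modulus (f w - f z) < e.
Proof.
split => [fc e e0|H].
  have /fc/nbhs_modulusP[d d0 dP] : nbhs (f z) [set y | modulus (y - f z) < e].
    by apply/nbhs_modulusP; exists e.
  by exists d.
move=> P /nbhs_modulusP[e e0 eP]; have [d d0 dP] := H _ e0.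
by apply/nbhs_modulusP; exists d => // w /dP; apply: eP.
Qed.

Lemma lipschitz1_continuous (f : C -> R) :
  (forall z w, `|f z - f w| <= modulus (z - w)) -> continuous f.
Proof.
move=> fL z P /nbhs_ballP[e /= e0 eP]; apply/nbhs_modulusP; exists e => // w wz.
by apply: eP; rewrite -ball_normE /= distrC; apply: le_lt_trans (fL _ _) wz.
Qed.

Lemma continuous_modulus : continuous (@modulus R).
Proof.
apply: lipschitz1_continuous => z w; rewrite ler_norml ler_modulus_dist andbT.
by rewrite lerNl opprB modulusB; exact: ler_modulus_dist.
Qed.

Lemma continuous_Re : continuous (@complex.Re R : C -> R).
Proof. by apply: lipschitz1_continuous => z w; rewrite -cReB normr_Re. Qed.

(** Compactness of the square [[-r, r]^2] is transported to the plane by the continuous map sending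
    [(x, y)] to [Complex x y]. *)
Lemma compact_disc (r : R) (A : set C) :
  closed A -> A `<=` [set z | modulus z <= r] -> compact A.
Proof.
move=> Acl Ar.
pose f (x : R * R) : C := Complex x.1 x.2.
have fc : continuous f.
  move=> x P /nbhs_modulusP[e e0 eP].
  have e20 : 0 < e / 2 by rewrite divr_gt0.
  exists (ball x.1 (e / 2), ball x.2 (e / 2)) => /=.
    by split; exact: nbhsx_ballx.
  move=> y /= [y1 y2]; apply: eP; rewrite /f.
  apply: le_lt_trans (modulus_le_ReIm _) _ => /=.
  move: y1 y2; rewrite -ball_normE /= (distrC x.1) (distrC x.2) => y1 y2.
  by rewrite [e]splitr ltrD.
pose K := f @` (`[-r, r]%classic `*` `[-r, r]%classic).
have Kc : compact K.
  apply: continuous_compact; last first.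
    by apply: compact_setX; exact: segment_compact.
  exact: continuous_subspaceT.
apply: (subclosed_compact Acl Kc) => z /Ar /= zr.
exists (complex.Re z, complex.Im z); last by rewrite /f; case: (z).
split; rewrite /= in_itv /= -ler_norml.
  by apply: le_trans zr; exact: normr_Re.
by apply: le_trans zr; exact: normr_Im.
Qed.

End Modulus.

Arguments modulus : simpl never.

(** * Complex derivatives *)
Section Derivation.

Lemma is_derive_nearP (K : numFieldType) (f : K -> K) (x D : K) :
  is_derive x 1 f D <-> forall e : K, 0 < e ->
    \forall h \near (0 : K), `|f (x + h) - f x - D * h| <= e * `|h|.
Proof.
set g := fun h : K => h^-1 *: ((f \o shift x) (h *: (1 : K)) - f x).
have gE (h : K) : h != 0 -> h * (g h - D) = f (x + h) - f x - D * h.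
  move=> h0; rewrite /g /= mulrBr (mulrC h D); congr (_ - _).
  by rewrite /GRing.scale /= mulr1 mulrA divff// mul1r (addrC h).
split => [[fd fD] e e0|H].
  have /cvgrPdist_le/(_ _ e0) : g h @[h --> 0^'] --> D.
    rewrite -fD; exact: fd.
  rewrite near_withinE; apply: filterS => h hP.
  have [->|h0] := eqVneq h 0; first by rewrite addr0 mulr0 !subrr normr0 mulr0.
  by rewrite -gE// normrM mulrC ler_wpM2r// distrC; exact: hP.
have gD : g h @[h --> 0^'] --> D.
  apply/cvgrPdist_le => e e0; rewrite near_withinE.
  have := H _ e0; apply: filterS => h hP h0.
  rewrite distrC -(ler_pM2r (_ : 0 < `|h|)) ?normr_gt0//.
  by rewrite mulrC -normrM gE.
apply: DeriveDef; first by apply/cvg_ex; exists D.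
exact: cvg_lim.
Qed.

Lemma is_derive_distP (R : realType) (f : R -> R) (x D : R) :
  is_derive x 1 f D <-> forall e : R, 0 < e ->
    exists2 d : R, 0 < d & forall h : R,
      `|h| < d -> `|f (x + h) - f x - D * h| <= e * `|h|.
Proof.
rewrite is_derive_nearP; split => H e e0.
  have /nbhs_ballP[d /= d0 dP] := H e e0; exists d => // h hd.
  by apply: dP; rewrite -ball_normE /= sub0r normrN.
have [d d0 dP] := H e e0; apply/nbhs_ballP; exists d => // h.
by rewrite -ball_normE /= sub0r normrN => /dP.
Qed.

Lemma is_derive1_derivable (K : numFieldType) (f : K -> K) (x D : K) :
  is_derive x 1 f D -> derivable f x 1.
Proof. by case. Qed.

Lemma is_derive_inv (K : numFieldType) (f : K -> K) (x D : K) : f x != 0 ->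
  is_derive x 1 f D -> is_derive x 1 (fun w => (f w)^-1) (- D / f x ^+ 2).
Proof.
move=> f0 [fd fD]; apply: DeriveDef; first exact: derivableV.
by rewrite deriveV// fD /GRing.scale /= mulrC mulrN mulNr.
Qed.

Lemma is_derive_MVT (R : realType) (f df : R -> R) (a b : R) : a <= b ->
  (forall t : R, a <= t <= b -> is_derive t 1 f (df t)) ->
  exists2 c : R, a <= c <= b & f b - f a = df c * (b - a).
Proof.
move=> ab fD.
have fD' (t : R) : t \in `]a, b[%R -> is_derive t 1 f (df t).
  by rewrite in_itv /= => /andP[/ltW ta /ltW tb]; apply: fD; rewrite ta.
have fc : {within `[a, b], continuous f}.
  apply: derivable_within_continuous => t; rewrite in_itv /= => tab.
  exact: is_derive1_derivable (fD _ tab).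
have [c cab cE] := MVT_segment ab fD' fc.
by exists c => //; rewrite in_itv in cab.
Qed.

Context {R : realType}.
Local Notation C := (Cplx R).
Implicit Types (z w h v c D : C) (f g : C -> C).

Lemma is_derive_modulusP f z D :
  is_derive z 1 f D <-> forall e : R, 0 < e -> exists2 d : R, 0 < d &
    forall h, modulus h < d ->
      modulus (f (z + h) - f z - D * h) <= e * modulus h.
Proof.
rewrite is_derive_nearP; split => H e e0.
  have eC0 : 0 < (e%:C%C : C) by rewrite ltcR.
  have /nbhs_modulusP[d d0 dP] := H _ eC0.
  exists d => // h hd; have := dP h; rewrite subr0 => /(_ hd).
  by rewrite !normC_modulus -rmorphM /= lecR.
have eE : e = (complex.Re e)%:C%C by rewrite RRe_real// gtr0_real.
have [|d d0 dP] := H (complex.Re e); first by rewrite -ltcR -eE.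
apply/nbhs_modulusP; exists d => // h; rewrite subr0 => /dP.
by rewrite !normC_modulus [in X in X -> _]eE -lecR rmorphM /= -eE.
Qed.

Lemma is_derive1_unique f z D D' :
  is_derive z 1 f D -> is_derive z 1 f D' -> D = D'.
Proof. by move=> [_ <-] [_ <-]. Qed.

Lemma is_derive1_continuous f z D : is_derive z 1 f D -> {for z, continuous f}.
Proof.
by move=> [fd _]; apply/differentiable_continuous/derivable1_diffP.
Qed.

Lemma is_derive1_eq f g z D D' : is_derive z 1 f D' -> (forall w, g w = f w) ->
  D' = D -> is_derive z 1 g D.
Proof. by move=> fD /funext -> <-. Qed.

Lemma is_derive1D f g z Df Dg : is_derive z 1 f Df -> is_derive z 1 g Dg ->
  is_derive z 1 (fun w => f w + g w) (Df + Dg).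
Proof. exact: is_deriveD. Qed.

Lemma is_derive1N f z Df : is_derive z 1 f Df ->
  is_derive z 1 (fun w => - f w) (- Df).
Proof. exact: is_deriveN. Qed.

Lemma is_derive1B f g z Df Dg : is_derive z 1 f Df -> is_derive z 1 g Dg ->
  is_derive z 1 (fun w => f w - g w) (Df - Dg).
Proof. exact: is_deriveB. Qed.

Lemma is_derive1M f g z Df Dg : is_derive z 1 f Df -> is_derive z 1 g Dg ->
  is_derive z 1 (fun w => f w * g w) (Df * g z + f z * Dg).
Proof.
move=> fD gD; apply: is_derive1_eq (is_deriveM fD gD) _ _ => //.
by rewrite /GRing.scale /= addrC mulrC.
Qed.

Lemma is_derive1V f z Df : f z != 0 -> is_derive z 1 f Df ->
  is_derive z 1 (fun w => (f w)^-1) (- Df / f z ^+ 2).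
Proof. exact: is_derive_inv. Qed.

Lemma is_derive1_comp f g z Df Dg :
  is_derive z 1 f Df -> is_derive (f z) 1 g Dg ->
  is_derive z 1 (fun w => g (f w)) (Dg * Df).
Proof.
move=> /is_derive_modulusP fD /is_derive_modulusP gD.
apply/is_derive_modulusP => e e0.
pose m := modulus Df + 1; pose n := modulus Dg + 1.
have m0 : 0 < m by rewrite ltr_wpDl// modulus_ge0.
have n0 : 0 < n by rewrite ltr_wpDl// modulus_ge0.
have [|d1 d10 gP] := gD (e / 2 / m); first by rewrite !divr_gt0.
have [|d2 d20 fP] := fD (Num.min 1 (e / 2 / n)).
  by rewrite lt_min ltr01 !divr_gt0.
exists (Num.min d2 (d1 / m)); first by rewrite lt_min d20 divr_gt0.
move=> h; rewrite lt_min => /andP[/fP hf hd1].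
set k := f (z + h) - f z.
have kE : f (z + h) = f z + k by rewrite /k [RHS]addrC subrK.
have h0 := modulus_ge0 h.
have kh : modulus k <= m * modulus h.
  rewrite -(subrK (Df * h) k); apply: le_trans (ler_modulusD _ _) _.
  rewrite modulusM mulrDl mul1r addrC lerD2l; apply: le_trans hf _.
  by rewrite ler_piMl// ge_min lexx.
have kd : modulus k < d1.
  by apply: le_lt_trans kh _; rewrite mulrC -ltr_pdivlMr.
rewrite kE.
have -> : g (f z + k) - g (f z) - Dg * Df * h =
  (g (f z + k) - g (f z) - Dg * k) + Dg * (k - Df * h) by ring.
apply: le_trans (ler_modulusD _ _) _; rewrite (splitr e) mulrDl lerD//.
  apply: le_trans (gP _ kd) _.
  by rewrite -mulrA ler_pM2l ?divr_gt0// ler_pdivrMl.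
rewrite modulusM.
apply: (@le_trans _ _ (n * (e / 2 / n * modulus h))).
  rewrite ler_pM ?modulus_ge0 ?lerDl//.
  by apply: le_trans hf _; rewrite ler_wpM2r// ge_min lexx orbT.
by rewrite mulrA mulrCA divff ?gt_eqF// mulr1.
Qed.

Lemma is_derive1_horner (p : {poly C}) z :
  is_derive z 1 (fun w => p.[w]) (p^`()).[z].
Proof.
elim/poly_ind: p => [|p c IH].
  by apply: is_derive1_eq (is_derive_cst 0 z 1) _ _ => [w|];
    rewrite ?deriv0 horner0.
apply: is_derive1_eq
  (is_derive1D (is_derive1M IH (is_derive_id z 1)) (is_derive_cst c z 1)) _ _.
  by move=> w; rewrite hornerMXaddC.
by rewrite derivD derivC derivM derivX addr0 mulr1 !hornerE.
Qed.

Lemma cexpD z w : cexp (z + w) = cexp z * cexp w.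
Proof.
case: z => a b; case: w => c d; rewrite /cexp /= expRD cosD sinD.
by apply/eqP; rewrite eq_complex /=; apply/andP; split; apply/eqP; ring.
Qed.

Lemma cexp0 : cexp 0 = 1 :> C.
Proof. by rewrite /cexp /= expR0 cos0 sin0 mulr1 mulr0. Qed.

Lemma modulus_cexp z : modulus (cexp z) = expR (complex.Re z).
Proof.
apply/eqP; rewrite -(@eqrXn2 _ 2) ?modulus_ge0 ?expR_ge0//.
by rewrite modulus_sqr /= !exprMn -mulrDr cos2Dsin2 mulr1.
Qed.

Lemma cexp_neq0 z : cexp z != 0.
Proof. by rewrite -modulus_gt0 modulus_cexp expR_gt0. Qed.

Lemma is_derive1_cexp z : is_derive z 1 (@cexp R) (cexp z).
Proof.
suff H : forall e : R, 0 < e -> exists2 d : R, 0 < d & forall h : C,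
    modulus h < d -> modulus (cexp h - 1 - h) <= e * modulus h.
  apply/is_derive_modulusP => e e0.
  have c0 : 0 < modulus (cexp z) by rewrite modulus_gt0 cexp_neq0.
  have [|d d0 dP] := H (e / modulus (cexp z)); first by rewrite divr_gt0.
  exists d => // h /dP hP.
  have -> : cexp (z + h) - cexp z - cexp z * h = cexp z * (cexp h - 1 - h).
    by rewrite cexpD; ring.
  by rewrite modulusM -ler_pdivlMl// mulrA (mulrC _ e).
(* By the functional equation only the origin matters. There the real expansions of [expR], [cos]
   and [sin] are combined; the real and the imaginary part each cost at most [3 * (k * h)], whence
   the 6. *)
move=> e e0; pose k := Num.min 1 (e / 6).
have k0 : 0 < k by rewrite lt_min ltr01 divr_gt0.
have k1 : k <= 1 by rewrite ge_min lexx.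
have ke : 6 * k <= e by rewrite mulrC -ler_pdivlMr// ge_min lexx orbT.
have /is_derive_distP/(_ _ k0)[d1 d10 H1] := is_derive_expR (0 : R).
have /is_derive_distP/(_ _ k0)[d2 d20 H2] := is_derive_sin (0 : R).
have /is_derive_distP/(_ _ k0)[d3 d30 H3] := is_derive_cos (0 : R).
exists (Num.min (Num.min d1 (k / 2)) (Num.min d2 d3)).
  by rewrite !lt_min d10 d20 d30 divr_gt0.
case=> x y; rewrite !lt_min => /andP[/andP[h1 hk] /andP[h2 h3]].
have xh : `|x| <= modulus (Complex x y : C) := normr_Re (Complex x y : C).
have yh : `|y| <= modulus (Complex x y : C) := normr_Im (Complex x y : C).
have {}H1 := H1 x (le_lt_trans xh h1).
have {}H2 := H2 y (le_lt_trans yh h2).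
have {}H3 := H3 y (le_lt_trans yh h3).
move: H1 H2 H3; rewrite !add0r expR0 sin0 cos0 !mul1r oppr0 mul0r subr0 addr0.
set h := modulus _ in xh yh h1 hk h2 h3 * => H1 H2 H3.
have ex1 : `|expR x - 1| <= k.
  rewrite -(subrK x (expR x - 1)); apply: le_trans (ler_normD _ _) _.
  have : k * `|x| <= `|x| by rewrite ler_piMl.
  lra.
have ex2 : `|expR x| <= 2.
  rewrite -(subrK 1 (expR x)); apply: le_trans (ler_normD _ _) _.
  rewrite normr1; lra.
apply: le_trans (modulus_le_ReIm _) _.
rewrite !(cReB, cImB) /= subr0.
have -> : expR x * cos y - 1 - x = (expR x - 1 - x) + expR x * (cos y - 1) by
  ring.
have -> : expR x * sin y - y = expR x * (sin y - y) + (expR x - 1) * y by ring.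
have B1 : `|expR x - 1 - x + expR x * (cos y - 1)| <= k * h + 2 * (k * h).
  apply: le_trans (ler_normD _ _) _; rewrite normrM lerD//.
    by apply: le_trans H1 _; rewrite ler_pM2l.
  rewrite ler_pM//; apply: le_trans H3 _; by rewrite ler_pM2l.
have B2 : `|expR x * (sin y - y) + (expR x - 1) * y| <= 2 * (k * h) + k * h.
  apply: le_trans (ler_normD _ _) _; rewrite !normrM lerD//.
    rewrite ler_pM//; apply: le_trans H2 _; by rewrite ler_pM2l.
  by rewrite ler_pM.
have hp : 0 <= h by exact: modulus_ge0.
nra.
Qed.

(** This replaces holomorphy in the maximum principle: a first derivative [f'] near [z] and its
    derivative [f2] at [z] alone, just enough for a Taylor expansion of order 2 at [z]. *)
Definition twice_derivable f z := exists (f' : C -> C) (f2 : C),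
  (\forall w \near z, is_derive (w : C) (1 : C) f (f' w)) /\
  is_derive z 1 f' f2.

Lemma twice_derivable_derive f z : twice_derivable f z ->
  exists D, is_derive z 1 f D.
Proof.
move=> [f' [_ [/nbhs_modulusP[d d0 dP] _]]]; exists (f' z).
by apply: dP; rewrite subrr modulus0.
Qed.

Lemma twice_derivable_continuous f z :
  twice_derivable f z -> {for z, continuous f}.
Proof. by move=> /twice_derivable_derive[D]; exact: is_derive1_continuous. Qed.

Lemma twice_derivable_cst c z : twice_derivable (fun=> c) z.
Proof.
exists (fun=> 0), 0; split; last exact: is_derive_cst.
by apply/nbhs_modulusP; exists 1 => // w _; exact: is_derive_cst.
Qed.

Lemma twice_derivable_horner (p : {poly C}) z :
  twice_derivable (fun w => p.[w]) z.
Proof.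
exists (fun w => (p^`()).[w]), (p^`()^`()).[z].
split; last exact: is_derive1_horner.
by apply/nbhs_modulusP; exists 1 => // w _; exact: is_derive1_horner.
Qed.

Lemma twice_derivableD f g z : twice_derivable f z -> twice_derivable g z ->
  twice_derivable (fun w => f w + g w) z.
Proof.
move=> [f' [f2 [fD f'D]]] [g' [g2 [gD g'D]]].
exists (fun w => f' w + g' w), (f2 + g2); split; last exact: is_derive1D.
by apply: filterS2 fD gD => w; exact: is_derive1D.
Qed.

Lemma twice_derivableN f z : twice_derivable f z ->
  twice_derivable (fun w => - f w) z.
Proof.
move=> [f' [f2 [fD f'D]]].
exists (fun w => - f' w), (- f2); split; last exact: is_derive1N.
by apply: filterS fD => w; exact: is_derive1N.
Qed.

Lemma twice_derivableB f g z : twice_derivable f z -> twice_derivable g z ->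
  twice_derivable (fun w => f w - g w) z.
Proof. by move=> ff /twice_derivableN; exact: twice_derivableD. Qed.

Lemma twice_derivableM f g z : twice_derivable f z -> twice_derivable g z ->
  twice_derivable (fun w => f w * g w) z.
Proof.
move=> Tf Tg; have [Df Dfz] := twice_derivable_derive Tf.
have [Dg Dgz] := twice_derivable_derive Tg; move: Tf Tg.
move=> [f' [f2 [fD f'D]]] [g' [g2 [gD g'D]]].
exists (fun w => f' w * g w + f w * g' w).
exists ((f2 * g z + f' z * Dg) + (Df * g' z + f z * g2)); split.
  by apply: filterS2 fD gD => w; exact: is_derive1M.
exact: is_derive1D (is_derive1M f'D Dgz) (is_derive1M Dfz g'D).
Qed.

Lemma twice_derivableX f n z : twice_derivable f z ->
  twice_derivable (fun w => f w ^+ n) z.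
Proof.
move=> Tf; elim: n => [|n IH]; first exact: twice_derivable_cst.
have -> : (fun w => f w ^+ n.+1) = (fun w => f w * f w ^+ n).
  by apply/funext => w; rewrite exprS.
exact: twice_derivableM.
Qed.

Lemma nbhs_neq0 f z : {for z, continuous f} -> f z != 0 ->
  \forall w \near z, f w != 0.
Proof.
move=> /continuous_modulusP fc f0; have [|d d0 dP] := fc (modulus (f z)).
  by rewrite modulus_gt0.
apply/nbhs_modulusP; exists d => // w /dP.
by apply: contraTneq => ->; rewrite sub0r modulusN ltxx.
Qed.

Lemma twice_derivableV f z : f z != 0 -> twice_derivable f z ->
  twice_derivable (fun w => (f w)^-1) z.
Proof.
move=> f0 Tf; have [Df Dfz] := twice_derivable_derive Tf.
have fn0 := nbhs_neq0 (twice_derivable_continuous Tf) f0.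
move: Tf => [f' [f2 [fD f'D]]].
have VD := is_derive1V f0 Dfz.
exists (fun w => - f' w * ((f w)^-1 * (f w)^-1)).
eexists; split; last exact: is_derive1M (is_derive1N f'D) (is_derive1M VD VD).
apply: filterS2 fD fn0 => w fDw fw0.
by apply: is_derive1_eq (is_derive1V fw0 fDw) _ _; rewrite // expr2 invfM.
Qed.

Lemma twice_derivable_cexp f z : twice_derivable f z ->
  twice_derivable (fun w => cexp (f w)) z.
Proof.
move=> Tf; have [Df Dfz] := twice_derivable_derive Tf.
move: Tf => [f' [f2 [fD f'D]]]; exists (fun w => cexp (f w) * f' w).
eexists; split; last first.
  exact: is_derive1M (is_derive1_comp Dfz (is_derive1_cexp _)) f'D.
by apply: filterS fD => w fDw; apply: is_derive1_comp fDw (is_derive1_cexp _).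
Qed.

End Derivation.

(** * Maximum modulus principle *)
Section MaximumPrinciple.
Context {R : realType}.
Local Notation C := (Cplx R).
Implicit Types (z w h v c D : C) (f g : C -> C).

Lemma cReM_real z (x : R) : complex.Re (z * x%:C%C) = complex.Re z * x.
Proof. by rewrite cReM /= mulr0 subr0. Qed.

Lemma continuousX f n z : {for z, continuous f} ->
  {for z, continuous (fun w => f w ^+ n)}.
Proof.
move=> fc; elim: n => [|n IH]; first exact: cst_continuous.
rewrite (_ : (fun w => _) = (fun w => f w * f w ^+ n)); last first.
  by apply/funext => w; rewrite exprS.
exact: (continuousM fc IH).
Qed.

Lemma is_derive_line f z v c D (s : R) :
  is_derive (z + s%:C%C * v) 1 f D ->
  is_derive s 1 (fun t : R => complex.Re (c * f (z + t%:C%C * v)))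
    (complex.Re (c * D * v)).
Proof.
move=> /is_derive_modulusP fD; apply/is_derive_distP => e e0.
pose m := modulus c + 1; pose n := modulus v + 1.
have m0 : 0 < m by rewrite ltr_wpDl// modulus_ge0.
have n0 : 0 < n by rewrite ltr_wpDl// modulus_ge0.
have [|d d0 dP] := fD (e / n / m); first by rewrite !divr_gt0.
exists (d / n); first by rewrite divr_gt0.
move=> h hd; have vh : modulus (h%:C%C * v) <= n * `|h|.
  by rewrite modulusM modulus_real mulrC ler_wpM2r// lerDl.
have {}dP := dP _ (le_lt_trans vh _).
rewrite mulrC -ltr_pdivlMr// in dP; have {}dP := dP hd.
rewrite -!cReB.
have -> : complex.Re (c * D * v) * h = complex.Re (c * (D * (h%:C%C * v))).
  by rewrite -cReM_real; congr complex.Re; ring.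
rewrite -cReB -!mulrBr; apply: le_trans (normr_Re _) _; rewrite modulusM.
rewrite rmorphD /= mulrDl addrA.
apply: (@le_trans _ _ (m * (e / n / m * (n * `|h|)))).
  rewrite ler_pM ?modulus_ge0 ?lerDl//.
  by apply: le_trans dP _; rewrite ler_pM2l// !divr_gt0.
rewrite le_eqVlt; apply/orP; left; apply/eqP.
by field; rewrite !gt_eqF.
Qed.

(** The real mean value theorem is applied to the real part of [conjc D * f] along the segment, [D]
    being the total increment of [f]: the increment of that function is then [modulus D ^+ 2]. *)
Lemma modulus_mean_value f (f' : C -> C) z h (M : R) :
  (forall t : R, 0 <= t <= 1 ->
     is_derive (z + t%:C%C * h) 1 f (f' (z + t%:C%C * h)) /\
     modulus (f' (z + t%:C%C * h)) <= M) ->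
  modulus (f (z + h) - f z) <= M * modulus h.
Proof.
move=> fM; set D := f (z + h) - f z.
have [->|D0] := eqVneq D 0.
  rewrite modulus0 mulr_ge0 ?modulus_ge0//.
  by apply: le_trans (modulus_ge0 _) (fM 0 _).2; rewrite lexx ler01.
pose phi := fun t : R => complex.Re (conjc D * f (z + t%:C%C * h)).
pose dphi := fun t : R => complex.Re (conjc D * f' (z + t%:C%C * h) * h).
have phiD (t : R) : 0 <= t <= 1 -> is_derive t 1 phi (dphi t).
  by move=> t01; apply: is_derive_line; exact: (fM _ t01).1.
have [s s01] := is_derive_MVT ler01 phiD.
rewrite subr0 mulr1 /phi rmorph1 mul1r rmorph0 mul0r addr0 -cReB -mulrBr.
rewrite -/D Re_conjM => DE.
have Dp : 0 < modulus D by rewrite modulus_gt0.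
rewrite -(ler_pM2l Dp) -expr2 DE /dphi.
apply: le_trans (ler_norm _) _; apply: le_trans (normr_Re _) _.
rewrite -mulrA !modulusM modulus_conj ler_pM2l// ler_wpM2r ?modulus_ge0//.
exact: (fM _ s01).2.
Qed.

Lemma twice_derivable_taylor f z : twice_derivable f z ->
  exists b c : C, forall e : R, 0 < e -> exists2 d : R, 0 < d &
    forall h, modulus h < d ->
      modulus (f (z + h) - (f z + b * h + c * h ^+ 2)) <= e * modulus h ^+ 2.
Proof.
move=> [f' [k [/nbhs_modulusP[r r0 fD] /is_derive_modulusP f'D]]].
exists (f' z), (k / 2) => e e0; have [d d0 dP] := f'D _ e0.
exists (Num.min r d) => [|h]; first by rewrite lt_min r0.
rewrite lt_min => /andP[hr hd].
(* [g] is [f] minus its linear and quadratic terms; its derivative [g'] is the first-order remainder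
   of [f'], of size at most [e * modulus h] on the segment, so the mean value inequality yields the
   second factor [modulus h]. *)
pose g w := f w - (f' z * (w - z) + k / 2 * (w - z) ^+ 2).
pose g' w := f' w - f' z - k * (w - z).
have gD w : modulus (w - z) < r -> is_derive w 1 g (g' w).
  move=> wr.
  have wD : is_derive w 1 (fun w : C => w - z) (1 : C).
    apply: is_derive1_eq (is_derive1B (is_derive_id w 1) (is_derive_cst z w 1))
      _ _ => //.
    by rewrite subr0.
  have zD := is_derive_cst (f' z) w 1.
  have kD := is_derive_cst (k / 2) w 1.
  have := is_derive1B (fD _ wr) (is_derive1D (is_derive1M zD wD)
    (is_derive1M kD (is_derive1M wD wD))).
  move=> H; apply: is_derive1_eq H _ _ => [u|]; rewrite /g ?expr2//.
  rewrite /g' /cst; by field.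
rewrite (_ : f (z + h) - _ = g (z + h) - g z); last first.
  by rewrite /g; ring.
rewrite expr2 mulrA; apply: (modulus_mean_value (f' := g')) => t /andP[t0 t1].
have th : modulus (t%:C%C * h) <= modulus h.
  by rewrite modulusM modulus_real ger0_norm// ler_piMl// modulus_ge0.
have zK (u : C) : z + u - z = u by rewrite addrAC subrr add0r.
split; first by apply: gD; rewrite zK (le_lt_trans th).
rewrite /g' zK; apply: le_trans (dP _ (le_lt_trans th hd)) _.
by rewrite ler_pM2l.
Qed.

(* The four points [z + t i^k] are orthogonal to the linear and quadratic terms
   of the Taylor expansion, which replaces the Laplacian of [|f|^2]. *)
Lemma twice_derivable_no_local_max f z (eps : R) : 0 < eps ->
  twice_derivable f z ->
  ~ \forall w \near z, modulus (f w) ^+ 2 + eps * modulus w ^+ 2 <=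
                       modulus (f z) ^+ 2 + eps * modulus z ^+ 2.
Proof.
move=> eps0 /twice_derivable_taylor[b [c H]] /nbhs_modulusP[r r0 rP].
move: (f z) H rP => a H rP.
pose M := modulus a + modulus b + modulus c + 1.
have [Ma0 Mb0 Mc0] := And3 (modulus_ge0 a) (modulus_ge0 b) (modulus_ge0 c).
have M0 : 0 < M by rewrite /M; lra.
(* [M] bounds the Taylor polynomial for steps of length at most 1, so this tolerance changes squared
   moduli by at most [eps / 2 * t ^+ 2], half of what the term [eps * modulus z ^+ 2] gains on
   average. *)
have [|d d0 dP] := H (eps / (4 * M)); first by rewrite divr_gt0// mulr_gt0.
pose t : R := Num.min 1 (Num.min r d) / 2.
have t0 : 0 < t by rewrite divr_gt0// !lt_min ltr01 r0.
have [t1 tr td] : [/\ t <= 1, t < r & t < d].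
  have : Num.min 1 (Num.min r d) <= 1 by rewrite ge_min lexx.
  have : Num.min 1 (Num.min r d) <= r by rewrite !ge_min lexx orbT.
  have : Num.min 1 (Num.min r d) <= d by rewrite !ge_min lexx !orbT.
  by rewrite /t; split; lra.
have key h : modulus h = t ->
    modulus (a + b * h + c * h ^+ 2) ^+ 2 - eps / 2 * t ^+ 2
      + eps * modulus (z + h) ^+ 2 <= modulus a ^+ 2 + eps * modulus z ^+ 2.
  move=> ht; have := rP (z + h); rewrite addrAC subrr add0r ht => /(_ tr).
  apply: le_trans; rewrite lerD2r.
  have := dP h; rewrite ht => /(_ td).
  set T := a + b * h + c * h ^+ 2; rewrite modulusB => rT.
  have TM : modulus T <= M.
    apply: le_trans (ler_modulusD _ _) _.
    apply: (@le_trans _ _ (modulus a + modulus b + modulus c)); last first.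
      by rewrite lerDl.
    rewrite lerD//.
      apply: le_trans (ler_modulusD _ _) _; rewrite lerD2l modulusM ht.
      by rewrite ler_piMr.
    by rewrite modulusM modulusX ht ler_piMr// exprn_ile1// ltW.
  have Tf : modulus T - modulus (f (z + h)) <= eps / (4 * M) * t ^+ 2.
    by apply: le_trans (ler_modulus_dist _ _) rT.
  set F := modulus (f (z + h)) in Tf *.
  have F0 : 0 <= F := modulus_ge0 _.
  have T0 : 0 <= modulus T := modulus_ge0 _.
  set s := eps / (4 * M) * t ^+ 2 in Tf.
  have s0 : 0 <= s by rewrite mulr_ge0 ?sqr_ge0// divr_ge0 ?mulr_ge0 ?ltW.
  have -> : eps / 2 * t ^+ 2 = 2 * M * s.
    by rewrite /s; field; rewrite gt_eqF.
  have [FT|FT] := leP (modulus T) F.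
    have : modulus T ^+ 2 <= F ^+ 2 by rewrite ler_sqr ?nnegrE.
    have : 0 <= M * s by rewrite mulr_ge0// ltW.
    lra.
  have : (modulus T - F) * (modulus T + F) <= s * (2 * M).
    by rewrite ler_pM ?subr_ge0 ?addr_ge0//; lra.
  by rewrite -subr_sqr; lra.
have k1 := key (Complex t 0); have k2 := key (Complex (- t) 0).
have k3 := key (Complex 0 t); have k4 := key (Complex 0 (- t)).
have m1 : modulus (Complex t 0 : C) = t.
  by rewrite /modulus /= expr0n addr0 sqrtr_sqr ger0_norm// ltW.
have m2 : modulus (Complex (- t) 0 : C) = t.
  by rewrite /modulus /= expr0n addr0 sqrrN sqrtr_sqr ger0_norm// ltW.
have m3 : modulus (Complex 0 t : C) = t.
  by rewrite /modulus /= expr0n add0r sqrtr_sqr ger0_norm// ltW.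
have m4 : modulus (Complex 0 (- t) : C) = t.
  by rewrite /modulus /= expr0n add0r sqrrN sqrtr_sqr ger0_norm// ltW.
(* In the sum of the four inequalities the cross terms cancel; the left side exceeds the right one
   by [4 |b|^2 t^2 + 4 |c|^2 t^4 + 2 eps t^2], which is positive. *)
move: {k1 k2 k3 k4} (k1 m1) (k2 m2) (k3 m3) (k4 m4).
rewrite !modulus_sqr !(cReD, cImD, cReM, cImM, expr2).
move: a b c z {H rP M Ma0 Mb0 Mc0 M0 dP key m1 m2 m3 m4} =>
  [a1 a2] [b1 b2] [c1 c2] [z1 z2] /=.
have : 0 < eps * t ^+ 2 by rewrite mulr_gt0// exprn_gt0.
have := sqr_ge0 (b1 * t); have := sqr_ge0 (b2 * t).
have := sqr_ge0 (c1 * t ^+ 2); have := sqr_ge0 (c2 * t ^+ 2).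
move=> h1 h2 h3 h4 h5 h6 h7 h8 h9; lra.
Qed.

Lemma maximum_modulus0 (K : set C) f (B : R) : 0 <= B -> compact K ->
  (forall z, K z -> {for z, continuous f}) ->
  (forall z, K z -> modulus (f z) <= B \/ (nbhs z K /\ twice_derivable f z)) ->
  forall z, K z -> modulus (f z) <= B.
Proof.
move=> B0 Kc fc KB z1 Kz1; rewrite leNgt; apply/negP => fz1.
have sqc (g : C -> R) : {in K, forall z, {for z, continuous g}} ->
    {in K, forall z, {for z, continuous (fun w => g w ^+ 2)}}.
  by move=> gc z Kz; exact: (continuousM (gc z Kz) (gc z Kz)).
have mc : {in K, forall z, {for z, continuous (fun w : C => modulus w ^+ 2)}}.
  by apply: sqc => z _; exact: continuous_modulus.
have fmc : {in K, forall z, {for z, continuous (fun w : C =>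
  modulus (f w) ^+ 2)}}.
  apply: sqc => z /set_mem Kz; apply: continuous_comp; first exact: fc.
  exact: continuous_modulus.
have withinc (g : C -> R) : {in K, forall z, {for z, continuous g}} ->
    {within K, continuous g}.
  by move=> gc; apply: continuous_in_subspaceT => z Kz; exact: gc.
have K0 : K !=set0 by exists z1.
have [zm _ zmP] := compact_EVT_max K0 Kc (withinc _ mc).
(* [M] exceeds the largest [|z|^2] on [K], so with this [eps] the perturbation stays below the
   excess of [|f z1|^2] over [B^2]: the maximum of [u] cannot be attained where [|f| <= B]. *)
pose M := modulus zm ^+ 2 + 1.
have M0 : 0 < M by rewrite ltr_wpDl ?sqr_ge0.
pose eps := (modulus (f z1) ^+ 2 - B ^+ 2) / M.
have eps0 : 0 < eps.
  by rewrite divr_gt0// subr_gt0 ltr_sqr// nnegrE modulus_ge0.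
pose u w := modulus (f w) ^+ 2 + eps * modulus w ^+ 2.
have uc : {within K, continuous u}.
  apply: withinc => z Kz; apply: continuousD; first exact: fmc.
  by apply: continuousM; [exact: cst_continuous|exact: mc].
have [z /set_mem Kz zP] := compact_EVT_max K0 Kc uc.
case: (KB _ Kz) => [fzB|[zK fT]].
  have := zP _ (mem_set Kz1); have := zmP _ (mem_set Kz).
  have : modulus (f z) ^+ 2 <= B ^+ 2 by rewrite ler_sqr ?nnegrE ?modulus_ge0.
  rewrite /u => h1 h2 h3.
  have : eps * modulus z ^+ 2 <= eps * (M - 1) by rewrite ler_pM2l// /M addrK.
  have : eps * M = modulus (f z1) ^+ 2 - B ^+ 2 by rewrite /eps divfK// gt_eqF.
  have : 0 <= eps * modulus z1 ^+ 2 by rewrite mulr_ge0 ?sqr_ge0// ltW.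
  move: eps0; clearbody eps; lra.
apply: (twice_derivable_no_local_max eps0 fT).
by apply: filterS zK => w Kw; apply: zP; exact: mem_set.
Qed.

Lemma poly_nbhs_neq0 (Q : {poly C}) z : Q != 0 ->
  \forall w \near z^', Q.[w] != 0.
Proof.
move=> Q0; have [n [q qz QE]] := multiplicity_XsubC Q z.
rewrite Q0 /= in qz.
have /is_derive1_continuous/continuous_modulusP qc := is_derive1_horner q z.
have [|d d0 dP] := qc (modulus q.[z]); first by rewrite modulus_gt0.
apply/dnbhs_modulusP; exists d => // w wz wd.
rewrite QE hornerM mulf_neq0//.
  apply: contraTneq (dP _ wd) => ->.
  by rewrite sub0r modulusN ltxx.
by rewrite horner_exp expf_neq0// hornerXsubC subr_eq0.
Qed.

(* Exceptional points of [f], roots of [Q], are removed by applying the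
   previous lemma to [Q f^n], which vanishes there, and letting [n] grow. *)
Lemma maximum_modulus (K : set C) f (Q : {poly C}) (B : R) :
  0 <= B -> compact K -> Q != 0 ->
  (forall z, K z -> {for z, continuous f}) ->
  (forall z, K z -> Q.[z] != 0 -> twice_derivable f z) ->
  (forall z, K z -> modulus (f z) <= B \/ nbhs z K) ->
  forall z, K z -> modulus (f z) <= B.
Proof.
move=> B0 Kc Q0 fc fT KB.
have Qc z : {for z, continuous (fun w => Q.[w])}.
  exact: is_derive1_continuous (is_derive1_horner Q z).
have mQc : {within K, continuous (fun w => modulus Q.[w])}.
  apply: continuous_in_subspaceT => z _.
  by apply: continuous_comp; [exact: Qc|exact: continuous_modulus].
(* Roots of [Q] are limits of non-roots, so continuity of [f] carries the bound to them. The strict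
   inequality [B < B'] leaves room for this limit and makes [B'] positive, hence invertible. *)
suff main B' z : B < B' -> K z -> Q.[z] != 0 -> modulus (f z) <= B'.
  move=> z Kz; rewrite leNgt; apply/negP => Bf.
  case: (KB _ Kz) => [|zK]; first by rewrite leNgt Bf.
  pose B' := (B + modulus (f z)) / 2.
  have BB' : B < B' by rewrite /B'; lra.
  have B'f : B' < modulus (f z) by rewrite /B'; lra.
  have /continuous_modulusP/(_ (modulus (f z) - B'))[|d d0 dP] := fc _ Kz.
    by rewrite subr_gt0.
  have fw : \forall w \near z^', B' < modulus (f w).
    apply/dnbhs_modulusP; exists d => // w _ /dP; rewrite modulusB.
    by have := ler_modulus_dist (f z) (f w); lra.
  have [w []] : exists w : C, [/\ K w, Q.[w] != 0 & B' < modulus (f w)].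
    suff : \forall w \near z^', [/\ K w, Q.[w] != 0 & B' < modulus (f w)].
      by move=> /filter_ex.
    have Kw : \forall w \near z^', K w by apply: nbhs_dnbhs.
    by apply: filterS3 Kw (poly_nbhs_neq0 z Q0) fw.
  by move=> Kw Qw; rewrite ltNge main.
move=> BB' Kz Qz; have B'0 : 0 < B' by apply: le_lt_trans BB'.
have [zm _ zmP] := compact_EVT_max (ex_intro _ z Kz) Kc mQc.
pose D := modulus Q.[zm].
have bound n : modulus (f z) ^+ n * modulus Q.[z] <= B' ^+ n * D.
  case: n => [|n]; first by rewrite !expr0 !mul1r zmP// mem_set.
  rewrite -modulusX -modulusM.
  refine (@maximum_modulus0 K (fun w => f w ^+ n.+1 * Q.[w]) (B' ^+ n.+1 * D)
    _ Kc _ _ z Kz).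
  - by rewrite mulr_ge0 ?exprn_ge0 ?modulus_ge0// ltW.
  - move=> w Kw; exact: (continuousM (continuousX (n :=
    n.+1) (fc w Kw)) (Qc w)).
  move=> w Kw; have [Qw|Qw] := eqVneq Q.[w] 0.
    left; rewrite Qw mulr0 modulus0.
    by rewrite mulr_ge0 ?exprn_ge0 ?modulus_ge0// ltW.
  case: (KB _ Kw) => [fB|wK].
    left; rewrite modulusM modulusX ler_pM ?exprn_ge0 ?modulus_ge0//.
      by rewrite lerXn2r ?nnegrE ?modulus_ge0 ?ltW// (le_lt_trans fB).
    by rewrite zmP// mem_set.
  right; split=> //; apply: twice_derivableM.
    by apply: twice_derivableX; exact: fT.
  exact: twice_derivable_horner.
rewrite leNgt; apply/negP => B'f.
(* By [bound], [(modulus (f z) / B') ^+ n] stays below [D / modulus Q.[z]] for all [n], whereas by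
   Bernoulli it is at least [n * x]. *)
pose x := modulus (f z) / B' - 1.
have x0 : 0 < x by rewrite subr_gt0 ltr_pdivlMr// mul1r.
have Qz0 : 0 < modulus Q.[z] by rewrite modulus_gt0.
have D0 : 0 <= D := modulus_ge0 _.
have [n nD] : exists n : nat, D / modulus Q.[z] / x < n%:R.
  by exists (Num.truncn (D / modulus Q.[z] / x)).+1; rewrite truncnS_gt.
rewrite ltr_pdivrMr// ltr_pdivrMr// in nD.
have bernoulli : n%:R * x <= (modulus (f z) / B') ^+ n.
  have -> : modulus (f z) / B' = 1 + x by rewrite /x; ring.
  elim: n {nD} => [|n IH]; first by rewrite mul0r expr0 ler01.
  have : 1 <= (1 + x) ^+ n by rewrite exprn_ege1// lerDl ltW.
  by rewrite exprS -natr1; nra.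
have := bound n; rewrite -ler_pdivrMl ?exprn_gt0// mulrA -exprVn -exprMn mulrC.
rewrite (mulrC _^-1) leNgt => /negP; apply.
by apply: lt_le_trans nD _; rewrite (mulrC _ (modulus Q.[z])) ler_pM2l.
Qed.

End MaximumPrinciple.

(** * Liouville theorem *)
Section Liouville.
Context {R : realType}.
Local Notation C := (Cplx R).
Implicit Types (z w b D : C) (f g : C -> C).

Lemma closed_sublevel (g : C -> R) (r : R) : continuous g ->
  closed [set z | g z <= r].
Proof.
move=> gc; apply: (@closed_comp _ _ g [set x | x <= r]) => [z _|].
  exact: gc.
exact: closed_le.
Qed.

Lemma nbhs_disc z (r : R) : modulus z < r -> nbhs z [set w | modulus w <= r].
Proof.
move=> zr; apply/nbhs_modulusP; exists (r - modulus z);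
  first by rewrite subr_gt0.
move=> w /= wz; have := ler_modulus_dist w z; lra.
Qed.

Lemma maximum_modulus_disc f (Q : {poly C}) (B r : R) : 0 <= B -> Q != 0 ->
  (forall z, modulus z <= r -> {for z, continuous f}) ->
  (forall z, modulus z <= r -> Q.[z] != 0 -> twice_derivable f z) ->
  (forall z, modulus z = r -> modulus (f z) <= B) ->
  forall z, modulus z <= r -> modulus (f z) <= B.
Proof.
move=> B0 Q0 fc fT fB.
have cK : compact [set z : C | modulus z <= r].
  apply: (@compact_disc _ r) => //.
  exact: closed_sublevel continuous_modulus.
apply: (maximum_modulus B0 cK Q0 fc fT) => z; rewrite /= le_eqVlt.
by move=> /orP[/eqP/fB|/nbhs_disc]; [left|right].
Qed.

Lemma near_eq_continuous f g z : (\forall w \near z, f w = g w) ->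
  {for z, continuous f} -> {for z, continuous g}.
Proof.
move=> /nbhs_modulusP[r r0 fg] /continuous_modulusP fc.
apply/continuous_modulusP => e e0; have [d d0 dP] := fc e e0.
have fgz : f z = g z by apply: fg; rewrite subrr modulus0.
exists (Num.min r d) => [|w]; first by rewrite lt_min r0.
by rewrite lt_min => /andP[wr wd]; rewrite -fgz -fg//; exact: dP.
Qed.

Lemma near_eq_is_derive1 f g z D : (\forall w \near z, f w = g w) ->
  is_derive z 1 f D -> is_derive z 1 g D.
Proof. exact: near_eq_is_derive. Qed.

Lemma near_eq_twice_derivable f g z : (\forall w \near z, f w = g w) ->
  twice_derivable f z -> twice_derivable g z.
Proof.
move=> /nbhs_modulusP[r r0 fg] [f' [f2 [/nbhs_modulusP[d d0 fD] f'D]]].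
exists f', f2; split=> //; apply/nbhs_modulusP.
exists (Num.min r d) => [|w]; first by rewrite lt_min r0.
rewrite lt_min => /andP[wr wd]; apply: near_eq_is_derive1 (fD _ wd).
apply/nbhs_modulusP; exists (r - modulus (w - z)); first by rewrite subr_gt0.
by move=> u uw; apply: fg; have := ler_modulus_distD w u z; lra.
Qed.

Lemma nbhs_neq z b : z != b -> \forall w \near z, w != b.
Proof.
move=> zb; have zc : {for z, continuous (fun w : C => w - b)}.
  exact: is_derive1_continuous
    (is_derive1B (is_derive_id z 1) (is_derive_cst b z 1)).
have : \forall w \near z, w - b != 0.
  by apply: nbhs_neq0 => //; rewrite subr_eq0.
by apply: filterS => w; rewrite subr_eq0.
Qed.

Definition divided_difference f D b z :=
  if z == b then D else (f z - f b) / (z - b).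

Lemma divided_differenceE f D b z : z != b ->
  \forall w \near z, (f w - f b) / (w - b) = divided_difference f D b w.
Proof.
move=> /nbhs_neq; apply: filterS => w /negbTE wb.
by rewrite /divided_difference wb.
Qed.

Lemma divided_difference_twice_derivable f D b z : z != b ->
  twice_derivable f z -> twice_derivable (divided_difference f D b) z.
Proof.
move=> zb fT; apply: near_eq_twice_derivable (divided_differenceE f D zb) _.
have T1 := twice_derivableB fT (twice_derivable_cst (f b) z).
have T2 : twice_derivable (fun w : C => w - b) z.
  have := twice_derivable_horner ('X - b%:P) z.
  rewrite (_ : (fun w => _) = (fun w : C => w - b))//.
  by apply/funext => w; rewrite hornerXsubC.
by apply: twice_derivableM T1 (twice_derivableV _ T2); rewrite subr_eq0.
Qed.

Lemma divided_difference_continuous f D b z : is_derive b 1 f D ->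
  {for z, continuous f} -> {for z, continuous (divided_difference f D b)}.
Proof.
move=> /is_derive_modulusP fD fc; have [->|zb] := eqVneq z b.
  apply/continuous_modulusP => e e0; have [|d d0 dP] := fD (e / 2).
    by rewrite divr_gt0.
  exists d => // w wd; rewrite /divided_difference eqxx.
  have [_|wb] := eqVneq w b; first by rewrite subrr modulus0.
  have wb0 : w - b != 0 by rewrite subr_eq0.
  have bw : b + (w - b) = w by rewrite addrCA subrr addr0.
  have := dP _ wd; rewrite bw => H.
  have -> : (f w - f b) / (w - b) - D = (f w - f b - D * (w - b)) / (w - b).
    by field.
  rewrite modulusf_div ltr_pdivrMr ?modulus_gt0//.
  apply: le_lt_trans H _; rewrite ltr_pM2r ?modulus_gt0//; lra.
apply: near_eq_continuous (divided_differenceE f D zb) _.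
have bc : {for z, continuous (fun w : C => (w - b)^-1)}.
  have zb0 : z - b != 0 by rewrite subr_eq0.
  have wD : is_derive z 1 (fun w : C => w - b) (1 - 0).
    exact: is_derive1B (is_derive_id z 1) (is_derive_cst b z 1).
  exact: is_derive1_continuous (is_derive1V (f := fun w => w - b) zb0 wD).
have fbc : {for z, continuous (fun w => f w - f b)}.
  exact: (continuousB fc (@cst_continuous _ _ (f b) z)).
exact: (continuousM fbc bc).
Qed.

(** On a circle of radius at least [A / e] the modulus is at most [e], and the maximum principle
    carries this bound to every point inside. *)
Lemma vanishing_liouville f (Q : {poly C}) (A r0 : R) : Q != 0 ->
  (forall z, {for z, continuous f}) ->
  (forall z, Q.[z] != 0 -> twice_derivable f z) ->
  (forall z, r0 <= modulus z -> modulus z * modulus (f z) <= A) ->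
  forall z, f z = 0.
Proof.
move=> Q0 fc fT fA z; apply/eqP; rewrite -modulus_eq0 eq_le modulus_ge0 andbT.
apply/ler_addgt0Pr => e e0; rewrite add0r.
pose r := Num.max (Num.max r0 (modulus z)) (Num.max 1 (A / e)).
have [rr0 zr r1 rA] : [/\ r0 <= r, modulus z <= r, 1 <= r & A / e <= r].
  by rewrite /r !le_max !lexx ?orbT.
apply: (maximum_modulus_disc (ltW e0) Q0 _ _ _ zr) => [w _|w _|w wr].
- exact: fc.
- exact: fT.
have r_gt0 : 0 < r by apply: lt_le_trans r1.
have := fA w; rewrite wr => /(_ rr0) H.
rewrite -(ler_pM2l r_gt0); apply: le_trans H _.
by rewrite -ler_pdivrMr.
Qed.

(* Only the decay of [f] matters, so each division by [z - b] may be done at a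
   fresh regular point [b], which then joins the exceptional set. *)
Lemma polynomial_growth_liouville (n : nat) f (Q : {poly C}) (A r0 : R) :
  Q != 0 -> (forall z, {for z, continuous f}) ->
  (forall z, Q.[z] != 0 -> twice_derivable f z) ->
  (forall z, r0 <= modulus z -> modulus z * modulus (f z) <= A * modulus z ^+
    n) ->
  exists p : {poly C}, forall z, f z = p.[z].
Proof.
elim: n f Q A r0 => [|n IH] f Q A r0 Q0 fc fT fA.
  exists 0 => z; rewrite horner0; move: z.
  apply: (vanishing_liouville Q0 fc fT) => z zr.
  by have := fA z zr; rewrite expr0 mulr1; apply.
have [b Qb] : exists b, Q.[b] != 0.
  by have /filter_ex := poly_nbhs_neq0 0 Q0.
have [D fD] := twice_derivable_derive (fT _ Qb).
(* Beyond [2 * modulus b] one has [modulus z <= 2 * modulus (z - b)], the origin of the factor 2 in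
   the new constant; beyond 1 the constant [f b] is absorbed by the power of [modulus z]. *)
pose r1 := Num.max (Num.max r0 1) (2 * modulus b).
have [||z Qz|z|p pE] := IH (divided_difference f D b) (Q * ('X - b%:P))
    (2 * (A + modulus (f b))) r1.
- by rewrite mulf_neq0// polyXsubC_eq0.
- by move=> z; apply: divided_difference_continuous.
- rewrite hornerM hornerXsubC mulf_eq0 negb_or subr_eq0 in Qz.
  by have /andP[Qz0 zb] := Qz;
    apply: divided_difference_twice_derivable (fT _ Qz0).
- rewrite /r1 !ge_max => /andP[/andP[zr0 z1] zb].
  have z0 : 0 < modulus z by apply: lt_le_trans z1.
  have zb2 : modulus z <= 2 * modulus (z - b).
    by have := ler_modulus_dist z b; lra.
  have zb0 : 0 < modulus (z - b) by lra.
  have zNb : z != b by rewrite -subr_eq0 -modulus_gt0.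
  rewrite /divided_difference (negbTE zNb) modulusf_div mulrA ler_pdivrMr//.
  have fz : modulus (f z) <= A * modulus z ^+ n.
    by have := fA z zr0; rewrite exprS mulrCA ler_pM2l.
  have zn : 1 <= modulus z ^+ n by rewrite exprn_ege1.
  have fb : modulus (f b) <= modulus (f b) * modulus z ^+ n.
    by rewrite ler_peMr// modulus_ge0.
  have fzb := ler_modulus_sub (f z) (f b).
  apply: (@le_trans _ _ (modulus z * ((A + modulus (f b)) * modulus z ^+ n))).
    by rewrite ler_pM2l//; lra.
  have X0 : 0 <= (A + modulus (f b)) * modulus z ^+ n.
    have := modulus_ge0 (f z); have := modulus_ge0 (f b); lra.
  have := ler_wpM2r X0 zb2; lra.
exists (p * ('X - b%:P) + (f b)%:P) => z.
rewrite !hornerE -pE /divided_difference; have [->|zb] := eqVneq z b.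
  by rewrite subrr mulr0 add0r.
by rewrite divfK ?subr_eq0// subrK.
Qed.

End Liouville.

(** * From circle means to pointwise bounds *)
Section Growth.
Context {R : realType}.
Local Notation C := (Cplx R).
Implicit Types (z w : C) (f g G : C -> C) (r : R).

Lemma circle_pointE r (t : R) :
  circle_point r t = r%:C%C * circle_point 1 t :> C.
Proof.
apply/eqP; rewrite eq_complex /=; apply/andP.
by split; apply/eqP; ring.
Qed.

Lemma modulus_circle_point r (t : R) : 0 <= r -> modulus (circle_point r t) = r.
Proof.
move=> r0; apply/eqP; rewrite -(@eqrXn2 _ 2) ?modulus_ge0//.
by rewrite modulus_sqr /= !exprMn -mulrDr cos2Dsin2 mulr1.
Qed.

Lemma ler_dist_derive (f df : R -> R) (s t : R) :
  (forall x : R, is_derive x 1 f (df x)) -> (forall x, `|df x| <= 1) ->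
  `|f s - f t| <= `|s - t|.
Proof.
move=> fD df1; wlog ts : s t / t <= s.
  move=> H; case: (leP t s) => [|/ltW]; first exact: H.
  by move=> /H; rewrite distrC (distrC t).
have [c _ ->] := is_derive_MVT ts (fun x _ => fD x).
by rewrite normrM ler_piMl.
Qed.

Lemma circle_point_lipschitz (s t : R) :
  modulus (circle_point 1 s - circle_point 1 t : C) <= 2 * `|s - t|.
Proof.
apply: le_trans (modulus_le_ReIm _) _; rewrite cReB cImB /= !mul1r.
rewrite mulr_natl mulr2n lerD//.
  apply: (@ler_dist_derive _ (fun x => - sin x)) => x.
  by rewrite normrN ler_norml sin_geN1 sin_le1.
apply: (@ler_dist_derive _ cos) => x.
by rewrite ler_norml cos_geN1 cos_le1.
Qed.

(** Polar coordinates from [acos], reflected for the lower half-plane. The strict bound [t < 2 * pi]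
    later guarantees that the grid cell containing [t] has a valid index. *)
Lemma modulus_circle_pointP z r : 0 < r -> modulus z = r ->
  exists2 t : R, 0 <= t < 2 * pi & z = circle_point r t.
Proof.
case: z => x y r0 zr; have pi0 : 0 < pi :> R := pi_gt0 R.
have xyr : x ^+ 2 + y ^+ 2 = r ^+ 2 by rewrite -zr modulus_sqr.
have xr : -1 <= x / r <= 1.
  rewrite -ler_norml normf_div (gtr0_norm r0) ler_pdivrMr// mul1r -zr.
  exact: (normr_Re (Complex x y : C)).
have cE : r * cos (acos (x / r)) = x.
  by rewrite acosK ?in_itv//= mulrC divfK// gt_eqF.
have sE : r * sin (acos (x / r)) = `|y|.
  have rn0 : r != 0 by rewrite gt_eqF.
  have -> : sin (acos (x / r)) = Num.sqrt ((y / r) ^+ 2).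
    rewrite sin_acos//; congr Num.sqrt; apply: (mulIf (expf_neq0 2 rn0)).
    rewrite -exprMn divfK// mulrBl mul1r -exprMn divfK// -xyr; ring.
  by rewrite sqrtr_sqr normf_div (gtr0_norm r0) mulrC divfK.
have [y0|y0] := leP 0 y.
  exists (acos (x / r)); last by rewrite /circle_point cE sE ger0_norm.
  by rewrite acos_ge0//=; have := acos_lepi xr; lra.
exists (2 * pi - acos (x / r)); last first.
  set a := acos _ in cE sE *.
  have -> : 2 * pi - a = pi + pi - a :> R by ring.
  have cosE : cos (pi + pi - a) = cos a.
    by rewrite cosB cosD sinD !cospi !sinpi; ring.
  have sinE : sin (pi + pi - a) = - sin a.
    by rewrite sinB cosD sinD !cospi !sinpi; ring.
  by rewrite /circle_point cosE sinE mulrN cE sE ltr0_norm// opprK.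
have x1 : x / r < 1.
  rewrite ltr_pdivrMr// mul1r ltNge; apply/negP => rx.
  have : y * y = 0 by nra.
  nra.
have : 0 < acos (x / r) by apply: acos_gt0; move/andP: xr => [-> _].
have := acos_lepi xr; lra.
Qed.

Lemma cRe_sum I (s : seq I) (P : pred I) (F : I -> C) :
  complex.Re (\sum_(i <- s | P i) F i) = \sum_(i <- s | P i) complex.Re (F i).
Proof.
elim/big_rec2: _ => [//|i x y _ <-]; exact: cReD.
Qed.

Lemma twice_derivable_sum I (s : seq I) (F : I -> C -> C) z :
  (forall i, twice_derivable (F i) z) ->
  twice_derivable (fun w => \sum_(i <- s) F i w) z.
Proof.
move=> FT; elim: s => [|i s IH].
  rewrite (_ : (fun w => _) = fun=> 0); first exact: twice_derivable_cst.
  by apply/funext => w; rewrite big_nil.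
rewrite (_ : (fun w => _) = fun w => F i w + \sum_(i <- s) F i w).
  exact: twice_derivableD.
by apply/funext => w; rewrite big_cons.
Qed.

(** The Herglotz kernel, whose real part is the Poisson kernel without its averaging factor. The
    complex form is kept because exponentials of its sums enter the maximum principle. *)
Definition herglotz_kernel (a z : C) : C := (a + z) / (a - z).

Lemma herglotz_kernel_twice_derivable (a z : C) : a != z ->
  twice_derivable (herglotz_kernel a) z.
Proof.
move=> az; have T1 : twice_derivable (fun w : C => a + w) z.
  have := twice_derivable_horner ('X + a%:P) z.
  by under eq_fun do rewrite !hornerE addrC.
have T2 : twice_derivable (fun w : C => a - w) z.
  have := twice_derivable_horner (a%:P - 'X) z.
  by under eq_fun do rewrite !hornerE.
by apply: twice_derivableM T1 (twice_derivableV _ T2); rewrite subr_eq0.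
Qed.

Lemma Re_herglotz_kernel (a z : C) : a != z ->
  complex.Re (herglotz_kernel a z) =
  (modulus a ^+ 2 - modulus z ^+ 2) / modulus (a - z) ^+ 2.
Proof.
move=> az; have d0 : modulus (a - z) ^+ 2 != 0.
  by rewrite expf_neq0// modulus_eq0 subr_eq0.
apply: (mulIf d0); rewrite divfK// -cReM_real.
have -> : ((modulus (a - z) ^+ 2)%:C)%C = conjc (a - z) * (a - z) :> C.
  case: (a - z) => x y; apply/eqP; rewrite eq_complex modulus_sqr /=.
  by apply/andP; split; apply/eqP; ring.
rewrite mulrCA /herglotz_kernel divfK ?subr_eq0// !modulus_sqr cReM.
by case: (a) (z) => [a1 a2] [z1 z2] /=; ring.
Qed.

(* Discretised Poisson integral over the circle of radius [r (1 + 1/n)]: near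
   the [k]-th node the [k]-th term alone already exceeds [a k]. *)
Lemma herglotz_majorant (n : nat) (a : 'I_n.+1 -> R) r : 0 < r ->
  (forall k, 0 <= a k) ->
  exists p : C -> C, [/\
    forall z, modulus z <= r -> twice_derivable p z,
    forall (k : 'I_n.+1) (t : R),
      `|t - 2 * pi * k%:R / n.+1%:R| <= 2 * pi / n.+1%:R ->
      a k <= complex.Re (p (circle_point r t)) &
    forall z, modulus z <= r / 2 ->
      complex.Re (p z) <= 450 * ((n.+1%:R)^-1 * \sum_(k < n.+1) a k)].
Proof.
move=> r0 a0; have N0 : 0 < n.+1%:R :> R by rewrite ltr0n.
move: (n.+1%:R) N0 => N N0.
have pi0 : 0 < pi :> R := pi_gt0 R.
have pi4 : pi <= 4 :> R by have := pihalf_lt2 R; lra.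
pose rho := r * (1 + N^-1).
have Ni0 : 0 < N^-1 by rewrite invr_gt0.
have rrho : r < rho by rewrite /rho mulrDr mulr1 ltrDl mulr_gt0.
have rho0 : 0 < rho by apply: lt_trans rrho.
pose zeta (k : 'I_n.+1) : C := circle_point rho (2 * pi * k%:R / N).
have mzeta k : modulus (zeta k) = rho by apply: modulus_circle_point;
  exact: ltW.
have zetaN z k : modulus z <= r -> zeta k != z.
  by move=> zr; apply: contraTneq zr => <-; rewrite mzeta -ltNge.
(* A point next to the [k]-th node is within [17 * (r / N)] of it: [r / N] radially and, as
   [pi <= 4], at most [16 * (r / N)] along the circle. The kernel there is at least
   [(2 * N + 1) / 289], and the factor [150 / N] lifts this above 1. *)
pose p z := \sum_(k < n.+1) (150 / N * a k)%:C%C * herglotz_kernel (zeta k) z.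
have ReP z : complex.Re (p z) =
    \sum_(k < n.+1) complex.Re (herglotz_kernel (zeta k) z) * (150 / N * a k).
  by rewrite cRe_sum; apply: eq_bigr => k _; rewrite mulrC cReM_real.
have c0 k : 0 <= 150 / N * a k.
  by apply: mulr_ge0 => //; apply: divr_ge0; [exact: ler0n|exact: ltW].
exists p; split.
- move=> z zr; apply: twice_derivable_sum => k; apply: twice_derivableM.
    exact: twice_derivable_cst.
  by apply: herglotz_kernel_twice_derivable; exact: zetaN.
- move=> k t tk; set z : C := circle_point r t.
  have zr : modulus z = r by apply: modulus_circle_point; exact: ltW.
  have K0 i : 0 <= complex.Re (herglotz_kernel (zeta i) z).
    rewrite Re_herglotz_kernel ?zetaN ?zr// mzeta divr_ge0 ?sqr_ge0// subr_ge0.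
    by rewrite ler_sqr ?nnegrE ltW.
  rewrite ReP (bigD1 k) //; apply: ler_wpDr.
    by apply: sumr_ge0 => i _; rewrite mulr_ge0.
  rewrite mulrA ler_peMl// Re_herglotz_kernel ?zetaN ?zr// mzeta.
  have zd : modulus (zeta k - z) <= 17 * (r / N).
    have -> : zeta k - z = (rho - r)%:C%C * circle_point 1 (2 * pi * k%:R / N) +
        r%:C%C * (circle_point 1 (2 * pi * k%:R / N) - circle_point 1 t).
      by rewrite /zeta /z circle_pointE (circle_pointE r) rmorphB /=; ring.
    apply: le_trans (ler_modulusD _ _) _; rewrite !modulusM !modulus_real.
    rewrite modulus_circle_point// mulr1 gtr0_norm ?subr_gt0// gtr0_norm//.
    have := circle_point_lipschitz (2 * pi * k%:R / N) t; rewrite distrC in tk.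
    move=> H; have {}H : modulus (circle_point 1 (2 * pi * k%:R / N) -
      circle_point 1 t : C) <= 16 / N.
      apply: le_trans H _; apply: (@le_trans _ _ (2 * (2 * pi / N)));
        first by rewrite ler_pM2l.
      by rewrite !mulrA ler_pM2r//; lra.
    have rhor : rho - r = r / N by rewrite /rho; ring.
    rewrite rhor; apply: (@le_trans _ _ (r / N + r * (16 / N))).
      by rewrite lerD2l ler_pM2l.
    by rewrite le_eqVlt; apply/orP; left; apply/eqP; ring.
  have zd0 : 0 < modulus (zeta k - z) by rewrite modulus_gt0 subr_eq0 zetaN//
    zr.
  rewrite mulrAC ler_pdivlMr ?exprn_gt0// mul1r.
  apply: (@le_trans _ _ ((17 * (r / N)) ^+ 2)).
    have X0 : 0 <= 17 * (r / N) by rewrite mulr_ge0// divr_ge0// ltW.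
    by rewrite ler_sqr ?nnegrE ?modulus_ge0.
  rewrite /rho; have -> : ((r * (1 + N^-1)) ^+ 2 - r ^+ 2) * (150 / N) =
     r ^+ 2 * (N^-1 ^+ 2 * (300 + 150 * N^-1)) by ring.
  have -> : (17 * (r / N)) ^+ 2 = r ^+ 2 * (N^-1 ^+ 2 * 289) by ring.
  by rewrite !ler_pM2l ?exprn_gt0//; lra.
- move=> z zr; rewrite ReP mulrA mulr_sumr ler_sum// => k _.
  (* For [modulus z <= r / 2] the kernel is at most [(rho + r / 2) / (rho - r / 2) <= 3]. *)
  have -> : 450 / N * a k = 3 * (150 / N * a k) by ring.
  rewrite ler_wpM2r//; apply: le_trans (ler_norm _) _.
  apply: le_trans (normr_Re _) _; rewrite /herglotz_kernel modulusf_div.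
  have h1 := ler_modulusD (zeta k) z; have h2 := ler_modulus_dist (zeta k) z.
  rewrite mzeta in h1 h2; rewrite ler_pdivrMr; lra.
Qed.

(** The grid is chosen so fine that [c] varies by at most 1 between a node and the points within one
    mesh of it; a step function lying below [c] then compares the Riemann sum with the integral, at
    the cost of another 1. *)
Lemma continuous_riemann_sum (c : R -> R) (m : R) : continuous c ->
  (forall t, 0 <= c t) ->
  (((2 * pi)^-1)%:E * \int[lebesgue_measure]_(t in `[0%R, (2 * pi)%R]) (c t)%:E
    <= m%:E)%E ->
  exists n : nat,
    (forall (k : 'I_n.+1) (t : R), 0 <= t <= 2 * pi ->
      `|t - 2 * pi * k%:R / n.+1%:R| <= 2 * pi / n.+1%:R ->
      c t <= c (2 * pi * k%:R / n.+1%:R) + 1) /\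
    (n.+1%:R)^-1 * \sum_(k < n.+1) c (2 * pi * k%:R / n.+1%:R) <= m + 1.
Proof.
move=> cc c0 cm; have pi0 : 0 < pi :> R := pi_gt0 R.
have tpi0 : 0 < 2 * pi :> R by rewrite mulr_gt0.
(* Uniform continuity by compactness of the segment; only [s] has to lie in it. *)
have [d d0 dP] : exists2 d : R, 0 < d & forall s t : R,
    0 <= s <= 2 * pi -> `|t - s| < d -> `|c t - c s| <= 1.
  pose P (e x : R) := forall t : R, `|t - x| < e -> `|c t - c x| <= 1.
  have cov := (compact_near_coveringP _).1 (@segment_compact R 0 (2 * pi)).
  have Pd : \forall d \near (0 : R)^'+, `[0, 2 * pi]%classic `<=` P d.
    apply: cov => x _.
    have /cvgrPdist_lt/(_ (1/2))[|e /= e0 eP] := cc x;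
      first by rewrite divr_gt0.
    exists (ball x (e / 2), [set d | d < e / 2]) => /=.
      split; first by apply: nbhsx_ballx; rewrite divr_gt0.
      by apply: nbhs_right_lt; rewrite divr_gt0.
    move=> [y d] /= [+ de] t td; rewrite -ball_normE /= => xy.
    have := eP y; have := eP t; rewrite /ball_ /=.
    have h1 : `|x - t| < e by have := ler_distD y x t; rewrite (distrC y t);
      lra.
    have h2 : `|x - y| < e by lra.
    move=> /(_ h1) h3 /(_ h2) h4; have := ler_distD (c x) (c t) (c y).
    by rewrite (distrC (c t) (c x)); lra.
  have [d [d0 dP]] := filter_ex (filterI (nbhs_right_gt (0 : R)) Pd).
  by exists d => // s t s0 ts; apply: (dP s) ts; rewrite /= in_itv.
pose n := Num.truncn (2 * pi / d); set N : R := n.+1%:R.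
have N0 : 0 < N by rewrite ltr0n.
have Nd : 2 * pi / N < d.
  by rewrite ltr_pdivrMr// -ltr_pdivrMl// mulrC truncnS_gt.
exists n; rewrite -/N.
pose th (k : nat) : R := 2 * pi * k%:R / N.
have thE k : th k.+1 = th k + 2 * pi / N by rewrite /th -natr1; ring.
have th0 k : 0 <= th k by rewrite /th !mulr_ge0 ?invr_ge0// ltW.
have th_le k : (k <= n.+1)%N -> th k <= 2 * pi.
  by move=> kn; rewrite /th ler_pdivrMr// ler_pM2l// ler_nat.
have near_th (k : 'I_n.+1) (t : R) : 
    `|t - th k| <= 2 * pi / N -> `|c t - c (th k)| <= 1.
  move=> tk; apply: dP; first by rewrite th0 th_le// ltnW.
  exact: le_lt_trans tk Nd.
split=> [k t t0 /near_th|]; first by rewrite ler_norml -/(th k); lra.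
pose I (k : nat) : set R := `[th k, th k.+1[%classic.
(* A lower bound of [c] on the [k]-th cell, cut off at 0 so that the step function can be integrated
   as a nonnegative extended real function. *)
pose b (k : nat) : R := Num.max 0 (c (th k) - 1).
have b0 k : 0 <= b k by rewrite le_max lexx.
pose F (k : nat) (t : R) : \bar R := ((b k)%:E * (\1_(I k) t)%:E)%E.
pose D : set R := `[0, 2 * pi]%classic.
have mD : measurable D by exact: measurable_itv.
have mI k : measurable (I k) by exact: measurable_itv.
have mI1 k : measurable_fun D (fun x => (\1_(I k) x)%:E).
  by apply/measurable_EFinP; exact: measurable_indic.
have mF k : measurable_fun D (F k) by apply: measurable_funeM; exact: mI1.
have F0 k t : D t -> (0 <= F k t)%E by move=> _; rewrite mule_ge0// lee_fin.
have mc : measurable_fun D (EFin \o c).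
  apply/measurable_EFinP; apply: measurable_funS (continuous_measurable_fun cc)
    => //.
have intF (k : 'I_n.+1) : (\int[lebesgue_measure]_(t in D) F k t = (b k * (2 *
  pi / N))%:E)%E.
  rewrite ge0_integralZl_EFin//; last exact: mI1.
  have -> : (\int[lebesgue_measure]_(t in D) (\1_(I k) t)%:E)%E =
      lebesgue_measure (I k `&` D) 
      by rewrite integral_indic; [|exact: mD|exact: mI].
  rewrite setIidl.
    rewrite lebesgue_measure_itv /= lte_fin thE ltrDl divr_gt0//.
    by rewrite EFinM; congr (_ * _)%E; rewrite -EFinB; congr EFin; ring.
  move=> t; rewrite /I /D /= !in_itv /= => /andP[t1 t2].
  by rewrite (le_trans (th0 k) t1) (le_trans (ltW t2) (th_le k.+1 (ltn_ord k))).
have Fc t : D t -> (\sum_(k < n.+1) F k t <= (c t)%:E)%E.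
  move=> Dt.
  have [[k kt]|nk] := pselect (exists k : 'I_n.+1, I k t); last first.
    rewrite big1 ?lee_fin// => k _; rewrite /F indicE memNset ?mule0//.
    by move=> kt; apply: nk; exists k.
  rewrite (bigD1 k)//= big1 ?adde0.
    rewrite /F indicE mem_set// mule1 lee_fin ge_max c0 /=.
    have := near_th k t; move: kt; rewrite /I /= in_itv /= thE => /andP[t1 t2].
    have -> : `|t - th k| <= 2 * pi / N by rewrite ger0_norm ?subr_ge0//
      lerBlDl ltW.
    by move=> /(_ isT); rewrite ler_norml; lra.
  move=> i ik; rewrite /F indicE memNset ?mule0//.
  move: kt; rewrite /I /= !in_itv /= => /andP[k1 k2] /andP[i1 i2].
  have thlt (a a' : nat) : th a < th a' -> (a < a')%N.
    by rewrite /th ltr_pM2r ?invr_gt0// ltr_pM2l// ltr_nat.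
  have := thlt _ _ (le_lt_trans k1 i2); have := thlt _ _ (le_lt_trans i1 k2).
  by rewrite !ltnS => h1 h2; move/eqP: ik; apply; apply/val_inj/anti_leq;
    rewrite h1.
have Fint : (\int[lebesgue_measure]_(t in D) (\sum_(k < n.+1) F k t) =
    \sum_(k < n.+1) (b k * (2 * pi / N))%:E)%E.
  rewrite ge0_integral_sum.
  - by apply: eq_bigr => k _; exact: intF.
  - exact: mD.
  - by move=> k; exact: mF.
  - by move=> k t; exact: F0.
have Fint_le : (\sum_(k < n.+1) (b k * (2 * pi / N))%:E <=
    \int[lebesgue_measure]_(t in D) (c t)%:E)%E.
  rewrite -Fint; apply: ge0_le_integral.
  - exact: mD.
  - by move=> t Dt; apply: sume_ge0 => k _; exact: F0.
  - by apply: emeasurable_sum => k; exact: mF.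
  - exact: mc.
  - exact: Fc.
have tpiV0 : (0 <= ((2 * pi)^-1)%:E :> \bar R)%E by rewrite lee_fin invr_ge0
  ltW.
have H : (((2 * pi)^-1)%:E * \sum_(k < n.+1) (b k * (2 * pi / N))%:E <= m%:E)%E.
  by apply: le_trans cm; apply: lee_wpmul2l; [exact: tpiV0|exact: Fint_le].
have {}H : (2 * pi)^-1 * (\sum_(k < n.+1) b k * (2 * pi / N)) <= m.
  by rewrite -lee_fin; apply: le_trans H; rewrite EFinM sumEFin.
apply: (@le_trans _ _ (N^-1 * \sum_(k < n.+1) (b k + 1))).
  rewrite ler_pM2l ?invr_gt0//; apply: ler_sum => k _.
  by rewrite -lerBlDr le_max lexx orbT.
rewrite big_split /= sumr_const card_ord mulrDr mulVf ?gt_eqF// lerD2r.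
apply: le_trans H.
by rewrite -mulr_suml mulrCA (mulKf (lt0r_neq0 tpi0)) mulrC.
Qed.

End Growth.

(** * Finite order *)
Section FiniteOrder.
Context {R : realType}.
Local Notation C := (Cplx R).
Implicit Types (z w : C) (f g G F : C -> C) (r : R).

Lemma pole_count_ge f (t : R) : 0 <= t ->
  (pole_count f 0 <= pole_count f t)%E.
Proof.
move=> t0; apply: ereal_sup_le => _ [A [Afin A0] <-].
by exists A => //; split=> // z /A0 /= z0; apply: le_trans t0.
Qed.

Lemma pole_count0 f : pole_count f 0 = (pole_mult f 0)%:R%:E.
Proof.
rewrite /pole_count (_ : [set z : C | _] = [set 0]); last first.
  apply/seteqP; split=> [z /= z0|z /= ->]; last by rewrite modulus0.
  by apply/eqP; rewrite -modulus_eq0 eq_le z0 modulus_ge0.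
by rewrite esum_set1// lee_fin.
Qed.

(** For [r >= 1] the logarithmic term is nonnegative as well. Hence the proximity function is at
    most the characteristic, which is how finite order enters. *)
Lemma counting_function_ge0 f r : 1 <= r -> (0 <= counting_function f r)%E.
Proof.
move=> r1; rewrite /counting_function; apply: adde_ge0.
  apply: integral_ge0 => t /=; rewrite in_itv /= => /andP[t0 _].
  apply: mule_ge0; last by rewrite lee_fin invr_ge0 ltW.
  by rewrite sube_ge0 ?pole_count0// -pole_count0 pole_count_ge// ltW.
by rewrite pole_count0 mule_ge0// lee_fin// ln_ge0.
Qed.

Lemma finite_order_proximity f : finite_order f ->
  exists (k : nat) (r0 : R), forall r, r0 <= r ->
    (proximity_function f r <= (r ^+ k)%:E)%E.
Proof.
rewrite /finite_order /order_of_growth limf_esupE.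
move=> /ereal_inf_lt[_ [V [M [_ MV]] <-] supV].
have [L LP] : exists L : R, forall r, V r ->
    (lne (maxe 1 (characteristic f r)) * ((ln r)^-1)%:E <= L%:E)%E.
  (* The supremum is below [+oo], but it may be [-oo], in which case [L = 0] serves. *)
  set s := ereal_sup _ in supV.
  have sP r : V r ->
      (lne (maxe 1 (characteristic f r)) * ((ln r)^-1)%:E <= s)%E.
    by move=> Vr; apply: ereal_sup_ubound; exists r.
  case: s supV sP => [L| |] // _ sP; first by exists L.
  by exists 0 => r /sP /le_trans; apply; rewrite leNye.
have {supV} [k Lk] : exists k : nat, L <= k%:R.
  by exists (Num.truncn L).+1; apply: ltW; rewrite truncnS_gt.
exists k, (Num.max (M + 1) 2) => r; rewrite ge_max => /andP[rM r2].
have lnr : 0 < ln r by apply: ln_gt0; lra.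
have r0 : 0 < r by lra.
have Mr : M < r by lra.
have prox : (proximity_function f r <= maxe 1 (characteristic f r))%E.
  rewrite le_max; apply/orP; right; rewrite /characteristic leeDl//.
  by apply: counting_function_ge0; lra.
apply: (le_trans prox); move: (LP r (MV r Mr)).
have : (1%:E <= maxe 1 (characteristic f r))%E by rewrite le_max lexx.
case: (maxe _ _) => [x| |] //; last first.
  (* An infinite characteristic would make the quotient [+oo], against the bound [L]. *)
  by rewrite /= gt0_mulye ?lte_fin ?invr_gt0// leye_eq.
rewrite lee_fin => x1; have x0 : 0 < x := lt_le_trans ltr01 x1.
rewrite lne_EFin// -EFinM lee_fin ler_pdivrMr// => H; rewrite lee_fin.
rewrite -(lnK (_ : x \is Num.pos)) ?posrE//.
rewrite -(lnK (_ : r ^+ k \is Num.pos)) ?posrE ?exprn_gt0// ler_expR.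
rewrite lnXn// -mulr_natl; apply: le_trans H _.
by rewrite ler_wpM2r// ltW.
Qed.

Lemma log_plus_ge0 (x : R) : 0 <= log_plus x.
Proof. by rewrite /log_plus ln_ge0// le_max lexx. Qed.

Lemma le_expR_log_plus (x : R) : x <= expR (log_plus x).
Proof.
have m0 : 0 < Num.max 1 x by rewrite lt_max ltr01.
by rewrite /log_plus lnK ?posrE// le_max lexx orbT.
Qed.

Lemma continuous_log_plus : continuous (@log_plus R).
Proof.
move=> x; apply: (@continuous_comp _ _ _ (fun y : R => Num.max 1 y) (@ln R)).
  rewrite (_ : (fun y : R => _) = (fun y : R => (1 + y + `|1 - y|) / 2)).
    apply: continuousM; last exact: cst_continuous.
    apply: continuousD; first by apply: continuousD; [exact: cst_continuous|].
    apply: (@continuous_comp _ _ _ (fun y : R => 1 - y)).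
      by apply: continuousB; [exact: cst_continuous|].
    exact: norm_continuous.
  by apply/funext => y; rewrite maxr_absE.
by apply: continuous_ln; rewrite lt_max ltr01.
Qed.

Lemma continuous_circle_point r : continuous (circle_point r : R -> C).
Proof.
move=> t P /nbhs_modulusP[e e0 eP].
have m0 : 0 < `|r| * 2 + 1 by rewrite ltr_wpDl// mulr_ge0.
apply/nbhs_ballP; exists (e / (`|r| * 2 + 1)); first by rewrite /= divr_gt0.
move=> s; rewrite -ball_normE /= ltr_pdivlMr// => ts; apply: eP.
rewrite circle_pointE (circle_pointE r t) -mulrBr modulusM modulus_real.
apply: le_lt_trans ts; rewrite distrC mulrDr mulr1 mulrA (mulrC _ `|r|).
have H := ler_wpM2l (normr_ge0 r) (circle_point_lipschitz s t).
by apply: le_trans H _; rewrite -mulrA (mulrC 2) lerDl.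
Qed.

Lemma horner_growth (p : {poly C}) : exists2 A : R, 0 <= A &
  forall z, 1 <= modulus z -> modulus p.[z] <= A * modulus z ^+ (size p).-1.
Proof.
exists (\sum_(i < size p) modulus p`_i) => [|z z1].
  by apply: sumr_ge0 => i _; exact: modulus_ge0.
rewrite horner_coef mulr_suml.
elim/big_rec2: _ => [|i x y _ H]; first by rewrite modulus0.
apply: le_trans (ler_modulusD _ _) _; rewrite lerD// modulusM modulusX.
rewrite ler_wpM2l ?modulus_ge0// ler_weXn2l//.
by rewrite -ltnS prednK// (leq_ltn_trans _ (ltn_ord i)).
Qed.

(** With [p] the majorant built from the values of [log^+ |F|] at the nodes, [P * F * cexp (- p)] is
    at most [B] on the circle, hence in the disc, and on the half disc [Re p] is bounded by the
    mean. In [m + 2], one unit pays for the variation of [c] near a node and one for the Riemann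
    sum. *)
Lemma proximity_growth F (P Q : {poly C}) (r m B : R) : 0 < r -> Q != 0 ->
  (forall z, modulus z <= r -> {for z, continuous (fun w => P.[w] * F w)}) ->
  (forall z, modulus z <= r -> Q.[z] != 0 ->
     twice_derivable (fun w => P.[w] * F w) z) ->
  (forall z, modulus z = r -> {for z, continuous F}) ->
  (forall z, modulus z = r -> modulus P.[z] <= B) ->
  (proximity_function F r <= m%:E)%E ->
  forall z, modulus z <= r / 2 ->
    modulus (P.[z] * F z) <= B * expR (450 * (m + 2)).
Proof.
move=> r0 Q0 Gc GT Fc PB Fm.
pose c t := log_plus (modulus (F (circle_point r t))).
have cc : continuous c.
  move=> t; have Ft : {for circle_point r t, continuous F}.
    by apply: Fc; apply: modulus_circle_point; exact: ltW.
  have H1 := @continuous_comp _ _ _ (circle_point r) F t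
    (@continuous_circle_point r t) Ft.
  have H2 := @continuous_comp _ _ _ (F \o circle_point r) (@modulus R) t
    H1 (@continuous_modulus R _).
  exact: (@continuous_comp _ _ _ (@modulus R \o (F \o circle_point r))
    (@log_plus R) t H2 (@continuous_log_plus _)).
have [n [nloc nsum]] := continuous_riemann_sum cc (fun t => log_plus_ge0 _) Fm.
pose a (k : 'I_n.+1) := c (2 * pi * k%:R / n.+1%:R) + 1.
have a0 k : 0 <= a k by rewrite addr_ge0// log_plus_ge0.
have [p [pT ploc psum]] := herglotz_majorant r0 a0.
have B0 : 0 <= B.
  apply: le_trans (modulus_ge0 P.[circle_point r 0]) (PB _ _).
  by apply: modulus_circle_point; exact: ltW.
have pc z : modulus z <= r -> twice_derivable (fun w => cexp (- p w)) z.
  by move=> zr; apply: twice_derivable_cexp; apply: twice_derivableN; exact: pT.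
have H z : modulus z <= r -> modulus (P.[z] * F z * cexp (- p z)) <= B.
  apply: (maximum_modulus_disc (f := fun z =>
    P.[z] * F z * cexp (- p z)) B0 Q0).
  - move=> w wr.
    exact: (continuousM (Gc w wr) (twice_derivable_continuous (pc w wr))).
  - by move=> w wr Qw; exact: (twice_derivableM (GT w wr Qw) (pc w wr)).
  move=> w wr; have [t /andP[t0 t2] wt] := modulus_circle_pointP r0 wr.
  rewrite modulusM modulusM -mulrA -[X in _ <= X]mulr1.
  rewrite ler_pM ?mulr_ge0 ?modulus_ge0 ?PB//.
  have N0 : 0 < n.+1%:R :> R by rewrite ltr0n.
  have pi0 : 0 < 2 * pi :> R by rewrite mulr_gt0// pi_gt0.
  (* The index of the grid cell containing [t]; it is less than [n.+1] because [t < 2 * pi]. *)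
  pose k := Num.truncn (t * n.+1%:R / (2 * pi)).
  have u0 : 0 <= t * n.+1%:R / (2 * pi).
    by apply: divr_ge0; [exact: mulr_ge0 (ltW N0)|exact: ltW].
  have kn : (k < n.+1)%N.
    rewrite ltnS truncn_le_nat ltr_pdivrMr// mulrC ltr_pM2l//.
  have tk : `|t - 2 * pi * k%:R / n.+1%:R| <= 2 * pi / n.+1%:R.
    have k1 : k%:R <= t * n.+1%:R / (2 * pi) by rewrite truncn_le.
    have k2 : t * n.+1%:R / (2 * pi) < k.+1%:R by rewrite truncnS_gt.
    rewrite ler_pdivlMr// in k1; rewrite ltr_pdivrMr// in k2.
    rewrite ler_distl; apply/andP; split.
      apply: (@le_trans _ _ (2 * pi * k%:R / n.+1%:R)).
        by rewrite lerBlDr lerDl divr_ge0// ltW.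
      by rewrite ler_pdivrMr// (mulrC (2 * pi)).
    have kE : k.+1%:R = k%:R + 1 :> R by rewrite natr1.
    rewrite (_ : _ + _ = 2 * pi * k.+1%:R / n.+1%:R); last by rewrite kE; ring.
    by rewrite ler_pdivlMr// (mulrC (2 * pi)) ltW.
  have t2' : 0 <= t <= 2 * pi by rewrite t0 ltW.
  have ct := nloc (Ordinal kn) t t2' tk; have pt := ploc (Ordinal kn) t tk.
  rewrite modulus_cexp cReN expRN ler_pdivrMr ?expR_gt0// mul1r.
  apply: le_trans (le_expR_log_plus _) _; rewrite ler_expR wt.
  exact: le_trans ct pt.
move=> z zr; have {}H := H z.
have zr' : modulus z <= r by apply: le_trans zr _; lra.
have := H zr'; rewrite modulusM modulus_cexp cReN expRN ler_pdivrMr ?expR_gt0//.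
move=> {}H; apply: le_trans H _; rewrite ler_wpM2l// ler_expR.
apply: le_trans (psum _ zr) _; apply: ler_wpM2l; first exact: ler0n.
rewrite big_split /= sumr_const card_ord mulrDr mulVf ?pnatr_eq0//.
by move: nsum; set S := _ * \sum_(k < _) _; lra.
Qed.

Lemma finite_order_growth F (P Q : {poly C}) (r0 : R) : Q != 0 ->
  (forall z, {for z, continuous (fun w => P.[w] * F w)}) ->
  (forall z, Q.[z] != 0 -> twice_derivable (fun w => P.[w] * F w) z) ->
  (forall z, r0 <= modulus z -> {for z, continuous F}) ->
  finite_order F ->
  exists (K : nat) (r1 : R), forall z, r1 <= modulus z ->
    modulus (P.[z] * F z) <= expR (modulus z ^+ K).
Proof.
move=> Q0 Gc GT Fc /finite_order_proximity[k [rk prox]].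
have [A A0 PA] := horner_growth P.
set D := (size P).-1 in PA.
(* Passing to the radius [2 * modulus z] produces the powers of 2, and [900 = 450 * 2]. Requiring
   [B <= modulus z] absorbs all constants into one more power of [modulus z]. *)
pose B : R := A * 2 ^+ D + 450 * 2 ^+ k + 900.
exists (maxn D k).+1, (Num.max (Num.max r0 rk) (Num.max 1 B)) => z.
rewrite !ge_max => /andP[/andP[zr0 zrk] /andP[z1 zB]].
have z0 : 0 <= modulus z by apply: modulus_ge0.
pose r := 2 * modulus z.
have zr : modulus z <= r by rewrite /r; lra.
have r1 : 1 <= r by lra.
have r_gt0 : 0 < r by lra.
have zr2 : modulus z <= r / 2 by rewrite /r; lra.
apply: le_trans (@proximity_growth F P Q r (r ^+ k) (A * r ^+ D) r_gt0 Q0 _ _ _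
  _ _ z zr2) _.
- by move=> w _; exact: Gc.
- by move=> w _; exact: GT.
- by move=> w wr; apply: Fc; rewrite wr; lra.
- by move=> w wr; rewrite -wr; apply: PA; rewrite wr.
- by apply: prox; lra.
set E := A * r ^+ D; have E0 : 0 <= E by rewrite mulr_ge0// exprn_ge0// ltW.
have EE : E <= expR E by apply: le_trans (expR_ge1Dx E); lra.
apply: (@le_trans _ _ (expR E * expR (450 * (r ^+ k + 2)))).
  by apply: ler_wpM2r; [exact: expR_ge0|exact: EE].
rewrite -expRD ler_expR /E /r !exprMn.
pose X := modulus z ^+ maxn D k.
have X1 : 1 <= X by rewrite exprn_ege1.
have XD : modulus z ^+ D <= X by rewrite ler_weXn2l// leq_maxl.
have Xk : modulus z ^+ k <= X by rewrite ler_weXn2l// leq_maxr.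
rewrite exprS -/X; apply: (@le_trans _ _ (B * X)); last first.
  by rewrite ler_wpM2r//; lra.
have h1 : A * (2 ^+ D * modulus z ^+ D) <= A * 2 ^+ D * X.
  by rewrite -mulrA ler_wpM2l// ler_wpM2l// exprn_ge0.
have h2 : 2 ^+ k * modulus z ^+ k <= 2 ^+ k * X by rewrite ler_wpM2l//
  exprn_ge0.
rewrite /B; lra.
Qed.

End FiniteOrder.

(** * Poles of solutions *)
Section Poles.
Context {R : realType}.
Local Notation C := (Cplx R).
Implicit Types (z w h a D : C) (f g F : C -> C).

Lemma continuous_dnbhs_unique f g z : {for z, continuous f} ->
  {for z, continuous g} -> (\forall w \near z^', f w = g w) -> f z = g z.
Proof.
move=> /continuous_modulusP fc /continuous_modulusP gc /dnbhs_modulusP[r r0 fg].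
apply/eqP; rewrite -subr_eq0 -modulus_eq0 eq_le modulus_ge0 andbT.
apply/ler_addgt0Pr => e e0; rewrite add0r.
have e20 : 0 < e / 2 by rewrite divr_gt0.
have [d1 d10 fP] := fc _ e20; have [d2 d20 gP] := gc _ e20.
pose t := Num.min r (Num.min d1 d2) / 2.
have m0 : 0 < Num.min r (Num.min d1 d2) by rewrite !lt_min r0 d10.
have [tr t1 t2] : [/\ t < r, t < d1 & t < d2].
  have : Num.min r (Num.min d1 d2) <= r by rewrite ge_min lexx.
  have : Num.min r (Num.min d1 d2) <= d1 by rewrite !ge_min lexx orbT.
  have : Num.min r (Num.min d1 d2) <= d2 by rewrite !ge_min lexx !orbT.
  by rewrite /t; split; lra.
have t0 : 0 < t by rewrite divr_gt0.
have wz : z + t%:C%C - z = t%:C%C by rewrite addrAC subrr add0r.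
have wt : modulus (z + t%:C%C - z) = t by rewrite wz modulus_real gtr0_norm.
have wN : z + t%:C%C != z.
  by rewrite -subr_eq0 wz -modulus_eq0 modulus_real gtr0_norm// gt_eqF.
have fgw := fg (z + t%:C%C) wN; rewrite wt in fgw.
have H1 := fP (z + t%:C%C); rewrite wt in H1.
have H2 := gP (z + t%:C%C); rewrite wt in H2.
have := ler_modulus_distD (f (z + t%:C%C)) (f z) (g z).
rewrite [X in _ <= _ + modulus (X - _)]fgw// (modulusB (f z) (f _)).
have := H1 t1; have := H2 t2; lra.
Qed.

Lemma subr_continuous a z : {for z, continuous (fun w => w - a)}.
Proof.
exact: is_derive1_continuous
  (is_derive1B (is_derive_id z 1) (is_derive_cst a z 1)).
Qed.

Lemma holomorphic_at_continuous f z : holomorphic_at f z ->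
  {for z, continuous f}.
Proof.
move=> /nbhs_modulusP[r r0 fd].
have /derivableP : derivable f z 1 by apply: fd; rewrite subrr modulus0.
exact: is_derive1_continuous.
Qed.

Lemma continuous_not_pole f z : {for z, continuous f} -> ~ pole f z.
Proof.
move=> fc [n [n0 [g [/holomorphic_at_continuous gc gz fg]]]].
have hc : {for z, continuous (fun w => f w * (w - z) ^+ n)}.
  exact: (continuousM fc (continuousX (f := fun w => w - z) (n := n)
    (@subr_continuous z z))).
have hg : \forall w \near z^', f w * (w - z) ^+ n = g w.
  have wz : \forall w \near z^', w != z by apply/dnbhs_modulusP; exists 1.
  apply: filterS2 fg wz => w -> wz.
  by rewrite divfK// expf_neq0// subr_eq0.
have := continuous_dnbhs_unique hc gc hg.
by rewrite subrr expr0n eqn0Ngt n0 mulr0 => /esym/eqP; apply/negP.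
Qed.

(* A pole of [f] at [z0] would force [g' ~ n g(z0) / (w - z0)], which is not
   integrable along a segment issued from [z0], while [g] is continuous. *)
Lemma linear_ode_no_pole f (a b : C -> C) z0 :
  {for z0, continuous a} -> {for z0, continuous b} ->
  (\forall w \near z0^', ~ pole f w -> derive1 f w = a w * f w + b w) ->
  ~ pole f z0.
Proof.
move=> ac bc /dnbhs_modulusP[r1 r10 fE] [n [n0 [g [gh gz fg]]]].
have gc := holomorphic_at_continuous gh.
move: gh => /nbhs_modulusP[r2 r20 gd].
move: fg => /dnbhs_modulusP[r3 r30 fg].
pose G0 := modulus (g z0); have G00 : 0 < G0 by rewrite modulus_gt0.
have /continuous_modulusP/(_ _ ltr01)[r4 r40 aP] := ac.
have /continuous_modulusP/(_ _ ltr01)[r5 r50 bP] := bc.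
have /continuous_modulusP/(_ (G0 / 16))[|r6 r60 gP] := gc.
  by rewrite divr_gt0.
pose M := modulus (a z0) + modulus (b z0) + 1.
have M0 : 0 < M by rewrite ltr_wpDl// addr_ge0// modulus_ge0.
(* [M * (2 * G0 + 1)] will bound the regular part of [g']; below [r7] this part is at most half of
   [G0 / (2 * s)]. *)
pose r7 := G0 / (4 * M * (2 * G0 + 1)).
have q0 : 0 < 4 * M * (2 * G0 + 1) by rewrite !mulr_gt0//; lra.
have r70 : 0 < r7 by rewrite divr_gt0.
pose m := Num.min (Num.min 1 r1) (Num.min (Num.min r2 r3)
  (Num.min (Num.min r4 r5) (Num.min r6 r7))).
have m0 : 0 < m by rewrite !lt_min ltr01 r10 r20 r30 r40 r50 r60 r70.
have [m_1 m1 m2 m3] : [/\ m <= 1, m <= r1, m <= r2 & m <= r3].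
  by rewrite /m; split; rewrite !ge_min lexx ?orbT.
have [m4 m5 m6 m7] : [/\ m <= r4, m <= r5, m <= r6 & m <= r7].
  by rewrite /m; split; rewrite !ge_min lexx ?orbT.
pose t := m / 4; have t0 : 0 < t by rewrite divr_gt0.
pose w (s : R) : C := z0 + s%:C%C * 1.
have wz s : w s - z0 = s%:C%C by rewrite /w mulr1 addrAC subrr add0r.
have ws s : 0 < s -> modulus (w s - z0) = s.
  by move=> s0; rewrite wz modulus_real gtr0_norm.
pose g' s := 'D_1 g (w s).
have gD s : 0 < s < m -> is_derive (w s) 1 g (g' s).
  move=> /andP[s0 sm]; apply: derivableP; apply: gd; rewrite ws//.
  exact: lt_le_trans sm m2.
(* Differentiating [f = g / (w - z0)^n] and inserting the equation isolates the singular term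
   [n g / s]. *)
have gE s : 0 < s < m -> g' s =
    n%:R * g (w s) / s%:C%C + a (w s) * g (w s) + b (w s) * s%:C%C ^+ n.
  move=> sm; have /andP[s0 sm'] := sm.
  have sC0 : (s%:C%C : C) != 0 by rewrite -modulus_eq0 modulus_real gtr0_norm//
    gt_eqF.
  have wN : w s != z0 by rewrite -subr_eq0 wz.
  have near_f : \forall u \near w s, g u * ((u - z0) ^+ n)^-1 = f u.
    apply/nbhs_modulusP; exists (Num.min s (m - s)) => [|u].
      by rewrite lt_min s0 subr_gt0.
    rewrite lt_min => /andP[us ums]; rewrite fg//.
      apply: contraTneq us => ->; by rewrite modulusB ws// ltxx.
    have := ler_modulus_distD (w s) u z0; rewrite ws//.
    by move: ums m3; clear; lra.
  have XD : is_derive (w s) 1 (fun u : C => (u - z0) ^+ n)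
      (n%:R * (w s - z0) ^+ n.-1).
    have BD : is_derive (w s) 1 (fun u : C => u - z0) (1 - 0).
      exact: is_derive1B (is_derive_id _ _) (is_derive_cst z0 _ _).
    have := @is_derive1_horner R ('X ^+ n) (w s - z0).
    rewrite derivXn hornerMn hornerXn => XD.
    apply: is_derive1_eq (is_derive1_comp BD XD) _ _ => [u|].
      by rewrite hornerXn.
    by rewrite subr0 mulr1 mulr_natl.
  have X0 : (w s - z0) ^+ n != 0 by rewrite expf_neq0// subr_eq0.
  have fD := near_eq_is_derive1 near_f (is_derive1M (gD _ sm)
    (is_derive1V (f := fun u => (u - z0) ^+ n) X0 XD)).
  have fdE := fE (w s) wN; rewrite ws// in fdE.
  have {}fdE := fdE (lt_le_trans sm' m1)
    (continuous_not_pole (is_derive1_continuous fD)).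
  have [_ fDv] := fD.
  rewrite derive1E fDv fg// ?ws// in fdE; last exact: lt_le_trans m3.
  move: fdE; rewrite wz; case: n n0 {fg near_f XD X0 fD fDv} => // n _ /=.
  rewrite exprS => fdE.
  have : forall x y : C, x = y -> x * (s%:C%C * s%:C%C ^+ n) = y * (s%:C%C *
    s%:C%C ^+ n).
    by move=> x y ->.
  move=> /(_ _ _ fdE) {}fdE.
  have sn0 : (s%:C%C : C) ^+ n != 0 by rewrite expf_neq0.
  have -> : g' s = (g' s * (s%:C%C * s%:C%C ^+ n)^-1 + g (w s) * (- (n.+1%:R *
    s%:C%C ^+ n) /
    (s%:C%C * s%:C%C ^+ n) ^+ 2)) * (s%:C%C * s%:C%C ^+ n) + n.+1%:R * g (w s)
      / s%:C%C.
    by field; rewrite sC0 sn0.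
  rewrite fdE; by field; rewrite sC0 sn0.
have gM s : 0 < s < m -> modulus (g (w s) - g z0) < G0 / 16.
  by move=> /andP[s0 sm]; apply: gP; rewrite ws//; exact: lt_le_trans m6.
pose c := conjc (g z0).
have cG : modulus c = G0 by rewrite modulus_conj.
(* Since [n >= 1], the singular term contributes at least [15/16 * G0^2 / s], and the rest takes
   away at most [G0^2 / (4 s)]. *)
have lower s : 0 < s < m -> G0 ^+ 2 / (2 * s) <= complex.Re (c * g' s * 1).
  move=> sm; have /andP[s0 sm'] := sm; rewrite mulr1 gE//.
  have gs := gM _ sm.
  have Rg : 15 / 16 * G0 ^+ 2 <= complex.Re (c * g (w s)).
    have -> : c * g (w s) = c * g z0 + c * (g (w s) - g z0) by ring.
    rewrite cReD Re_conjM -/G0.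
    have := normr_Re (c * (g (w s) - g z0)); rewrite modulusM cG.
    have := ler_wpM2l (ltW G00) (ltW gs); rewrite ler_norml => h1 /andP[h2 _].
    by move: h1 h2; clear; lra.
  have gs2 : modulus (g (w s)) <= 2 * G0.
    have := ler_modulus_dist (g (w s)) (g z0); rewrite -/G0.
    by move: gs G00; clear; lra.
  have aM : modulus (a (w s)) <= M.
    have /aP : modulus (w s - z0) < r4.
      by rewrite ws//; exact: lt_le_trans sm' m4.
    have := ler_modulus_dist (a (w s)) (a z0); have := modulus_ge0 (b z0).
    by rewrite /M; clear; lra.
  have bM : modulus (b (w s)) <= M.
    have /bP : modulus (w s - z0) < r5.
      by rewrite ws//; exact: lt_le_trans sm' m5.
    have := ler_modulus_dist (b (w s)) (b z0); have := modulus_ge0 (a z0).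
    by rewrite /M; clear; lra.
  set e := a (w s) * g (w s) + b (w s) * s%:C%C ^+ n.
  have eM : modulus e <= M * (2 * G0 + 1).
    apply: le_trans (ler_modulusD _ _) _;
      rewrite !modulusM modulusX modulus_real.
    have sn1 : s ^+ n <= 1 
      by apply: exprn_ile1; [exact: ltW|exact: le_trans (ltW sm') m_1].
    have sn0 : 0 <= s ^+ n by apply: exprn_ge0; exact: ltW.
    rewrite gtr0_norm// mulrDr.
    by apply: lerD; apply: ler_pM => //; exact: modulus_ge0.
  have -> : c * (n%:R * g (w s) / s%:C%C + a (w s) * g (w s) + b (w s) * s%:C%C
    ^+ n) =
      c * g (w s) * (n%:R / s)%:C%C + c * e.
    by rewrite /e rmorphM rmorphV ?unitfE ?gt_eqF//= rmorph_nat; ring.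
  rewrite cReD cReM_real.
  have Re_e : - (G0 * (M * (2 * G0 + 1))) <= complex.Re (c * e).
    have := normr_Re (c * e); rewrite modulusM cG ler_norml => /andP[h _].
    by apply: le_trans h; rewrite lerN2 ler_pM2l.
  have n1 : 1 <= n%:R :> R by rewrite ler1n.
  have h1 : 15 / 16 * G0 ^+ 2 / s <= complex.Re (c * g (w s)) * (n%:R / s).
    have Rg0 : 0 <= complex.Re (c * g (w s)).
      by apply: le_trans Rg; rewrite mulr_ge0 ?sqr_ge0.
    rewrite [X in _ <= X]mulrA ler_wpM2r ?invr_ge0 ?(ltW s0)//.
    by apply: le_trans Rg _; rewrite ler_peMr.
  have h2 : G0 * (M * (2 * G0 + 1)) <= G0 ^+ 2 / (4 * s).
    have : s <= r7 := le_trans (ltW sm') m7.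
    rewrite /r7 ler_pdivlMr// => h; rewrite ler_pdivlMr ?mulr_gt0//.
    by move: (ler_wpM2l (ltW G00) h); clear; lra.
  have -> : G0 ^+ 2 / (2 * s) = G0 ^+ 2 / s / 2 by rewrite invfM; ring.
  have h3 : G0 ^+ 2 / (4 * s) = G0 ^+ 2 / s / 4 by rewrite invfM; ring.
  rewrite h3 in h2; have : 0 < G0 ^+ 2 / s by rewrite divr_gt0// exprn_gt0.
  have h4 : 15 / 16 * G0 ^+ 2 / s = 15 / 16 * (G0 ^+ 2 / s) by ring.
  rewrite h4 in h1; move: h1 h2 Re_e;
    move: (complex.Re _) (complex.Re _) => x y.
  by clear; lra.
have tt2 : t <= 2 * t by move: t0; clear; lra.
have seg s : t <= s <= 2 * t -> 0 < s < m.
  by move/andP; move: m0; rewrite /t; clear; lra.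
(* Over [[t, 2t]] the function increases by at least [t * G0^2 / (2 s) >= G0^2 / 4], because
   [s <= 2 * t], whereas continuity of [g] allows only [G0^2 / 8]. Both bounds are independent of
   [t]. *)
have [s /andP[st s2t] sE] := is_derive_MVT tt2
  (fun s H => @is_derive_line R g z0 1 c (g' s) s (gD s (seg s H))).
have sm : 0 < s < m by apply: seg; rewrite st.
have t2m : 0 < 2 * t < m by apply: seg; rewrite tt2 lexx.
have tm : 0 < t < m by apply: seg; rewrite tt2 lexx.
have := lower s sm; have s0 : 0 < s by case/andP: sm.
rewrite -cReB -mulrBr -/(w t) -/(w (2 * t)) in sE.
have := normr_Re (c * (g (w (2 * t)) - g (w t))).
rewrite sE modulusM cG; set L := complex.Re _.
have gg : modulus (g (w (2 * t)) - g (w t)) <= G0 / 8.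
  apply: le_trans (ler_modulus_distD (g z0) _ _) _.
  rewrite (modulusB (g z0)); move: (gM _ tm) (gM _ t2m).
  by move: (modulus _) (modulus _) => x y; clear; lra.
have {}gg := ler_wpM2l (ltW G00) gg.
have -> : 2 * t - t = t by ring.
move=> /(le_trans (ler_norm _)) h1 h2.
have : G0 ^+ 2 / (2 * s) * t <= L * t by rewrite ler_pM2r.
have h3 : G0 ^+ 2 / 4 <= G0 ^+ 2 / (2 * s) * t.
  rewrite [X in _ <= X]mulrAC ler_pdivlMr ?mulr_gt0//.
  by move: (ler_wpM2l (sqr_ge0 G0) s2t); clear; lra.
have : 0 < G0 ^+ 2 by rewrite exprn_gt0.
move: h1 h2 h3 gg; move: (G0 ^+ 2 / (2 * s)) (modulus _) => x y.
by clear; lra.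
Qed.

End Poles.

(** * Asymptotics and differential inequalities *)
Section Asymptotics.
Context {R : realType}.
Local Notation C := (Cplx R).
Implicit Types (z w h v D : C) (f g F : C -> C).

Lemma horner_lead (p : {poly C}) : exists2 A : R, 0 <= A &
  forall z, 1 <= modulus z ->
    modulus (p.[z] - lead_coef p * z ^+ (size p).-1) * modulus z <=
      A * modulus z ^+ (size p).-1.
Proof.
exists (\sum_(i < (size p).-1) modulus p`_i) => [|z z1].
  by apply: sumr_ge0 => i _; exact: modulus_ge0.
have [->|p0] := eqVneq p 0.
  rewrite horner0 lead_coef0 mul0r subr0 modulus0 mul0r.
  by rewrite mulr_ge0 ?exprn_ge0 ?modulus_ge0// sumr_ge0// => i _;
    exact: modulus_ge0.
have sp : size p = (size p).-1.+1 by rewrite prednK// lt0n size_poly_eq0.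
rewrite horner_coef [in X in X * _ <= _]sp big_ord_recr /= addrK.
rewrite mulr_suml.
have Hi (i : 'I_(size p).-1) : modulus (p`_i * z ^+ i) * modulus z <=
    modulus p`_i * modulus z ^+ (size p).-1.
  rewrite modulusM modulusX -mulrA -exprSr ler_wpM2l ?modulus_ge0//.
  by rewrite ler_weXn2l.
elim/big_rec2: _ => [|i x y _ H]; first by rewrite modulus0 mul0r.
apply: (@le_trans _ _ ((modulus (p`_i * z ^+ i) + modulus y) * modulus z)).
  by rewrite ler_wpM2r ?modulus_ge0 ?ler_modulusD.
by rewrite mulrDl lerD.
Qed.

Lemma horner_lower (p : {poly C}) : p != 0 -> exists2 c : R, 0 < c &
  exists2 r0 : R, 1 <= r0 & forall z, r0 <= modulus z ->
    c * modulus z ^+ (size p).-1 <= modulus p.[z].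
Proof.
move=> p0; have [A A0 pA] := horner_lead p.
pose l := modulus (lead_coef p).
have l0 : 0 < l by rewrite modulus_gt0 lead_coef_eq0.
exists (l / 2); first by rewrite divr_gt0.
exists (Num.max 1 (2 * A / l)) => [|z]; first by rewrite le_max lexx.
rewrite ge_max => /andP[z1 zA]; have := pA z z1.
set n := (size p).-1; set X := modulus z ^+ n => H.
have z0 : 0 < modulus z by lra.
have X0 : 0 < X by rewrite exprn_gt0.
have := ler_modulus_dist (lead_coef p * z ^+ n) p.[z].
rewrite modulusB modulusM modulusX -/l -/X => H1.
rewrite ler_pdivrMr// in zA.
have H2 : modulus (p.[z] - lead_coef p * z ^+ n) * 2 <= l * X.
  rewrite -(ler_pM2l z0).
  have := ler_wpM2r (ltW X0) zA; lra.
lra.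
Qed.

Lemma horner_lower_const (p : {poly C}) : p != 0 -> exists2 c : R, 0 < c &
  exists2 r0 : R, 1 <= r0 & forall z, r0 <= modulus z -> c <= modulus p.[z].
Proof.
move=> /horner_lower[c c0 [r0 r1 H]]; exists c => //; exists r0 => // z zr.
by apply: le_trans (H z zr);
  rewrite (ler_peMr (ltW c0))// exprn_ege1// (le_trans r1).
Qed.

Lemma horner_lipschitz (p : {poly C}) : exists2 A : R, 0 <= A & exists n : nat,
  forall z h, 1 <= modulus z -> modulus h <= 1 ->
    modulus (p.[z + h] - p.[z]) <= A * modulus z ^+ n * modulus h.
Proof.
elim/poly_ind: p => [|p c [A A0 [n IH]]].
  exists 0 => //; exists 0%N => z h _ _.
  by rewrite !horner0 subrr modulus0 !mul0r.
have [B B0 pB] := horner_growth p; set k := (size p).-1 in pB.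
exists (2 * A + B); first by rewrite addr_ge0// mulr_ge0.
exists (maxn n k).+1 => z h z1 h1; rewrite !hornerMXaddC.
have -> : p.[z + h] * (z + h) + c - (p.[z] * z + c) =
  (p.[z + h] - p.[z]) * (z + h) + p.[z] * h by ring.
apply: le_trans (ler_modulusD _ _) _; rewrite !modulusM.
pose X := modulus z ^+ maxn n k; have h0 := modulus_ge0 h.
have X1 : 1 <= X by rewrite exprn_ege1.
have Xn : modulus z ^+ n <= X by rewrite ler_weXn2l// leq_maxl.
have Xk : modulus z ^+ k <= X by rewrite ler_weXn2l// leq_maxr.
have zh : modulus (z + h) <= 2 * modulus z.
  by apply: le_trans (ler_modulusD _ _) _; lra.
rewrite mulrDl mulrDl lerD//.
  apply: (@le_trans _ _ ((A * X * modulus h) * (2 * modulus z))).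
    rewrite ler_pM ?modulus_ge0//; apply: le_trans (IH z h z1 h1) _.
    by rewrite ler_wpM2r// ler_wpM2l.
  by rewrite exprS -/X le_eqVlt; apply/orP; left; apply/eqP; ring.
rewrite ler_wpM2r//; apply: le_trans (pB z z1) _; rewrite ler_wpM2l//.
by apply: le_trans Xk _; rewrite exprS -/X ler_peMl//; lra.
Qed.

(** From [x <= expR x] with [x = k r / (n + 1)], raised to the power [n + 1]: this gives one power
    of [r] more than needed, which beats the constant [B]. *)
Lemma expR_dominates (k B : R) (n : nat) : 0 < k ->
  exists2 r0 : R, 1 <= r0 & forall r, r0 <= r -> B * r ^+ n <= expR (k * r).
Proof.
move=> k0; pose c := (k / n.+1%:R) ^+ n.+1.
have n0 : 0 < n.+1%:R :> R by rewrite ltr0n.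
have c0 : 0 < c by rewrite exprn_gt0// divr_gt0.
exists (Num.max 1 (B / c)) => [|r]; first by rewrite le_max lexx.
rewrite ge_max => /andP[r1 rB]; have r0 : 0 < r by lra.
have -> : expR (k * r) = expR (k / n.+1%:R * r) ^+ n.+1.
  by rewrite -expRM_natl; congr expR; field; rewrite gt_eqF.
apply: (@le_trans _ _ ((k / n.+1%:R * r) ^+ n.+1)); last first.
  have x0 : 0 <= k / n.+1%:R * r by rewrite mulr_ge0 ?divr_ge0 ?ltW.
  rewrite lerXn2r ?nnegrE ?expR_ge0//.
  by apply: le_trans (expR_ge1Dx _); rewrite lerDr.
rewrite exprMn -/c exprS mulrA ler_wpM2r ?(exprn_ge0 _ (ltW r0))//.
by rewrite mulrC -ler_pdivrMr.
Qed.

(** The squared modulus is the sum of the squares of the real parts of [f] and [- i f], and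
    [is_derive_line] differentiates both. *)
Lemma is_derive_sqr_modulus f z v D (s : R) :
  is_derive (z + s%:C%C * v) 1 f D ->
  is_derive s 1 (fun t : R => modulus (f (z + t%:C%C * v)) ^+ 2)
    (2 * complex.Re (conjc (f (z + s%:C%C * v)) * D * v)).
Proof.
move=> fD; have XD := is_derive_line 1 fD.
have YD := is_derive_line (Complex 0 (-1)) fD.
have H := is_deriveD (is_deriveX 2 XD) (is_deriveX 2 YD).
have E : (fun t : R => modulus (f (z + t%:C%C * v)) ^+ 2) =
    (fun t : R => complex.Re (1 * f (z + t%:C%C * v))) ^+ 2 +
    (fun t : R => complex.Re (Complex 0 (-1) * f (z + t%:C%C * v))) ^+ 2.
  apply/funext => t; change (modulus (f (z + t%:C%C * v)) ^+ 2 =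
    complex.Re (1 * f (z + t%:C%C * v)) ^+ 2 +
    complex.Re (Complex 0 (-1) * f (z + t%:C%C * v)) ^+ 2).
  by rewrite modulus_sqr mul1r cReM /= mul0r sub0r mulN1r opprK.
rewrite E; apply: is_derive_eq; move: (f _) => u.
rewrite /GRing.scale /= !expr1.
by move: u D v {fD XD YD H E} => [u1 u2] [x y] [v1 v2] /=; ring.
Qed.

(** A Gronwall argument for [phi = |F|^2]: the coefficient [a] gives [2 phi / t], and splitting
    [2 |F| |b|] by the arithmetic-geometric inequality adds [phi / t] and [B^2 t^(2n+1)]. Thus the
    derivative of [phi / t^3] is polynomially bounded from above. *)
Lemma ray_polynomial_bound F (a b : C -> C) w (B r0 : R) (n : nat) :
  modulus w = 1 -> 1 <= r0 ->
  (forall r : R, r0 <= r -> [/\ is_derive (r%:C%C * w : C) 1 F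
      (a (r%:C%C * w) * F (r%:C%C * w) + b (r%:C%C * w)),
    modulus (a (r%:C%C * w)) <= r^-1 & modulus (b (r%:C%C * w)) <= B * r ^+ n])
      ->
  exists2 A : R, 0 <= A & exists k : nat, forall r : R, r0 <= r ->
    modulus (F (r%:C%C * w)) <= A * r ^+ k.
Proof.
move=> w1 r01 H.
pose phi (t : R) := modulus (F (0 + t%:C%C * w)) ^+ 2.
pose dphi (t : R) := 2 * complex.Re (conjc (F (t%:C%C * w)) *
  (a (t%:C%C * w) * F (t%:C%C * w) + b (t%:C%C * w)) * w).
have phiD t : r0 <= t -> is_derive t 1 phi (dphi t).
  move=> /H[FD _ _]; rewrite /dphi -[X in conjc (F X)]add0r.
  by apply: is_derive_sqr_modulus; rewrite add0r.
have phi0 t : 0 <= phi t by exact: sqr_ge0.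
have dphi_le t : r0 <= t -> dphi t <= 3 * phi t / t + B ^+ 2 * t ^+ n.*2.+1.
  move=> rt; have [_ at1 bt] := H t rt; have t0 : 0 < t by lra.
  rewrite /dphi /phi add0r; move: (F _) at1 bt => u.
  move: (a _) (b _) => x y at1 bt; have u0 := modulus_ge0 u.
  have : complex.Re (conjc u * (x * u + y) * w) <=
      modulus u * (modulus x * modulus u + modulus y).
    apply: le_trans (ler_norm _) _; apply: le_trans (normr_Re _) _.
    rewrite !modulusM w1 mulr1 modulus_conj ler_wpM2l//.
    by rewrite -modulusM ler_modulusD.
  have h1 : modulus u * (modulus x * modulus u + modulus y) <=
      modulus u ^+ 2 / t + modulus u * (B * t ^+ n).
    rewrite mulrDr lerD ?ler_wpM2l// expr2 -mulrA ler_wpM2l// mulrC.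
    by rewrite ler_wpM2l.
  have h2 : 2 * (modulus u * (B * t ^+ n)) <=
      modulus u ^+ 2 / t + B ^+ 2 * t ^+ n.*2.+1.
    rewrite -(ler_pM2r t0) [X in _ <= X]mulrDl divfK ?gt_eqF//.
    have -> : B ^+ 2 * t ^+ n.*2.+1 * t = (B * t ^+ n * t) ^+ 2.
      by rewrite -muln2 (exprS t (n * 2)) !exprMn -exprM; ring.
    have := sqr_ge0 (modulus u - B * t ^+ n * t).
    by rewrite sqrrB; lra.
  lra.
pose g (t : R) := (t ^+ 3)^-1.
have gD t : r0 <= t -> is_derive t 1 g (- (3 * t ^+ 2) / (t ^+ 3) ^+ 2).
  move=> rt; have t0 : t != 0 by rewrite gt_eqF//; lra.
  apply: is_derive_inv; first by rewrite expf_neq0.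
  apply: is_derive_eq.
  by rewrite /GRing.scale /=; ring.
exists (phi r0 + B ^+ 2 + 1); first by rewrite !addr_ge0 ?sqr_ge0.
exists (n.*2 + 5)%N => r rr0.
have [s /andP[rs sr]] := is_derive_MVT rr0 (fun t (H : r0 <= t <= r) =>
  is_deriveM (phiD t (proj1 (andP H))) (gD t (proj1 (andP H)))).
rewrite /GRing.scale /=.
set X := phi s * _ + _ => sE.
have r1 : 1 <= r by lra.
have s1 : 1 <= s by lra.
have sn0 : s != 0 by rewrite gt_eqF//; lra.
have gs0 : 0 <= g s by rewrite invr_ge0 exprn_ge0//; lra.
have gs1 : g s <= 1 by rewrite invf_le1 ?exprn_gt0 ?exprn_ege1//; lra.
have XB : X <= B ^+ 2 * r ^+ n.*2.+1.
  have -> : X = g s * (dphi s - 3 * phi s / s) by rewrite /X /g; field.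
  have Bs0 : 0 <= B ^+ 2 * s ^+ n.*2.+1.
    by rewrite mulr_ge0 ?sqr_ge0// exprn_ge0//; lra.
  apply: (@le_trans _ _ (B ^+ 2 * s ^+ n.*2.+1)).
    apply: (@le_trans _ _ (g s * (B ^+ 2 * s ^+ n.*2.+1))).
      by rewrite ler_wpM2l// lerBlDl dphi_le.
    by rewrite ler_piMl.
  by rewrite ler_wpM2l ?sqr_ge0// lerXn2r// nnegrE; lra.
have r_gt0 : 0 < r by lra.
have phir : phi r <= (phi r0 + B ^+ 2 * r ^+ n.*2.+1 * r) * r ^+ 3.
  have r3 : 0 < r ^+ 3 by rewrite exprn_gt0.
  rewrite -ler_pdivrMr//.
  have gr0 : phi r0 * g r0 <= phi r0.
    by rewrite ler_piMr// invf_le1 ?exprn_gt0 ?exprn_ege1//; lra.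
  have Y0 : 0 <= B ^+ 2 * r ^+ n.*2.+1.
    by rewrite mulr_ge0 ?sqr_ge0 ?exprn_ge0// ltW.
  have Xr : X * (r - r0) <= B ^+ 2 * r ^+ n.*2.+1 * (r - r0).
    by rewrite ler_wpM2r// subr_ge0.
  have Yr : B ^+ 2 * r ^+ n.*2.+1 * (r - r0) <= B ^+ 2 * r ^+ n.*2.+1 * r.
    by rewrite ler_wpM2l//; lra.
  have : phi r * g r - phi r0 * g r0 = X * (r - r0) by exact: sE.
  rewrite [X in X - _ = _](_ : _ = phi r / r ^+ 3)//; lra.
set T := phi r0 + B ^+ 2 + 1; have T1 : 1 <= T.
  by rewrite /T lerDr addr_ge0 ?sqr_ge0.
have rn1 : 1 <= r ^+ (n.*2 + 5) by rewrite exprn_ege1.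
have phiT : phi r <= T * r ^+ (n.*2 + 5).
  apply: le_trans phir _.
  have -> : (phi r0 + B ^+ 2 * r ^+ n.*2.+1 * r) * r ^+ 3 =
      phi r0 * r ^+ 3 + B ^+ 2 * r ^+ (n.*2 + 5).
    by rewrite (exprS r n.*2) exprD; ring.
  have r35 : r ^+ 3 <= r ^+ (n.*2 + 5) by rewrite ler_weXn2l// addnC.
  have := ler_wpM2l (phi0 r0) r35; rewrite /T; lra.
have T0 : 0 <= T := le_trans ler01 T1.
have rn0 := le_trans ler01 rn1.
rewrite -(@ler_pXn2r _ 2) ?nnegrE ?modulus_ge0 ?mulr_ge0//.
rewrite /phi add0r in phiT; apply: le_trans phiT _.
by rewrite expr2 ler_peMl ?mulr_ege1 ?mulr_ge0.
Qed.

(** For [phi = |F|^2], using [2 |F| <= 1 + |F|^2] on the inhomogeneous term,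
    [phi' >= 3/2 L (phi - 1/3)]. Hence [(phi - 1/3) exp (- 3/2 L t)] does not decrease, and it
    starts from at least [2/3]. *)
Lemma growing_segment F (a b : C -> C) z v (d L : R) :
  modulus v = 1 -> 0 <= d -> 0 < L -> 
  (forall s : R, 0 <= s <= d -> [/\ is_derive (z + s%:C%C * v) 1 F
      (a (z + s%:C%C * v) * F (z + s%:C%C * v) + b (z + s%:C%C * v)),
    L <= complex.Re (a (z + s%:C%C * v) * v) &
    modulus (b (z + s%:C%C * v)) <= L / 2]) ->
  1 < modulus (F z) -> expR (L * d) <= 2 * modulus (F (z + d%:C%C * v)) ^+ 2.
Proof.
move=> v1 d0 L0 H Fz.
pose phi (t : R) := modulus (F (z + t%:C%C * v)) ^+ 2.
pose dphi (t : R) := 2 * complex.Re (conjc (F (z + t%:C%C * v)) *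
  (a (z + t%:C%C * v) * F (z + t%:C%C * v) + b (z + t%:C%C * v)) * v).
have phiD (t : R) : 0 <= t <= d -> is_derive t 1 phi (dphi t).
  by move=> /H[FD _ _]; exact: is_derive_sqr_modulus.
have dphi_ge (t : R) : 0 <= t <= d -> 3 / 2 * L * (phi t - 3^-1) <= dphi t.
  move=> /H[_ aL bL]; rewrite /dphi /phi; move: (F _) aL bL => u.
  move: (a _) (b _) => x y aL bL; have u0 := modulus_ge0 u.
  have -> : conjc u * (x * u + y) * v =
      x * v * (modulus u ^+ 2)%:C%C + conjc u * y * v.
    have -> : ((modulus u ^+ 2)%:C)%C = conjc u * u :> C.
      case: u {u0} => u1 u2; apply/eqP; rewrite eq_complex modulus_sqr /=.
      by apply/andP; split; apply/eqP; ring.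
    by ring.
  rewrite cReD cReM_real.
  have h1 : L * modulus u ^+ 2 <= complex.Re (x * v) * modulus u ^+ 2.
    by rewrite ler_wpM2r// sqr_ge0.
  have h2 : - (modulus u * (L / 2)) <= complex.Re (conjc u * y * v).
    have := normr_Re (conjc u * y * v).
    rewrite !modulusM v1 mulr1 modulus_conj ler_norml => /andP[h _].
    by apply: le_trans h; rewrite lerN2 ler_wpM2l.
  have h3 : L * (2 * modulus u) <= L * (1 + modulus u ^+ 2).
    by rewrite ler_pM2l//; have := sqr_ge0 (1 - modulus u); rewrite sqrrB; lra.
  lra.
pose k := - (3 / 2 * L).
have eD (t : R) : is_derive t 1 (fun s : R => expR (k * s)) (k * expR (k * t)).
  have kD : is_derive t 1 (fun s : R => k * s) k.
    apply: is_derive_eq; by rewrite /GRing.scale /= mulr1.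
  have := realfun.is_derive1_comp (is_derive_expR (k * t)) kD.
  by rewrite mulrC.
have [s /andP[s0 sd]] := is_derive_MVT d0 (fun t (H : 0 <= t <= d) =>
  is_deriveM (is_deriveB (phiD t H) (is_derive_cst (3^-1 : R) t 1)) (eD t)).
rewrite /GRing.scale /= !subr0; set X := (X in _ = X * d -> _); move=> sE.
have X0 : 0 <= X.
  have -> : X = expR (k * s) * (dphi s - 3 / 2 * L * (phi s - 3^-1)).
    rewrite /X -[(phi - _) s]/(phi s - 3^-1) /k; ring.
  by rewrite mulr_ge0 ?expR_ge0// subr_ge0 dphi_ge// s0.
have {}sE : (phi d - 3^-1) * expR (k * d) - (phi 0 - 3^-1) * expR (k * 0) = X *
  d.
  exact: sE.
rewrite mulr0 expR0 mulr1 in sE.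
have phi01 : 1 <= phi 0.
  by rewrite /phi mul0r addr0 exprn_ege1// ltW.
have Xd : 0 <= X * d by rewrite mulr_ge0.
have H1 : 2 / 3 <= (phi d - 3^-1) * expR (k * d) by lra.
rewrite /k mulNr expRN ler_pdivlMr ?expR_gt0// in H1.
have H2 : expR (L * d) <= expR (3 / 2 * L * d).
  by rewrite ler_expR -mulrA ler_peMl ?mulr_ge0 ?(ltW L0)//; lra.
have := expR_ge0 (L * d); rewrite -/(phi d); lra.
Qed.

End Asymptotics.

(** * Phragmen-Lindelof principle *)
Section PhragmenLindelof.
Context {R : realType}.
Local Notation C := (Cplx R).
Implicit Types (z w v nu : C) (f g G : C -> C).

(** The closed sector [|arg (nu z)| <= pi / 2^(m+2)], with the origin, written without arguments:
    each squaring doubles the angle, and the conditions for smaller [j] exclude the other sectors on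
    which the last real part is nonnegative. *)
Definition sector nu (m : nat) : set C :=
  [set z | forall j, (j <= m.+1)%N -> 0 <= complex.Re ((nu * z) ^+ (2 ^ j))].

Lemma horner_pow nu (n : nat) z : ((nu *: 'X) ^+ n).[z] = (nu * z) ^+ n.
Proof. by rewrite horner_exp hornerZ hornerX. Qed.

Lemma continuous_Re_pow nu (n : nat) :
  continuous (fun z : C => complex.Re ((nu * z) ^+ n)).
Proof.
move=> z; have H : {for z, continuous (fun w => (nu * w) ^+ n)}.
  have /is_derive1_continuous := is_derive1_horner ((nu *: 'X) ^+ n) z.
  by rewrite (_ : (fun w => _) = (fun w => (nu * w) ^+ n))//;
    apply/funext => w; rewrite horner_pow.
exact: (@continuous_comp _ _ _ (fun w => (nu * w) ^+ n)
  (@complex.Re R : C -> R) z H (@continuous_Re R _)).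
Qed.

Lemma closed_sector nu (m : nat) : closed (sector nu m).
Proof.
have -> : sector nu m = \bigcap_(j in [set j | (j <= m.+1)%N])
    [set z | - complex.Re ((nu * z) ^+ (2 ^ j)) <= 0].
  by apply/seteqP; split=> z H j /H; rewrite /= oppr_le0.
apply: closed_bigI => j _; apply: closed_sublevel => z.
exact: (continuousN (@continuous_Re_pow nu _ z)).
Qed.

Lemma nbhs_sector nu (m : nat) z :
  (forall j, (j <= m.+1)%N -> 0 < complex.Re ((nu * z) ^+ (2 ^ j))) ->
  nbhs z (sector nu m).
Proof.
move=> H; rewrite /sector.
suff : forall k, (k <= m.+2)%N -> \forall w \near z,
    forall j, (j < k)%N -> 0 <= complex.Re ((nu * w) ^+ (2 ^ j)).
  by move=> /(_ m.+2 (leqnn _)); apply: filterS => w Hw j; exact: Hw.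
elim=> [|k IH] km; first by apply/nbhs_modulusP; exists 1.
have Hk : \forall w \near z, 0 <= complex.Re ((nu * w) ^+ (2 ^ k)).
  have /nbhs_ballP[e /= e0 eP] : nbhs (complex.Re ((nu * z) ^+ (2 ^ k))) [set x
    : R | 0 < x].
    by apply: lt_nbhsr => /=; apply: H.
  have : nbhs z ((fun w : C =>
    complex.Re ((nu * w) ^+ (2 ^ k))) @^-1` [set x : R | 0 < x]).
    by apply: (@continuous_Re_pow nu (2 ^ k) z); apply/nbhs_ballP; exists e.
  by apply: filterS => w /= /ltW.
apply: filterS2 (IH (ltnW km)) Hk => w H1 H2 j.
by rewrite ltnS leq_eqVlt => /orP[/eqP->//|]; exact: H1.
Qed.

Lemma Re_sqr_eq0 z : complex.Re z = 0 -> 0 <= complex.Re (z ^+ 2) -> z = 0.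
Proof.
case: z => x y; rewrite expr2 cReM /= => ->; rewrite mul0r sub0r oppr_ge0 => H.
have : y ^+ 2 == 0 by rewrite eq_le expr2 H -expr2 sqr_ge0.
by rewrite sqrf_eq0 => /eqP ->.
Qed.

(** If an earlier real part vanishes, that power is purely imaginary and its square has nonnegative
    real part, so it is 0 and so are the later powers. Only the condition for [m.+1] therefore
    describes the boundary. *)
Lemma sector_boundary nu (m : nat) z j : sector nu m z -> (j <= m.+1)%N ->
  complex.Re ((nu * z) ^+ (2 ^ j)) = 0 ->
  complex.Re ((nu * z) ^+ (2 ^ m.+1)) = 0.
Proof.
move=> Sz; rewrite leq_eqVlt => /orP[/eqP->//|jm] R0.
have := Sz j.+1 jm; rewrite expnSr exprM => /(Re_sqr_eq0 R0) u0.
rewrite -(subnK jm) addnC expnD expnSr -mulnA exprM u0 expr0n /=.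
by rewrite muln_eq0 expn_eq0.
Qed.

(** The comparison function is [h = G (1 + nu w)^(-M) exp (- eps (nu w)^(2^m))]. The exponential
    beats [exp (|w|^K)] on far arcs because [K < 2^m], and the first factor cancels the polynomial
    growth on the boundary rays. *)
Lemma phragmen_lindelof_sector G (Q : {poly C}) nu (m K M : nat) (A r1 : R) :
  Q != 0 -> (forall z, {for z, continuous G}) ->
  (forall z, Q.[z] != 0 -> twice_derivable G z) ->
  (K < 2 ^ m)%N -> modulus nu = 1 -> 0 <= A ->
  (forall z, r1 <= modulus z -> modulus (G z) <= expR (modulus z ^+ K)) ->
  (forall z, sector nu m z -> complex.Re ((nu * z) ^+ (2 ^ m.+1)) = 0 ->
     modulus (G z) <= A * (1 + modulus z) ^+ M) ->
  forall z, sector nu m z ->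
    modulus (G z) <= (A + 1) * 2 ^+ M * expR 1 * (1 + modulus z) ^+ M.
Proof.
move=> Q0 Gc GT Km nu1 A0 Ggrow Gray z Sz.
(* Instead of letting [eps] tend to 0, it is adapted to the point [z]: undoing the exponential
   factor at [z] costs at most [expR 1]. *)
pose eps := (1 + modulus z ^+ (2 ^ m))^-1.
have zm0 : 0 <= modulus z ^+ (2 ^ m) by rewrite exprn_ge0 ?modulus_ge0.
have eps0 : 0 < eps by rewrite invr_gt0; lra.
pose P1 : {poly C} := (1 + nu *: 'X) ^+ M.
pose P2 : {poly C} := - (eps%:C%C *: (nu *: 'X) ^+ (2 ^ m)).
have P1E w : P1.[w] = (1 + nu * w) ^+ M.
  by rewrite /P1 horner_exp hornerD hornerZ hornerX hornerC.
have P2E w : P2.[w] = - (eps%:C%C * (nu * w) ^+ (2 ^ m)).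
  by rewrite /P2 hornerN hornerZ horner_pow.
pose h w := G w * (P1.[w]^-1 * cexp P2.[w]).
have mnu w : modulus (nu * w) = modulus w by rewrite modulusM nu1 mul1r.
(* As [nu * w] has nonnegative real part, [|1 + nu w|^2 >= 1 + |w|^2 >= (1 + |w|)^2 / 4]; this is
   the origin of the factor [2 ^+ M]. *)
have half w : sector nu m w -> (1 + modulus w) / 2 <= modulus (1 + nu * w).
  move=> Sw; have := Sw 0%N isT; rewrite expn0 expr1 => Rw.
  rewrite -(@ler_pXn2r _ 2) ?nnegrE ?modulus_ge0//; last first.
    by rewrite divr_ge0 ?addr_ge0 ?modulus_ge0.
  rewrite modulus_sqr cReD cImD /= add0r -(mnu w).
  have := modulus_sqr (nu * w); have := modulus_ge0 (nu * w).
  have := sqr_ge0 (modulus (nu * w) - 1); nra.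
have P1lb w : sector nu m w -> ((1 + modulus w) / 2) ^+ M <= modulus P1.[w].
  move=> Sw; rewrite P1E modulusX lerXn2r ?nnegrE ?modulus_ge0 ?half//.
  by rewrite divr_ge0 ?addr_ge0 ?modulus_ge0.
have w2 w : 0 < ((1 + modulus w) / 2) ^+ M.
  by rewrite exprn_gt0// divr_gt0// ltr_wpDr ?modulus_ge0.
have P1n0 w : sector nu m w -> P1.[w] != 0.
  by move=> Sw; rewrite -modulus_gt0; apply: lt_le_trans (P1lb w Sw).
(* For [u = (nu w)^(2^m)] both [Re u] and [Re (u^2)] are nonnegative, so [u] lies within angle
   [pi / 4] of the positive axis and [Re u >= |u| / 2]. *)
have ReP2 w : sector nu m w ->
    complex.Re P2.[w] <= - (eps / 2 * modulus w ^+ (2 ^ m)).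
  move=> Sw; rewrite P2E cReN lerN2 (mulrC eps%:C%C) cReM_real.
  rewrite (mulrC _ eps) -mulrA ler_pM2l//.
  have := Sw m (leqnSn m); have := Sw m.+1 (leqnn _).
  rewrite expnSr exprM; set u := (nu * w) ^+ (2 ^ m) => H1 H0.
  have -> : modulus w ^+ (2 ^ m) = modulus u by rewrite /u modulusX mnu.
  rewrite -(@ler_pXn2r _ 2) ?nnegrE//; last by rewrite mulr_ge0 ?modulus_ge0.
  rewrite exprMn modulus_sqr; move: H1; rewrite expr2 cReM.
  have := sqr_ge0 (complex.Re u); nra.
have P2le1 w : sector nu m w -> modulus (cexp P2.[w]) <= 1.
  move=> Sw; rewrite modulus_cexp -expR0 ler_expR;
    apply: le_trans (ReP2 w Sw) _.
  by rewrite oppr_le0 !mulr_ge0 ?exprn_ge0 ?modulus_ge0// ltW.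
have mh w : sector nu m w -> modulus (h w) <=
    modulus (G w) * modulus (cexp P2.[w]) / ((1 + modulus w) / 2) ^+ M.
  move=> Sw; rewrite /h !modulusM modulusV mulrA mulrAC ler_wpM2l//.
    by rewrite mulr_ge0 ?modulus_ge0.
  rewrite lef_pV2 ?posrE ?P1lb//; last by rewrite modulus_gt0 P1n0.
(* On the arc, [Rr >= 2 / eps] gives [Rr^K <= eps / 2 * Rr^(K+1)], which is at most the decay
   exponent. *)
pose Rr := Num.max (Num.max 1 (2 / eps)) (Num.max r1 (modulus z)).
have [R1 Re Rr1 Rz] : [/\ 1 <= Rr, 2 / eps <= Rr, r1 <= Rr & modulus z <= Rr].
  by rewrite /Rr !le_max !lexx ?orbT.
pose KR : set C := sector nu m `&` [set w | modulus w <= Rr].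
have KRc : compact KR.
  apply: (@compact_disc _ Rr) => [|w []//].
  by apply: closedI; [exact: closed_sector|exact: closed_sublevel
    continuous_modulus].
have PT w : sector nu m w -> twice_derivable (fun w =>
  P1.[w]^-1 * cexp P2.[w]) w.
  move=> Sw; apply: twice_derivableM.
    apply: (twice_derivableV (f := fun w => P1.[w])); first exact: P1n0.
    exact: twice_derivable_horner.
  apply: (twice_derivable_cexp (f := fun w => P2.[w])).
  exact: twice_derivable_horner.
pose B := (A + 1) * 2 ^+ M.
have B0 : 0 <= B by rewrite mulr_ge0 ?exprn_ge0//; lra.
have hc w : KR w -> {for w, continuous h}.
  by move=> [Sw _]; exact: (continuousM (Gc w) (twice_derivable_continuous (PT
    w Sw))).
have hT w : KR w -> Q.[w] != 0 -> twice_derivable h w.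
  by move=> [Sw _] Qw; exact: (twice_derivableM (GT w Qw) (PT w Sw)).
have hB w : KR w -> modulus (h w) <= B \/ nbhs w KR.
  move=> [Sw]; rewrite /= le_eqVlt => /orP[/eqP wR|wR].
    left; apply: le_trans (mh w Sw) _; rewrite ler_pdivrMr//.
    apply: (@le_trans _ _ 1).
      apply: (@le_trans _ _ (expR (modulus w ^+ K) * expR (complex.Re P2.[w]))).
        by rewrite modulus_cexp ler_wpM2r ?expR_ge0// Ggrow// wR.
      rewrite -expRD -expR0 ler_expR -lerBrDr sub0r.
      rewrite -lerN2 opprK; apply: le_trans (ReP2 w Sw) _; rewrite lerN2 wR.
      apply: (@le_trans _ _ (eps / 2 * Rr ^+ K.+1)); last first.
        by rewrite ler_wpM2l ?divr_ge0 ?(ltW eps0)// ler_weXn2l.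
      rewrite exprS mulrA ler_peMl ?exprn_ge0//; first by lra.
      by rewrite ler_pdivrMr// mulrC in Re; lra.
    rewrite /B expr_div_n -mulrA [2 ^+ M * _]mulrC divfK ?expf_neq0//.
    rewrite wR mulr_ege1//; first by lra.
    by rewrite exprn_ege1//; lra.
  have [Hp|Hn] := pselect (forall j,
    (j <= m.+1)%N -> 0 < complex.Re ((nu * w) ^+ (2 ^ j))).
    right; apply: filterI; first exact: nbhs_sector.
    exact: nbhs_disc.
  left; have [j jm Rj] : exists2 j,
    (j <= m.+1)%N & complex.Re ((nu * w) ^+ (2 ^ j)) = 0.
    apply: contrapT => Hj; apply: Hn => j jm; rewrite lt_neqAle Sw// andbT.
    by rewrite eq_sym; apply/eqP => Rj; apply: Hj; exists j.
  have := Gray w Sw (sector_boundary Sw jm Rj) => GA.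
  apply: le_trans (mh w Sw) _; rewrite ler_pdivrMr//.
  apply: (@le_trans _ _ (A * (1 + modulus w) ^+ M)).
    apply: le_trans GA; rewrite ler_piMr ?modulus_ge0//; exact: P2le1.
  rewrite /B expr_div_n -mulrA [2 ^+ M * _]mulrC divfK ?expf_neq0//.
  rewrite ler_wpM2r ?exprn_ge0 ?addr_ge0 ?modulus_ge0//; lra.
have KRz : KR z by split.
have := maximum_modulus B0 KRc Q0 hc hT hB KRz.
rewrite /h !modulusM modulusV modulus_cexp => H.
have P1z : 0 < modulus P1.[z] by rewrite modulus_gt0 P1n0.
have P1ub : modulus P1.[z] <= (1 + modulus z) ^+ M.
  rewrite P1E modulusX lerXn2r ?nnegrE ?modulus_ge0 ?addr_ge0 ?modulus_ge0//.
  by apply: le_trans (ler_modulusD _ _) _; rewrite modulus1 mnu.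
have ReP2lb : -1 <= complex.Re P2.[z].
  have := normr_Re P2.[z]; rewrite P2E modulusN modulusM modulus_real modulusX
    mnu.
  rewrite (gtr0_norm eps0) ler_norml => /andP[Hl _]; apply: le_trans Hl.
  by rewrite lerN2 /eps mulrC ler_pdivrMr ?mul1r; lra.
have : modulus (G z) <= B * (modulus P1.[z] / expR (complex.Re P2.[z])).
  have E0 := expR_gt0 (complex.Re P2.[z]).
  by rewrite mulrA ler_pdivlMr// -ler_pdivrMr// mulrAC -mulrA.
move=> /le_trans; apply; rewrite -/B -mulrA ler_wpM2l// mulrC -expRN.
by rewrite ler_pM ?expR_ge0 ?modulus_ge0// ler_expR; lra.
Qed.

(** At each stage the square root with nonnegative real part is taken. Sectors containing a given
    point are found this way. *)
Lemma iterated_sqrt (k : nat) (y : C) : exists2 w : C, w ^+ (2 ^ k) = y &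
  forall j, (j < k)%N -> 0 <= complex.Re (w ^+ (2 ^ j)).
Proof.
elim: k y => [|k IH] y; first by exists y; rewrite ?expn0 ?expr1.
have [w wy wP] := IH y.
have [v vw v0] : exists2 v : C, v ^+ 2 = w & 0 <= complex.Re v.
  have [s0|s0] := leP 0 (complex.Re (sqrtc w)).
    by exists (sqrtc w); rewrite ?sqr_sqrtc.
  by exists (- sqrtc w); rewrite ?sqrrN ?sqr_sqrtc// cReN oppr_ge0 ltW.
exists v; first by rewrite expnS exprM vw.
by case=> [_|j jk]; rewrite ?expn0 ?expr1// expnS exprM vw; exact: wP.
Qed.

(** The sectors with [nu ^+ N = kap], where [N = 2^(m+2)], cover the plane. On a boundary ray
    [(nu z)^(N/2)] is purely imaginary, so its square [kap z^N] is [- |z|^N], whichever [nu] is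
    used. *)
Lemma phragmen_lindelof G (Q : {poly C}) kap (m K M : nat) (A r1 : R) :
  Q != 0 -> (forall z, {for z, continuous G}) ->
  (forall z, Q.[z] != 0 -> twice_derivable G z) ->
  (K < 2 ^ m)%N -> modulus kap = 1 -> 0 <= A ->
  (forall z, r1 <= modulus z -> modulus (G z) <= expR (modulus z ^+ K)) ->
  (forall z, kap * z ^+ (2 ^ m.+2) = - (modulus z ^+ (2 ^ m.+2))%:C%C ->
     modulus (G z) <= A * (1 + modulus z) ^+ M) ->
  exists2 B : R, 0 <= B & forall z, modulus (G z) <= B * (1 + modulus z) ^+ M.
Proof.
move=> Q0 Gc GT Km kap1 A0 Ggrow Gray.
pose N := (2 ^ m.+2)%N; have N0 : (0 < N)%N by rewrite expn_gt0.
exists ((A + 1) * 2 ^+ M * expR 1) => [|z].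
  by rewrite !mulr_ge0 ?exprn_ge0 ?expR_ge0//; lra.
have [nu nuN Snu] : exists2 nu : C, nu ^+ N = kap & sector nu m z.
  have [->|z0] := eqVneq z 0.
    have [nu nuN _] := iterated_sqrt m.+2 kap; exists nu => // j _.
    by rewrite mulr0 expr0n expn_eq0.
  have [w wN wP] := iterated_sqrt m.+2 (kap * z ^+ N).
  (* With this [nu], the product [nu * z] is the chosen root [w], whose iterated squares have
     nonnegative real parts. *)
  exists (w / z); first by rewrite expr_div_n wN mulfK// expf_neq0.
  by move=> j jm; rewrite divfK//; apply: wP.
have nu1 : modulus nu = 1.
  apply/eqP; rewrite -(@eqrXn2 _ N)// ?modulus_ge0// expr1n -modulusX nuN.
  by rewrite kap1.
apply: (phragmen_lindelof_sector Q0 Gc GT Km nu1 A0 Ggrow _ Snu).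
move=> w Sw Rw; apply: Gray; rewrite -/N -nuN -exprMn.
rewrite /N expnSr exprM [in RHS]exprM -(mul1r (modulus w)) -nu1 -modulusM
  -modulusX.
move: Rw; case: ((nu * w) ^+ _) => x y /= ->.
rewrite modulus_sqr /=; apply/eqP; rewrite eq_complex !expr2 /=.
by apply/andP; split; apply/eqP; ring.
Qed.

End PhragmenLindelof.

(** * Growth of solutions along rays *)
Section Rays.
Context {R : realType}.
Local Notation C := (Cplx R).
Implicit Types (z w h u v e : C) (F : C -> C) (p d q : {poly C}).

Lemma modulus_ray w (r : R) : modulus w = 1 -> 0 <= r ->
  modulus (r%:C%C * w) = r.
Proof. by move=> w1 r0; rewrite modulusM modulus_real w1 mulr1 ger0_norm. Qed.

Lemma Re_horner_ray q w : modulus w = 1 -> (1 < size q)%N ->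
  0 < complex.Re (lead_coef q * w ^+ (size q).-1) ->
  exists2 k : R, 0 < k & exists2 r0 : R, 1 <= r0 & forall r, r0 <= r ->
    k * r <= complex.Re q.[r%:C%C * w].
Proof.
move=> w1 sq l0; have [A A0 qA] := horner_lead q.
set n := (size q).-1 in l0 qA *; set l := complex.Re _ in l0.
have n0 : (0 < n)%N by rewrite /n -subn1 subn_gt0.
exists (l / 2); first by rewrite divr_gt0.
exists (Num.max 1 (2 * A / l)) => [|r]; first by rewrite le_max lexx.
rewrite ge_max ler_pdivrMr// => /andP[r1 rA]; have r0 : 0 < r by lra.
have zr := modulus_ray w1 (ltW r0); have := qA (r%:C%C * w); rewrite zr.
move=> /(_ r1) H.
have X0 : 0 < r ^+ n by rewrite exprn_gt0.
have rX : r <= r ^+ n by rewrite -{1}(expr1 r) ler_weXn2l.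
have := normr_Re (q.[r%:C%C * w] - lead_coef q * (r%:C%C * w) ^+ n).
rewrite cReB ler_norml => /andP[Hl _].
have RE : complex.Re (lead_coef q * (r%:C%C * w) ^+ n) = r ^+ n * l.
  rewrite exprMn -rmorphXn mulrCA mulrC cReM_real mulrC.
  by [].
rewrite RE in Hl.
have H2 : modulus (q.[r%:C%C * w] - lead_coef q * (r%:C%C * w) ^+ n) <=
    l / 2 * r ^+ n.
  rewrite -(ler_pM2r r0); apply: le_trans H _; move: (ler_wpM2r (ltW X0) rA).
  by move: (r ^+ n) => X; clear; lra.
have : l / 2 * r <= l / 2 * r ^+ n by rewrite ler_pM2l// divr_gt0.
move: Hl H2; move: (modulus _) (r ^+ n) (complex.Re _) => x X y.
by clear; lra.
Qed.

Lemma near_one_quotient u v e : modulus (u - 1) <= 16^-1 ->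
  modulus (v - 1) <= 16^-1 -> modulus (e - 1) <= 16^-1 ->
  modulus (u / v * e - 1) <= 2^-1.
Proof.
move=> u1 v1 e1.
have vl : 15 / 16 <= modulus v.
  have := ler_modulus_dist 1 v; rewrite modulusB modulus1 => H.
  have := le_trans H v1; lra.
have v0 : v != 0 by rewrite -modulus_gt0; lra.
have uu : modulus u <= 17 / 16.
  have := ler_modulus_dist u 1; rewrite modulus1 => H; have := le_trans H u1;
    lra.
have -> : u / v * e - 1 = (u * (e - 1) + (u - 1) + (1 - v)) / v by field.
rewrite modulusf_div ler_pdivrMr; last by lra.
apply: le_trans (ler_modulusD _ _) _; rewrite (modulusB 1).
have := ler_modulusD (u * (e - 1)) (u - 1); rewrite modulusM.
have : modulus u * modulus (e - 1) <= 17 / 16 * 16^-1.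
  by rewrite ler_pM ?modulus_ge0.
lra.
Qed.

Lemma rational_growth p d : d != 0 -> exists2 A : R, 0 <= A & exists n : nat,
  exists2 r0 : R, 1 <= r0 & forall z, r0 <= modulus z ->
    modulus (p.[z] / d.[z]) <= A * modulus z ^+ n.
Proof.
move=> /horner_lower_const[c c0 [r0 r01 dc]]; have [A A0 pA] := horner_growth p.
exists (A / c); first by rewrite divr_ge0// ltW.
exists (size p).-1; exists r0 => // z zr.
have zc := dc z zr; have d0 : 0 < modulus d.[z] by apply: lt_le_trans zc.
rewrite modulusf_div ler_pdivrMr//.
apply: le_trans (pA z (le_trans r01 zr)) _.
have dc1 : 1 <= modulus d.[z] / c by rewrite ler_pdivlMr// mul1r.
have X0 : 0 <= A * modulus z ^+ (size p).-1.
  by rewrite mulr_ge0 ?exprn_ge0 ?modulus_ge0.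
have := ler_wpM2l X0 dc1; rewrite mulr1 => /le_trans; apply.
by rewrite le_eqVlt; apply/orP; left; apply/eqP; ring.
Qed.

Lemma rational_lower p d : p != 0 -> d != 0 -> exists2 c : R, 0 < c &
  exists n : nat, exists2 r0 : R, 1 <= r0 & forall z, r0 <= modulus z ->
    c <= modulus (p.[z] / d.[z]) * modulus z ^+ n.
Proof.
move=> p0 d0; have [A A0 [n [r0 r01 H]]] := rational_growth d p0.
have [c c0 [r1 r11 dc]] := horner_lower_const d0.
have [c' c'0 [r2 r21 pc]] := horner_lower_const p0.
exists (A + 1)^-1; first by rewrite invr_gt0; lra.
exists n; exists (Num.max r0 (Num.max r1 r2)) => [|z];
  first by rewrite le_max r01.
rewrite !ge_max => /and3P[zr0 zr1 zr2].
have dz : 0 < modulus d.[z] by apply: lt_le_trans (dc z zr1).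
have pz : 0 < modulus p.[z] by apply: lt_le_trans (pc z zr2).
have := H z zr0; rewrite !modulusf_div ler_pdivrMr// => H1.
rewrite mulrAC ler_pdivlMr// ler_pdivrMl; last by lra.
apply: le_trans H1 _; rewrite -mulrA (mulrC (modulus z ^+ n)) ler_wpM2r//.
  by rewrite mulr_ge0 ?exprn_ge0 ?modulus_ge0.
lra.
Qed.

(* If [|F| > 1] at a point where [e^q] is huge, then [|F|] explodes along a
   short segment in the direction in which [R1 e^q] is positive. *)
Lemma ray_bounded_by_1 F p1 d1 p2 d2 q w (K : nat) (rho : R) :
  p1 != 0 -> d1 != 0 -> d2 != 0 -> modulus w = 1 -> (1 < size q)%N ->
  0 < complex.Re (lead_coef q * w ^+ (size q).-1) ->
  (forall z, rho <= modulus z -> is_derive z 1 F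
     (p1.[z] / d1.[z] * cexp q.[z] * F z + p2.[z] / d2.[z])) ->
  (forall z, rho <= modulus z -> modulus (F z) <= expR (modulus z ^+ K)) ->
  exists2 r0 : R, 1 <= r0 & forall r, r0 <= r -> modulus (F (r%:C%C * w)) <= 1.
Proof.
move=> p10 d10 d20 w1 sq l0 FD Fgrow.
have [k k0 [s0 s01 qk]] := Re_horner_ray w1 sq l0.
have [A1 A10 [n1 L1]] := horner_lipschitz p1.
have [A2 A20 [n2 L2]] := horner_lipschitz d1.
have [A3 A30 [n3 L3]] := horner_lipschitz q.
have [c1 c10 [s1 s11 lp1]] := horner_lower_const p10.
have [c2 c20 [s2 s21 ld1]] := horner_lower_const d10.
have [B B0 [D [s3 s31 uB]]] := rational_growth p2 d20.
have [c3 c30 [E [s4 s41 lA]]] := rational_lower p10 d10.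
(* Taken with tolerance 1, the expansion at 0 gives [|cexp g - 1| <= 2 |g|], which turns the bound
   [1/32] on the increment of [q] into [1/16]. *)
have := is_derive1_cexp (0 : C);
  rewrite cexp0 => /is_derive_modulusP/(_ 1 ltr01).
move=> [dd dd0 eP].
pose n0 := maxn n1 (maxn n2 n3).
have [n10 n20 n30] : [/\ (n1 <= n0)%N, (n2 <= n0)%N & (n3 <= n0)%N].
  by rewrite /n0 !leq_max !leqnn ?orbT.
(* [T1] makes the inhomogeneous term at most a quarter of [|R1 e^q|] on the segment; [T2] is tuned
   to the final contradiction with the growth bound. *)
pose T1 := 4 * B * 2 ^+ D / c3.
pose T2 := 2 / c3 * (2 + 2 * 2 ^+ K).
have [s5 s51 H5] := expR_dominates T1 (D + E) k0.
have [s6 s61 H6] := expR_dominates T2 (K + E + n0.+1) k0.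
pose T := Num.max (Num.max (Num.max s0 (rho + 1)) (Num.max (s1 + 1) (s2 + 1)))
  (Num.max (Num.max (s3 + 1) (s4 + 1)) (Num.max s5 s6)).
pose T' := Num.max (Num.max (16 * A1 / c1) (16 * A2 / c2))
  (Num.max (32 * A3) (2 * A3 / dd)).
exists (Num.max T (Num.max 1 T')) => [|r]; first by rewrite !le_max lexx ?orbT.
rewrite !ge_max => /and3P[HT r1 HT'].
move: HT => /andP[/andP[/andP[rs0 rrho] /andP[rs1 rs2]]].
move=> /andP[/andP[rs3 rs4] /andP[rs5 rs6]].
move: HT' => /andP[/andP[r7 r8] /andP[r9 r10]].
rewrite leNgt; apply/negP; set z0 := r%:C%C * w => Fz0.
have r0 : 0 < r := lt_le_trans ltr01 r1.
have z0r : modulus z0 = r by rewrite /z0 modulus_ray// ltW.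
pose a z := p1.[z] / d1.[z] * cexp q.[z].
pose A0 := modulus (a z0).
(* Short enough that [p1], [d1] and [q] change by [O(1 / r)], so [a] keeps its direction up to a
   relative error of one half; long enough that [A0 * dl] is still exponentially large in [r]. *)
pose dl : R := (r ^+ n0.+1)^-1.
have rn1 : 1 <= r ^+ n0.+1 by rewrite exprn_ege1.
have rn0 : 0 < r ^+ n0.+1 by apply: lt_le_trans rn1.
have dl0 : 0 < dl by rewrite invr_gt0.
have dl1 : dl <= 1 by rewrite invf_le1.
have p1z0 : 0 < modulus p1.[z0] 
  by apply: lt_le_trans (lp1 z0 _) => //; rewrite z0r; move: rs1; clear; lra.
have d1z0 : 0 < modulus d1.[z0] 
  by apply: lt_le_trans (ld1 z0 _) => //; rewrite z0r; move: rs2; clear; lra.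
have az0 : a z0 != 0.
  by rewrite /a !mulf_neq0 ?invr_eq0 ?cexp_neq0// -modulus_gt0.
have A0_gt0 : 0 < A0 by rewrite modulus_gt0.
have incr p (A : R) (n : nat) h : 0 <= A -> (n <= n0)%N ->
    (forall z h, 1 <= modulus z -> modulus h <= 1 ->
      modulus (p.[z + h] - p.[z]) <= A * modulus z ^+ n * modulus h) ->
    modulus h <= dl -> modulus (p.[z0 + h] - p.[z0]) <= A / r.
  move=> A_ge0 nn0 L hd.
  have z01 : 1 <= modulus z0 by rewrite z0r.
  apply: le_trans (L z0 h z01 (le_trans hd dl1)) _;
    rewrite z0r -mulrA ler_wpM2l//.
  apply: (@le_trans _ _ (r ^+ n0 * dl)).
    by rewrite ler_pM ?exprn_ge0 ?modulus_ge0 ?(ltW r0)// ler_weXn2l.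
  by rewrite /dl exprSr invfM mulrA divff ?mul1r// expf_neq0// gt_eqF.
have ratio p (A c s : R) (n : nat) h : 0 <= A -> (n <= n0)%N ->
    (forall z h, 1 <= modulus z -> modulus h <= 1 ->
      modulus (p.[z + h] - p.[z]) <= A * modulus z ^+ n * modulus h) ->
    0 < c -> (forall z, s <= modulus z -> c <= modulus p.[z]) -> s + 1 <= r ->
    16 * A / c <= r -> modulus h <= dl ->
    modulus (p.[z0 + h] / p.[z0] - 1) <= 16^-1.
  move=> A_ge0 nn0 L c0 lp sr Ar hd.
  have cp : c <= modulus p.[z0].
    by apply: lp; rewrite z0r; move: sr; clear; lra.
  have pz : 0 < modulus p.[z0] by apply: lt_le_trans cp.
  have pn : p.[z0] != 0 by rewrite -modulus_gt0.
  have -> : p.[z0 + h] / p.[z0] - 1 = (p.[z0 + h] - p.[z0]) / p.[z0] by field.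
  rewrite modulusf_div ler_pdivrMr//.
  apply: le_trans (incr p A n h A_ge0 nn0 L hd) _.
  rewrite ler_pdivrMr// in Ar; rewrite ler_pdivrMr//.
  move: Ar (ler_wpM2r (ltW r0) cp); move: (modulus _) => x; clear; lra.
have aE h : modulus h <= dl -> modulus (a (z0 + h) / a z0 - 1) <= 2^-1.
  move=> hd.
  have u1 := ratio p1 A1 c1 s1 n1 h A10 n10 L1 c10 lp1 rs1 r7 hd.
  have u2 := ratio d1 A2 c2 s2 n2 h A20 n20 L2 c20 ld1 rs2 r8 hd.
  have dq := incr q A3 n3 h A30 n30 L3 hd.
  set g := q.[z0 + h] - q.[z0] in dq.
  have g32 : modulus g <= 32^-1.
    by apply: le_trans dq _; rewrite ler_pdivrMr//; move: r9; clear; lra.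
  have gdd : modulus g < dd.
    apply: le_lt_trans dq _; rewrite ltr_pdivrMr//.
    rewrite ler_pdivrMr// in r10; have : 0 < dd * r by rewrite mulr_gt0.
    by move: r10; clear; lra.
  have e1 : modulus (cexp g - 1) <= 16^-1.
    have := eP g gdd; rewrite add0r cexp0 mul1r => H.
    have := ler_modulusD (cexp g - 1 - g) g; rewrite subrK; move: H g32.
    by move: (modulus _) (modulus _) (modulus _) => x y t; clear; lra.
  have := near_one_quotient u1 u2 e1; congr (modulus (_ - 1) <= _).
  have qE : q.[z0 + h] = q.[z0] + g by rewrite /g addrCA subrr addr0.
  have cE : cexp q.[z0 + h] = cexp q.[z0] * cexp g by rewrite -cexpD -qE.
  rewrite /a cE; move: p1z0 d1z0; rewrite !modulus_gt0 => p1n d1n.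
  have en := cexp_neq0 q.[z0].
  have d1h : d1.[z0 + h] != 0.
    apply: contraTneq u2 => ->; rewrite mul0r sub0r modulusN modulus1.
    by rewrite -ltNge invf_lt1// ltr1n.
  by field; rewrite d1n d1h p1n en.
pose v := conjc (a z0) / A0%:C%C.
have A0C : (A0%:C%C : C) != 0 by rewrite -modulus_eq0 modulus_real gtr0_norm//
  gt_eqF.
have v1 : modulus v = 1.
  by rewrite modulusf_div modulus_conj modulus_real gtr0_norm// divff// gt_eqF.
have av : a z0 * v = A0%:C%C.
  have sq0 : a z0 * conjc (a z0) = (A0 ^+ 2)%:C%C.
    rewrite /A0; case: (a z0) => x y; apply/eqP;
      rewrite eq_complex modulus_sqr /=.
    by apply/andP; split; apply/eqP; ring.
  by rewrite /v mulrA sq0 expr2 rmorphM /= mulfK.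
have hs (s : R) : 0 <= s <= dl -> modulus (s%:C%C * v) <= dl.
  by move=> /andP[sge sle]; rewrite modulusM v1 mulr1 modulus_real ger0_norm.
have zh h : modulus h <= dl -> r - 1 <= modulus (z0 + h) <= 2 * r.
  move=> hd; apply/andP; split.
    have := ler_modulus_dist z0 (- h); rewrite opprK modulusN z0r.
    by move: hd dl1; move: (modulus _) (modulus _) => x y; clear; lra.
  have := ler_modulusD z0 h; rewrite z0r.
  by move: hd dl1 r1; move: (modulus _) (modulus _) => x y; clear; lra.
have A0lb : c3 * expR (k * r) <= A0 * r ^+ E.
  rewrite /A0 /a modulusM modulus_cexp mulrAC.
  apply: ler_pM; rewrite ?(ltW c30) ?expR_ge0//.
    by rewrite -z0r; apply: lA; rewrite z0r; move: rs4; clear; lra.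
  by rewrite ler_expR; exact: qk.
have rE0 : 0 < r ^+ E by rewrite exprn_gt0.
have bL h : modulus h <= dl -> modulus (p2.[z0 + h] / d2.[z0 + h]) <= A0 / 2 /
  2.
  move=> hd; have /andP[zl zu] := zh h hd.
  apply: le_trans (uB (z0 + h) _) _.
    by apply: le_trans zl; move: rs3; clear; lra.
  apply: (@le_trans _ _ (B * (2 * r) ^+ D)).
    apply: ler_wpM2l => //; apply: lerXn2r => //; rewrite nnegrE ?modulus_ge0//.
    exact: mulr_ge0 (ler0n _ _) (ltW r0).
  rewrite exprMn -(ler_pM2r rE0).
  have H := H5 r rs5; rewrite -(ler_pM2l c30) /T1 exprD in H.
  have E1 : c3 * (4 * B * 2 ^+ D / c3 * (r ^+ D * r ^+ E)) =
      4 * (B * (2 ^+ D * r ^+ D) * r ^+ E) by field; rewrite gt_eqF.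
  rewrite E1 in H; move: (le_trans H A0lb).
  by move: (_ * r ^+ E) (A0) => x y; move: (r ^+ E) => X; clear; lra.
have seg := @growing_segment R F a (fun z =>
  p2.[z] / d2.[z]) z0 v dl (A0 / 2) v1
  (ltW dl0) (divr_gt0 A0_gt0 (ltr0n _ 2)).
have {}seg : expR (A0 / 2 * dl) <= 2 * modulus (F (z0 + dl%:C%C * v)) ^+ 2.
  apply: seg => // s sdl; have hsd := hs s sdl; have /andP[zl zu] := zh _ hsd.
  split.
  - by apply: FD; apply: le_trans zl; move: rrho; clear; lra.
  - have -> : a (z0 + s%:C%C * v) * v = (a (z0 + s%:C%C * v) / a z0 - 1) *
    A0%:C%C + A0%:C%C.
      by rewrite -av; field.
    rewrite cReD cReM_real /=.
    have := le_trans (normr_Re _) (aE _ hsd); rewrite ler_norml => /andP[Hl _].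
    move: (ler_wpM2r (ltW A0_gt0) Hl); move: (complex.Re _) (A0) => x y.
    by clear; lra.
  - exact: bL.
have hdl : modulus (dl%:C%C * v) <= dl by apply: hs; rewrite lexx ltW.
have /andP[zl zu] := zh _ hdl.
have zrho : rho <= modulus (z0 + dl%:C%C * v).
  by apply: le_trans zl; move: rrho; clear; lra.
have e2 : 2 <= expR 1 :> R by apply: le_trans (expR_ge1Dx _).
have Fe := Fgrow _ zrho.
have F2 : modulus (F (z0 + dl%:C%C * v)) <= expR ((2 * r) ^+ K).
  apply: le_trans Fe _; rewrite ler_expR; apply: lerXn2r => //.
  - by rewrite nnegrE modulus_ge0.
  - by rewrite nnegrE mulr_ge0// ltW.
(* Explosion at the endpoint against the growth bound on [F] leaves [A0 * dl] polynomially bounded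
   in [r], while [A0 * r ^+ E >= c3 * expR (k * r)]. *)
have : expR (A0 / 2 * dl) <= expR (1 + 2 * (2 * r) ^+ K).
  apply: le_trans seg _; rewrite expRD; apply: ler_pM => //.
    by rewrite exprn_ge0// modulus_ge0.
  by rewrite expRM_natl lerXn2r ?nnegrE ?modulus_ge0 ?expR_ge0.
rewrite ler_expR => H.
have rK1 : 1 <= r ^+ K by rewrite exprn_ege1.
have := H6 r rs6; rewrite /T2 !exprD => H7.
have {}H : A0 * dl <= 2 * (1 + 2 * 2 ^+ K) * r ^+ K.
  have -> : A0 * dl = 2 * (A0 / 2 * dl) by field.
  rewrite exprMn in H; move: H rK1; move: (A0 / 2 * dl) (r ^+ K) (2 ^+ K).
  by clear=> x X Y; lra.
have {}H : A0 <= 2 * (1 + 2 * 2 ^+ K) * r ^+ K * r ^+ n0.+1.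
  by rewrite -ler_pdivrMr.
have {}H : A0 * r ^+ E <= 2 * (1 + 2 * 2 ^+ K) * r ^+ K * r ^+ n0.+1 * r ^+ E.
  by rewrite ler_pM2r.
have {}H := le_trans A0lb H.
have {H7} : c3 * (2 / c3 * (2 + 2 * 2 ^+ K) * (r ^+ K * r ^+ E * r ^+ n0.+1))
  <= c3 * expR (k * r).
  by rewrite ler_pM2l.
have -> : c3 * (2 / c3 * (2 + 2 * 2 ^+ K) * (r ^+ K * r ^+ E * r ^+ n0.+1)) =
   2 * (2 + 2 * 2 ^+ K) * r ^+ K * r ^+ n0.+1 * r ^+ E by field; rewrite gt_eqF.
have Y0 : 0 < r ^+ K * r ^+ n0.+1 * r ^+ E.
  by rewrite !mulr_gt0// (lt_le_trans ltr01 rK1).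
move: H Y0; move: (c3 * expR _) (r ^+ K) (r ^+ n0.+1) (r ^+ E) (2 ^+ K).
by clear=> x X Y Z t; lra.
Qed.

(** Exponential decay of [e^q] beats the rational factor, so the coefficient of [F] is at most
    [1 / r] and [ray_polynomial_bound] applies. *)
Lemma ray_polynomial_growth F p1 d1 p2 d2 q w (rho : R) :
  d1 != 0 -> d2 != 0 -> modulus w = 1 -> (1 < size q)%N ->
  complex.Re (lead_coef q * w ^+ (size q).-1) < 0 ->
  (forall z, rho <= modulus z -> is_derive z 1 F
     (p1.[z] / d1.[z] * cexp q.[z] * F z + p2.[z] / d2.[z])) ->
  exists2 A : R, 0 <= A & exists k : nat, exists r0 : R, forall r : R,
    r0 <= r ->
    modulus (F (r%:C%C * w)) <= A * r ^+ k.
Proof.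
move=> d10 d20 w1 sq l0 FD.
have [] := @Re_horner_ray (- q) w w1; first by rewrite size_polyN.
  by rewrite size_polyN lead_coefN mulNr cReN oppr_gt0.
move=> k k0 [s0 s01 qk].
have [B B0 [D [s3 s31 uB]]] := rational_growth p2 d20.
have [A A0 [E [s4 s41 uA]]] := rational_growth p1 d10.
have [s5 s51 H5] := expR_dominates A E.+1 k0.
pose T := Num.max (Num.max s0 rho) (Num.max (Num.max s3 s4) s5).
have T1 : 1 <= T by rewrite /T !le_max s01.
pose a z := p1.[z] / d1.[z] * cexp q.[z]; pose b z := p2.[z] / d2.[z].
have H (r : R) : T <= r -> [/\ is_derive (r%:C%C * w : C) 1 F
    (a (r%:C%C * w) * F (r%:C%C * w) + b (r%:C%C * w)),
    modulus (a (r%:C%C * w)) <= r^-1 & modulus (b (r%:C%C * w)) <= B * r ^+ D].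
  rewrite /T !ge_max => /andP[/andP[rs0 rrho] /andP[/andP[rs3 rs4] rs5]].
  have r0 : 0 < r by lra.
  have zr := modulus_ray w1 (ltW r0); split.
  - by apply: FD; rewrite zr.
  - rewrite /a modulusM modulus_cexp.
    have Hq := qk r rs0; rewrite hornerN cReN in Hq.
    have HA := uA (r%:C%C * w); rewrite zr in HA; have {}HA := HA rs4.
    apply: (@le_trans _ _ (A * r ^+ E * expR (- (k * r)))).
      by apply: ler_pM; rewrite ?modulus_ge0 ?expR_ge0// ler_expR; lra.
    rewrite expRN ler_pdivrMr ?expR_gt0// ler_pdivlMl// mulrCA -exprS.
    exact: H5.
  - by have := uB (r%:C%C * w); rewrite zr; apply.
have [A' A'0 [n H']] := ray_polynomial_bound w1 T1 H.
by exists A' => //; exists n, T.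
Qed.

End Rays.

(** * Contradiction when q is not constant *)
Section Assembly.
Context {R : realType}.
Local Notation C := (Cplx R).
Implicit Types (z w h u v a : C) (f g F : C -> C) (p d q : {poly C}).

Lemma is_derive1_rational p d z : d.[z] != 0 ->
  is_derive z 1 (fun w => p.[w] / d.[w])
    ((p^`() * d - p * d^`()).[z] / d.[z] ^+ 2).
Proof.
move=> dz; apply: is_derive1_eq (is_derive1M (is_derive1_horner p z)
  (is_derive1V (f := fun w => d.[w]) dz (is_derive1_horner d z))) _ _ => //.
by rewrite hornerD hornerN !hornerM; field.
Qed.

Lemma twice_derivable_rational p d z : d.[z] != 0 ->
  twice_derivable (fun w => p.[w] / d.[w]) z.
Proof.
move=> dz; apply: twice_derivableM; first exact: twice_derivable_horner.
apply: (twice_derivableV (f := fun w => d.[w])) => //.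
exact: twice_derivable_horner.
Qed.

Lemma bounded_on_disc f (r : R) : (forall z, {for z, continuous f}) ->
  exists2 A : R, 0 <= A & forall z, modulus z <= r -> modulus (f z) <= A.
Proof.
move=> fc; have [r0|r0] := ltP r 0.
  by exists 0 => // z zr; have := modulus_ge0 z; lra.
pose K : set C := [set z | modulus z <= r].
have Kc : compact K.
  apply: (@compact_disc _ r) => //; exact: closed_sublevel continuous_modulus.
have K0 : K !=set0 by exists 0; rewrite /K /= modulus0.
have mfc : {within K, continuous (fun z => modulus (f z))}.
  apply: continuous_subspaceT => z.
  exact: (@continuous_comp _ _ _ f (@modulus R) z (fc z) (@continuous_modulus R
    _)).
have [c _ cP] := compact_EVT_max K0 Kc mfc.
by exists (modulus (f c)) => [|z zr]; [exact: modulus_ge0|apply: cP;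
  rewrite inE].
Qed.

(** [F] can only have poles at the finitely many roots of [d], so one power of [d] removes them all;
    each root is handled for all large exponents so that a common one exists. *)
Lemma meromorphic_mul_continuous F d : d != 0 -> meromorphic F ->
  (forall z, d.[z] != 0 -> {for z, continuous F}) ->
  exists n : nat, forall z, {for z, continuous (fun w => (d ^+ n).[w] * F w)}.
Proof.
move=> d0 Fm Fc.
have dnc n z : {for z, continuous (fun w => (d ^+ n).[w])}.
  exact: is_derive1_continuous (is_derive1_horner (d ^+ n) z).
have cont_ok n z : {for z, continuous F} ->
    {for z, continuous (fun w => (d ^+ n).[w] * F w)}.
  by move=> Fz; exact: (continuousM (dnc n z) Fz).
have single a : exists n : nat, forall k, (n <= k)%N ->
    {for a, continuous (fun w => (d ^+ k).[w] * F w)}.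
  have [da|da] := eqVneq d.[a] 0; last by exists 0%N => k _;
    exact: cont_ok (Fc a da).
  case: (Fm a) => [/holomorphic_at_continuous Fa|];
    first by exists 0%N => k _; exact: cont_ok.
  move=> [n [n0 [g [/holomorphic_at_continuous gc _ Fg]]]].
  (* One more than the order of the pole: the product then tends to 0 at [a], in agreement with its
     actual value there, where [d] vanishes and [F a] is arbitrary. *)
  exists n.+1 => k nk.
  have /factor_theorem[e dE] : root d a by apply/eqP.
  have kn0 : (0 < k - n)%N by rewrite subn_gt0.
  pose P := e ^+ k * ('X - a%:P) ^+ (k - n).
  have Pc : {for a, continuous (fun w => P.[w] * g w)}.
    exact: (continuousM (is_derive1_continuous (is_derive1_horner P a)) gc).
  apply: near_eq_continuous Pc; move: Fg => /dnbhs_modulusP[r r0 Fg].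
  apply/nbhs_modulusP; exists r => // w wr.
  have [->|wa] := eqVneq w a.
    rewrite /P dE !horner_exp !hornerM !horner_exp hornerXsubC subrr mulr0.
    have k0 : (0 < k)%N by exact: leq_trans nk.
    by rewrite !expr0n (gtn_eqF kn0) (gtn_eqF k0) mulr0 !mul0r.
  have wa0 : (w - a) ^+ n != 0 by rewrite expf_neq0// subr_eq0.
  rewrite Fg// /P dE exprMn hornerM [in RHS]hornerM !horner_exp hornerXsubC.
  have -> : (w - a) ^+ k = (w - a) ^+ n * (w - a) ^+ (k - n).
    by rewrite -exprD subnKC// ltnW.
  by field.
have [rs rsP] : exists rs : seq C, forall a, d.[a] = 0 -> a \in rs.
  have [rs dE] := closed_field_poly_normal d; exists rs => a.
  rewrite dE hornerZ => /eqP; rewrite mulf_eq0 lead_coef_eq0 (negbTE d0) /=.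
  by rewrite horner_prod => /eqP H; rewrite -root_prod_XsubC; apply/eqP;
    rewrite horner_prod.
have [n nP] : exists n : nat, forall a, a \in rs -> forall k, (n <= k)%N ->
    {for a, continuous (fun w => (d ^+ k).[w] * F w)}.
  elim: rs {rsP} => [|a rs [n IH]]; first by exists 0%N.
  have [m mP] := single a; exists (maxn m n) => b; rewrite inE.
  move=> /orP[/eqP->|brs] k; rewrite geq_max => /andP[mk nk]; first exact: mP.
  exact: IH.
exists n => z; have [/rsP zrs|/Fc] := eqVneq d.[z] 0; first exact: nP zrs _ _.
exact: cont_ok.
Qed.

Lemma modulus_unit_root (kap w : C) (N : nat) : (0 < N)%N ->
  modulus kap = 1 -> kap * w ^+ N = -1 -> modulus w = 1.
Proof.
move=> N0 kap1 /(congr1 (@modulus R)).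
rewrite modulusM kap1 mul1r modulusN modulus1 modulusX => wN.
by apply/eqP; rewrite -(@eqrXn2 _ N)// ?modulus_ge0// wN expr1n.
Qed.

(* The direction [kap] of the sectors is chosen so that no boundary ray is
   critical for [q], i.e. on none of them [Re (a w^n)] vanishes. *)
Lemma noncritical_rotation a (n N : nat) : a != 0 -> (0 < n)%N -> (0 < N)%N ->
  exists2 kap : C, modulus kap = 1 & forall w, kap * w ^+ N = -1 ->
    complex.Re (a * w ^+ n) != 0.
Proof.
(* If [Re (a w^n) = 0] with [|w| = 1], then [(a w^n)^2 = - |a|^2] determines [w^(2n)], and its
   [N]-th power is [b]. With [kap w^N = -1] this forces [kap^(2n) b = 1], which is avoided by
   [kap = 1] or, when [b = 1], by a [2n]-th root of [-1]. *)
move=> a0 n0 N0; pose b : C := (- ((modulus a ^+ 2)%:C%C) / a ^+ 2) ^+ N.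
have n20 : (0 < n * 2)%N by rewrite muln_gt0 n0.
have [kap kap1 kapb] : exists2 kap : C, modulus kap = 1 &
    kap ^+ (n * 2) * b != 1.
  have [b1|b1] := eqVneq b 1; last by exists 1;
    rewrite ?modulus1 ?expr1n ?mul1r.
  exists ((n * 2)%N.-root (-1)); last first.
    by rewrite rootCK// b1 mulr1 -subr_eq0 -opprD oppr_eq0 (_ : 1 + 1 = 2)//
      pnatr_eq0.
  apply/eqP; rewrite -(@eqrXn2 _ (n * 2))// ?modulus_ge0// -modulusX rootCK//.
  by rewrite modulusN modulus1 expr1n.
exists kap => // w wN; apply: contraNneq kapb => R0.
have w1 := modulus_unit_root N0 kap1 wN.
have sq : (a * w ^+ n) ^+ 2 = - (modulus a ^+ 2)%:C%C.
  have := modulus_sqr (a * w ^+ n);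
    rewrite modulusM modulusX w1 expr1n mulr1 => ->.
  move: R0; case: (a * w ^+ n) => x y /= ->.
  apply/eqP; rewrite eq_complex !expr2 /=.
  by apply/andP; split; apply/eqP; ring.
have wb : w ^+ (n * 2) = - (modulus a ^+ 2)%:C%C / a ^+ 2.
  by rewrite -sq exprMn -exprM [a ^+ 2 * _]mulrC mulfK// expf_neq0.
by rewrite /b -wb exprAC -exprMn wN mulnC exprM sqrrN !expr1n.
Qed.

Lemma uniform_on_seq (s : seq C) (P : C -> R -> nat -> Prop) :
  (forall a (A B : R) (n m : nat),
    P a A n -> A <= B -> (n <= m)%N -> P a B m) ->
  (forall a, a \in s -> exists2 A : R, 0 <= A & exists n, P a A n) ->
  exists2 A : R, 0 <= A & exists n, forall a, a \in s -> P a A n.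
Proof.
move=> Pmono; elim: s => [|a s IH] H; first by exists 0 => //; exists 0%N.
have [A A0 [n aP]] := H a (mem_head _ _).
have [B B0 [m bP]] : exists2 A : R, 0 <= A & exists n, forall a,
  a \in s -> P a A n.
  by apply: IH => b bs; apply: H; rewrite inE bs orbT.
exists (A + B); first exact: addr_ge0.
exists (maxn n m) => b; rewrite inE => /orP[/eqP->|/bP bB].
  by apply: Pmono aP _ _; rewrite ?lerDl ?leq_maxl.
by apply: Pmono bB _ _; rewrite ?lerDr ?leq_maxr.
Qed.

(** Along the ray [e^q] is exponentially large and [p] is bounded below, while [d] grows only
    polynomially. *)
Lemma exp_poly_not_rational q p d w : p != 0 -> modulus w = 1 ->
  (1 < size q)%N -> 0 < complex.Re (lead_coef q * w ^+ (size q).-1) ->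
  forall r0 : R,
  ~ forall r : R, r0 <= r ->
    cexp q.[r%:C%C * w] * p.[r%:C%C * w] = d.[r%:C%C * w].
Proof.
move=> p0 w1 sq l0 r0 H.
have [k k0 [s0 s01 qk]] := Re_horner_ray w1 sq l0.
have [c c0 [s1 s11 pc]] := horner_lower_const p0.
have [A A0 dA] := horner_growth d; set n := (size d).-1 in dA.
have [s2 s21 H2] := expR_dominates ((A + 1) / c) n k0.
pose r := Num.max (Num.max r0 s0) (Num.max s1 s2).
have [rr0 rs0 rs1 rs2] : [/\ r0 <= r, s0 <= r, s1 <= r & s2 <= r].
  by rewrite /r !le_max !lexx ?orbT.
have r_gt0 : 0 < r by lra.
have zr := modulus_ray w1 (ltW r_gt0).
have := congr1 (@modulus R) (H r rr0); rewrite modulusM modulus_cexp => E.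
have h1 := pc (r%:C%C * w); rewrite zr in h1; have {}h1 := h1 rs1.
have h2 := dA (r%:C%C * w); rewrite zr in h2;
  have {}h2 := h2 (le_trans s01 rs0).
have h3 : expR (k * r) <= expR (complex.Re q.[r%:C%C * w]) by rewrite ler_expR
  qk.
have h4 := H2 r rs2.
have h5 : (A + 1) / c * r ^+ n * c <= modulus d.[r%:C%C * w].
  rewrite -E; apply: ler_pM => //; last exact: le_trans h3.
    by rewrite mulr_ge0 ?exprn_ge0 ?divr_ge0//; lra.
  exact: ltW.
have rn : 0 < r ^+ n by rewrite exprn_gt0.
have : (A + 1) * r ^+ n <= A * r ^+ n.
  apply: le_trans h2; apply: le_trans h5.
  by rewrite mulrAC divfK// gt_eqF.
by rewrite ler_pM2r//; lra.
Qed.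

Lemma linear_ode_no_finite_order_solution F p1 d1 p2 d2 q :
  p1 != 0 -> d1 != 0 -> d2 != 0 -> (1 < size q)%N ->
  meromorphic F -> finite_order F -> nonconstant F ->
  (forall z, (d1 * d2).[z] != 0 -> is_derive z 1 F
     (p1.[z] / d1.[z] * cexp q.[z] * F z + p2.[z] / d2.[z])) -> False.
Proof.
move=> p10 d10 d20 sq Fm Ford Fnc FD.
pose d := d1 * d2; have d0 : d != 0 by rewrite mulf_neq0.
have d_neq0 z : d.[z] != 0 -> d1.[z] != 0 /\ d2.[z] != 0.
  by rewrite hornerM mulf_eq0 negb_or => /andP.
(* The right-hand side of the equation serves as the first derivative and is itself differentiable
   at [z]. *)
have FT z : d.[z] != 0 -> twice_derivable F z.
  move=> dz; exists (fun z => p1.[z] / d1.[z] * cexp q.[z] * F z + p2.[z] /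
    d2.[z]).
  have [d1z d2z] := d_neq0 z dz.
  have [D1 HD1] := twice_derivable_derive (twice_derivable_rational p1 d1z).
  have [D2 HD2] := twice_derivable_derive (twice_derivable_rational p2 d2z).
  have HE := is_derive1_comp (is_derive1_horner q z) (is_derive1_cexp _).
  eexists; split; last first.
    exact: is_derive1D (is_derive1M (is_derive1M HD1 HE) (FD z dz)) HD2.
  have : \forall w \near z, d.[w] != 0.
    exact: nbhs_neq0 (is_derive1_continuous (is_derive1_horner d z)) dz.
  by apply: filterS => w; exact: FD.
have Fc z : d.[z] != 0 -> {for z, continuous F}.
  by move=> dz; exact: twice_derivable_continuous (FT z dz).
have [K Gc] := meromorphic_mul_continuous d0 Fm Fc.
pose P := d ^+ K; have P0 : P != 0 by rewrite expf_neq0.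
have Pd z : d.[z] != 0 -> P.[z] != 0.
  by move=> dz; rewrite horner_exp expf_neq0.
pose G z := P.[z] * F z.
have GT z : d.[z] != 0 -> twice_derivable G z.
  by move=> /FT; exact: twice_derivableM (twice_derivable_horner P z).
have [cd cd0 [rd rd1 dlb]] := horner_lower_const d0.
have dfar z : rd <= modulus z -> d.[z] != 0.
  by move=> zr; rewrite -modulus_gt0; apply: lt_le_trans (dlb z zr).
have [k [rk Ggrow]] := finite_order_growth d0 Gc GT (fun z zr =>
  Fc z (dfar z zr)) Ford.
have [cP cP0 [rP rP1 Plb]] := horner_lower_const P0.
(* Dividing [G] by [P] costs the factor [cP^-1], which the additional power of [modulus z]
   absorbs. *)
have Fgrow : exists2 r0 : R, rd <= r0 & forall z, r0 <= modulus z ->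
    modulus (F z) <= expR (modulus z ^+ k.+1).
  exists (Num.max (Num.max rd rk) (Num.max rP (1 + cP^-1))).
    by rewrite !le_max lexx.
  move=> z; rewrite !ge_max => /andP[/andP[zd zk] /andP[zP zc]].
  have := Ggrow z zk; rewrite modulusM => H.
  have Pz := Plb z zP; have z1 : 1 <= modulus z by apply: le_trans zd.
  have Fz : cP * modulus (F z) <= expR (modulus z ^+ k).
    by apply: le_trans H; rewrite ler_wpM2r ?modulus_ge0.
  have X1 : 1 <= modulus z ^+ k by rewrite exprn_ege1.
  have cI : cP^-1 <= expR (cP^-1) by apply: le_trans (expR_ge1Dx _); lra.
  have {}Fz : modulus (F z) <= expR (modulus z ^+ k) * cP^-1.
    by rewrite ler_pdivlMr// mulrC.
  apply: le_trans Fz _; apply: (@le_trans _ _ (expR (modulus z ^+ k) * expR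
    (cP^-1))).
    by rewrite ler_wpM2l// expR_ge0.
  rewrite -expRD ler_expR exprS.
  have : 0 <= cP^-1 by rewrite invr_ge0 ltW.
  nra.
have [r0 rdr0 {}Fgrow] := Fgrow.
pose n := (size q).-1; have n0 : (0 < n)%N by rewrite /n -subn1 subn_gt0.
have a0 : lead_coef q != 0 by rewrite lead_coef_eq0 -size_poly_gt0 (ltn_trans _
  sq).
have Dfar z : r0 <= modulus z -> is_derive z 1 F
     (p1.[z] / d1.[z] * cexp q.[z] * F z + p2.[z] / d2.[z]).
  by move=> zr; apply: FD; apply: dfar; apply: le_trans zr.
(* The growth exponent [k] itself indexes the sectors, as [k < 2 ^ k]. *)
pose N := (2 ^ k.+2)%N; have N0 : (0 < N)%N by rewrite expn_gt0.
have [kap kap1 kapP] := noncritical_rotation a0 n0 N0.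
pose Pray w (A : R) (m : nat) := kap * w ^+ N = -1 -> forall r : R, 0 <= r ->
  modulus (G (r%:C%C * w)) <= A * (1 + r) ^+ m.
have Pray_mono w (A B : R) m m' : Pray w A m -> A <= B -> (m <= m')%N -> Pray w
  B m'.
  move=> H AB mm wN r rge0; apply: le_trans (H wN r rge0) _.
  have := le_trans (modulus_ge0 _) (H wN r rge0).
  have r1 : 1 <= 1 + r by rewrite lerDl.
  have X0 : 0 < (1 + r) ^+ m by rewrite exprn_gt0//; lra.
  rewrite pmulr_lge0// => A0; apply: ler_pM => //; first exact: ltW.
  exact: ler_weXn2l.
have Pray_ex w : exists2 A : R, 0 <= A & exists m, Pray w A m.
  have [wN|wN] := eqVneq (kap * w ^+ N) (-1); last first.
    by exists 0 => //; exists 0%N => /eqP; rewrite (negbTE wN).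
  have w1 := modulus_unit_root N0 kap1 wN.
  have [A A0 [m [s Fs]]] : exists2 A : R, 0 <= A & exists m, exists s : R,
      forall r : R, s <= r -> modulus (F (r%:C%C * w)) <= A * r ^+ m.
    have := kapP w wN; rewrite neq_lt => /orP[neg|pos].
      exact: (ray_polynomial_growth d10 d20 w1 sq neg Dfar).
    have [s s1 Fs] := ray_bounded_by_1 p10 d10 d20 w1 sq pos Dfar Fgrow.
    exists 1 => //; exists 0%N, s => r rs; rewrite expr0 mulr1; exact: Fs.
  have [B B0] := horner_growth P; move: (size P).-1 => e1 PB.
  pose s' := Num.max 1 s; have [D D0 GD] := bounded_on_disc s' Gc.
  exists (A * B + D); first by rewrite addr_ge0 ?mulr_ge0.
  exists (m + e1)%N => _ r rge0; have zr := modulus_ray w1 rge0.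
  have r1 : 1 <= (1 + r) ^+ (m + e1) by rewrite exprn_ege1// lerDl.
  have [rs|rs] := leP r s'.
    have := GD (r%:C%C * w); rewrite zr => /(_ rs) => /le_trans; apply.
    rewrite mulrDl; apply: (@le_trans _ _ (D * (1 + r) ^+ (m + e1))).
      by rewrite ler_peMr.
    by rewrite lerDr !mulr_ge0// (le_trans ler01).
  move: rs; rewrite /s' gt_max => /andP[r1' rs].
  rewrite /G modulusM; have := PB (r%:C%C * w); rewrite zr => /(_ (ltW r1')) H1.
  have H2 := Fs r (ltW rs).
  apply: (@le_trans _ _ (B * r ^+ e1 * (A * r ^+ m))).
    by rewrite ler_pM ?modulus_ge0.
  have -> : B * r ^+ e1 * (A * r ^+ m) = A * B * r ^+ (m + e1).
    by rewrite exprD; ring.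
  set e := (m + e1)%N in r1 *.
  have AB0 : 0 <= A * B by apply: mulr_ge0.
  have re : r ^+ e <= (1 + r) ^+ e.
    by apply: lerXn2r; rewrite ?nnegrE ?addr_ge0 ?lerDr.
  apply: (@le_trans _ _ (A * B * (1 + r) ^+ e)); first exact: ler_wpM2l.
  apply: ler_wpM2r; first exact: le_trans ler01 r1.
  by rewrite lerDl.
have [rs rsP] : exists rs : seq C, forall w, kap * w ^+ N = -1 -> w \in rs.
  pose p : {poly C} := kap *: 'X^N + 1.
  have kap0 : kap != 0 by rewrite -modulus_gt0 kap1.
  have p0 : p != 0.
    apply: contraTneq (oner_neq0 C) => H;
      have := congr1 (fun p : {poly C} => p.[0]) H.
    rewrite /p hornerD hornerZ hornerXn expr0n gtn_eqF// mulr0 add0r hornerC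
      horner0.
    by move=> ->; rewrite eqxx.
  have [rs pE] := closed_field_poly_normal p; exists rs => w wN.
  have : p.[w] = 0 by rewrite /p hornerD hornerZ hornerXn hornerC wN addNr.
  rewrite pE hornerZ => /eqP; rewrite mulf_eq0 lead_coef_eq0 (negbTE p0) /=.
  by move=> H; rewrite -root_prod_XsubC.
have [A A0 [M AP]] := uniform_on_seq Pray_mono (fun w (_ : w \in rs) =>
  Pray_ex w).
have Gray z : kap * z ^+ N = - (modulus z ^+ N)%:C%C ->
    modulus (G z) <= (A + modulus (G 0)) * (1 + modulus z) ^+ M.
  have G00 := modulus_ge0 (G 0).
  have [->|z0] := eqVneq z 0.
    by move=> _; rewrite modulus0 addr0 expr1n mulr1 lerDr.
  move=> zN; pose w := z / (modulus z)%:C%C.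
  have mz : 0 < modulus z by rewrite modulus_gt0.
  have mzC : ((modulus z)%:C%C : C) != 0.
    by rewrite -modulus_eq0 modulus_real gtr0_norm// gt_eqF.
  have wN : kap * w ^+ N = -1.
    rewrite /w expr_div_n mulrA zN -rmorphXn mulNr divff// rmorphXn.
    exact: expf_neq0.
  have zE : z = (modulus z)%:C%C * w by rewrite /w mulrC divfK.
  have := AP w (rsP w wN) wN (modulus z) (ltW mz); rewrite -zE => H.
  apply: le_trans H _; rewrite ler_wpM2r ?exprn_ge0 ?addr_ge0 ?(ltW mz)//.
  by rewrite lerDl.
have A00 : 0 <= A + modulus (G 0) by rewrite addr_ge0 ?modulus_ge0.
have [B B0 GB] := phragmen_lindelof d0 Gc GT (ltn_expl k (ltnSn 1)) kap1 A00
  Ggrow Gray.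
have [z z1|g gE] := @polynomial_growth_liouville R M.+1 G d (B * 2 ^+ M) 1 d0
  Gc GT.
  have mz : 0 < modulus z by lra.
  rewrite exprS mulrCA ler_pM2l// -mulrA -exprMn; apply: le_trans (GB z) _.
  apply: ler_wpM2l => //.
  by apply: lerXn2r; rewrite ?nnegrE; move: z1 mz; clear; lra.
(* If [g = 0], then [F] vanishes off the roots of [d], and by continuity at the roots that are not
   poles, so it is constant. *)
have g0 : g != 0.
  apply/eqP => g0; apply: Fnc; exists 0.
  have F0 z : d.[z] != 0 -> F z = 0.
    move=> dz; have := gE z; rewrite g0 horner0 /G => /eqP.
    by rewrite mulf_eq0 (negbTE (Pd z dz)) => /eqP.
  move=> z zp; have [dz|] := eqVneq d.[z] 0; last exact: F0.
  case: (Fm z) => // /holomorphic_at_continuous Fz.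
  apply: (@continuous_dnbhs_unique _ F (fun=> 0) z Fz).
    exact: cst_continuous.
  by apply: filterS (poly_nbhs_neq0 z d0) => w; exact: F0.
(* In this direction the leading term of [q] is a positive real number. *)
have [w0 w0n] : exists w : C,
  w ^+ n = conjc (lead_coef q) / (modulus (lead_coef q))%:C%C.
  by exists (n.-root (conjc (lead_coef q) / (modulus (lead_coef q))%:C%C));
    rewrite rootCK.
have l0 : 0 < modulus (lead_coef q) by rewrite modulus_gt0.
have w01 : modulus w0 = 1.
  apply/eqP; rewrite -(@eqrXn2 _ n)// ?modulus_ge0// expr1n -modulusX w0n.
  by rewrite modulusf_div modulus_conj modulus_real gtr0_norm// divff// gt_eqF.
have pos : 0 < complex.Re (lead_coef q * w0 ^+ (size q).-1).
  rewrite -/n w0n mulrA [lead_coef q * _]mulrC -rmorphV ?unitfE ?gt_eqF//=.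
  by rewrite cReM_real Re_conjM mulr_gt0 ?exprn_gt0 ?invr_gt0.
have X0 : p1 * d2 * (g * P) != 0 by rewrite !mulf_neq0.
(* Inserting [F = g / P] into the equation and multiplying by [P^2 d1 d2] leaves [e^q] times a
   nonzero polynomial equal to a polynomial. *)
apply: (@exp_poly_not_rational q (p1 * d2 * (g * P))
  ((g^`() * P - g * P^`()) * (d1 * d2) - p2 * d1 * (P * P)) w0 X0 w01 sq pos
    rd).
move=> r rr; have r_ge0 : 0 <= r by lra.
have zr := modulus_ray w01 r_ge0; set z : C := r%:C%C * w0 in zr *.
have dz : d.[z] != 0 by apply: dfar; rewrite zr.
have [d1z d2z] := d_neq0 z dz; have Pz := Pd z dz.
have near_g : \forall w \near z, g.[w] / P.[w] = F w.
  have : \forall w \near z, d.[w] != 0.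
    exact: nbhs_neq0 (is_derive1_continuous (is_derive1_horner d z)) dz.
  by apply: filterS => w /Pd Pw; rewrite -gE /G mulrC mulKf.
have gD := near_eq_is_derive1 near_g (is_derive1_rational g Pz).
have := is_derive1_unique gD (FD z dz).
have -> : F z = g.[z] / P.[z] by rewrite -gE /G mulrC mulKf.
rewrite hornerD hornerN !hornerM => H.
rewrite hornerD hornerN !hornerM hornerD hornerN !hornerM.
have P2 : P.[z] ^+ 2 != 0 by rewrite expf_neq0.
have -> : g^`().[z] * P.[z] - g.[z] * P^`().[z] =
  (g^`().[z] * P.[z] - g.[z] * P^`().[z]) / P.[z] ^+ 2 * P.[z] ^+ 2.
  by rewrite divfK.
by rewrite H; field; rewrite Pz d1z d2z.
Qed.

End Assembly.

Theorem theorem3p1 (R : realType) (R1 R2 : Cplx R -> Cplx R)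
    (q : {poly Cplx R}) (F : Cplx R -> Cplx R)
    (hR1 : rational_function R1) (hR2 : rational_function R2)
    (hR1_neq0 : exists z, R1 z <> 0)
    (hF : meromorphic F) (hF_nonconst : nonconstant F)
    (hF_order : finite_order F)
    (hF_eq : forall z, ~ pole F z -> ~ pole R1 z -> ~ pole R2 z ->
       derive1 F z = R1 z * cexp q.[z] * F z + R2 z) :
  exists c : Cplx R, q = c%:P.
Proof.
have [sq|sq] := leqP (size q) 1; first by exists q`_0; exact: size1_polyC.
have [p1 [d1 [d10 _ R1E]]] := hR1; have [p2 [d2 [d20 _ R2E]]] := hR2.
(* With [R1 = 0] the equation would not see [q]; a nonzero numerator is what makes [e^q] rational in
   the end. *)
have p10 : p1 != 0.
  have [z] := hR1_neq0; rewrite R1E; apply: contra_notN => /eqP ->.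
  by rewrite horner0 mul0r.
have {}R1E : R1 = (fun z => p1.[z] / d1.[z]) by apply/funext.
have {}R2E : R2 = (fun z => p2.[z] / d2.[z]) by apply/funext.
have R1c z : d1.[z] != 0 -> {for z, continuous R1}.
  by rewrite R1E => /(is_derive1_rational p1); exact: is_derive1_continuous.
have R2c z : d2.[z] != 0 -> {for z, continuous R2}.
  by rewrite R2E => /(is_derive1_rational p2); exact: is_derive1_continuous.
have dneq0 z : (d1 * d2).[z] != 0 -> d1.[z] != 0 /\ d2.[z] != 0.
  by rewrite hornerM mulf_eq0 negb_or => /andP.
have eqn z : (d1 * d2).[z] != 0 -> ~ pole F z ->
    derive1 F z = R1 z * cexp q.[z] * F z + R2 z.
  move=> /dneq0[/R1c/continuous_not_pole h1 /R2c/continuous_not_pole h2] h.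
  exact: hF_eq.
(* Both coefficients are continuous at such a point, and the equation is available at nearby points
   that are not poles. *)
have no_pole z : (d1 * d2).[z] != 0 -> ~ pole F z.
  move=> dz; have [d1z d2z] := dneq0 z dz.
  have Ec : {for z, continuous (fun w => cexp q.[w])}.
    exact: is_derive1_continuous
      (is_derive1_comp (is_derive1_horner q z) (is_derive1_cexp _)).
  apply: (linear_ode_no_pole (a := fun w => R1 w * cexp q.[w]) (b := R2)).
  - exact: (continuousM (R1c z d1z) Ec).
  - exact: R2c.
  - have /(poly_nbhs_neq0 z) : d1 * d2 != 0 by rewrite mulf_neq0.
    by apply: filterS => w; exact: eqn.
exfalso; apply: (linear_ode_no_finite_order_solution
  p10 d10 d20 sq hF hF_order hF_nonconst) => z dz.
(* Not being a pole, [z] is a point of differentiability, so [derive1 F z] is a genuine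
   derivative. *)
have Fnp := no_pole z dz; case: (hF z) => [/nbhs_modulusP[r r0 Fd]|] //.
have /derivableP : derivable F z 1 by apply: Fd; rewrite subrr modulus0.
by rewrite -derive1E eqn// R1E R2E; apply.
Qed.
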